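(* Let $\mathfrak{K}\in C^1([-1,1])$ be such that $\mathfrak{K}<0$ on $[-1,1]$. The rotational $\mathfrak{K}$-surfaces are classified as follows: 1. For each $x_0>0$, a $\mathfrak{K}$-surface diffeomorphic to $\mathbb{S}^1\times(0,1)$, having as boundary circumferences of certain radii, and whose waist (the smallest circumference) has radius $x_0$. 2. For each $\nu_0\in(-1,1)$, $\nu_0\neq 0$, a simply connected $\mathfrak{K}$-surface that intersects the axis of rotation with angle function equal to $\nu_0$, and has as boundary a circumference of a certain radius. 3. Two $\mathfrak{K}$-surfaces diffeomorphic to $\mathbb{S}^1\times(0,1)$, for each of which one end is unbounded and converges to the $z$-axis, and the other has as boundary a circumference of a certain radius. Moreover, the boundary circumferences consist of singular points that do not belong to any $\mathfrak{K}$-surface.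
   Context: An immersed, oriented surface $\Sigma$ in $\mathbb{R}^3$ with Gauss map $\eta$ is a $\mathfrak{K}$-surface if its Gauss curvature satisfies $K_\Sigma(p)=\mathfrak{K}(\langle\eta_p,e_3\rangle)$ for every $p\in\Sigma$, where $e_3=(0,0,1)$; $\nu=\langle\eta,e_3\rangle$ is the angle function. Rotational surfaces have the $z$-axis as axis of rotation and are generated by arc-length parametrized curves $\alpha(s)=(x(s),0,z(s))$, $x\ge 0$, with $x'=\cos\theta$, $z'=\sin\theta$; with the chosen orientation the angle function is $\nu=x'(s)=\cos\theta(s)$, and the $\mathfrak{K}$-surface condition reads $\theta'=x\,\mathfrak{K}(\cos\theta)/\sin\theta$ wherever $\sin\theta\neq 0$. If $(x,z,\theta)$ is a solution so is $(x,-z,2\pi-\theta)$ (reflection in a horizontal plane), so $\theta$ is taken in $(0,\pi)$; the rotational $\mathfrak{K}$-surfaces considered are those generated by the maximal solutions (orbits) $(x(s),\theta(s))\in[0,\infty)\times(0,\pi)$ of $$x'=\cos\theta,\qquad \theta'=\frac{x\,\mathfrak{K}(\cos\theta)}{\sin\theta},$$ with $z$ determined up to a vertical translation. The solution $x\equiv0,\ \theta\equiv\pi/2$ does not generate a surface. Surfaces as in item 2 meet the axis at a cusp point (where they fail to be $C^1$). The boundary circumferences are the limits of the surface where $\theta\to 0$ or $\theta\to\pi$ at a finite positive distance to the axis. *)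

(* Defs.v *)
(* Real numbers of the standard library, with Coquelicot. *)
From Stdlib Require Export Reals.
From Coquelicot Require Export Coquelicot.
Open Scope R_scope.

(** * Euclidean space *)

Notation R2 := (R * R)%type.
Notation R3 := (R * R * R)%type.

Definition c1 (p : R3) : R := fst (fst p).
Definition c2 (p : R3) : R := snd (fst p).
Definition c3 (p : R3) : R := snd p.

Definition dot (p q : R3) : R := c1 p * c1 q + c2 p * c2 q + c3 p * c3 q.

Definition cross (p q : R3) : R3 :=
  (c2 p * c3 q - c3 p * c2 q,
   c3 p * c1 q - c1 p * c3 q,
   c1 p * c2 q - c2 p * c1 q).

Definition e3 : R3 := (0, 0, 1).

Definition closure {T : UniformSpace} (A : T -> Prop) (p : T) : Prop :=
  forall P : T -> Prop, locally p P -> exists q, P q /\ A q.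

(** * Differentiability *)

(* [f'(s) = l] relative to [I]: one-sided at an endpoint belonging to [I]. *)
Definition deriv_within (I : R -> Prop) (f : R -> R) (s l : R) : Prop :=
  filterlim (fun t => (f t - f s) / (t - s))
            (within (fun t => I t /\ t <> s) (locally s)) (locally l).

Definition C1_on (I : R -> Prop) (f : R -> R) : Prop :=
  exists df : R -> R,
    (forall s, I s -> deriv_within I f s (df s)) /\ continuous_on I df.

Definition dder {V : NormedModule R_AbsRing} (v : V) (f : V -> R) (p : V) : R :=
  Derive (fun t : R => f (plus p (scal t v))) 0.

(* Class [C^k] on an open set.  All directional derivatives are used in place
   of those along a basis; [V] is only instantiated with [R2] and [R3]. *)
Fixpoint Ck {V : NormedModule R_AbsRing} (k : nat) (U : V -> Prop) (f : V -> R)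
    : Prop :=
  (forall p, U p -> continuous f p) /\
  match k with
  | O => True
  | S k' => forall v : V,
      (forall p, U p -> ex_derive (fun t : R => f (plus p (scal t v))) 0) /\
      Ck k' U (dder v f)
  end.

Definition Ck3 {V : NormedModule R_AbsRing} (k : nat) (U : V -> Prop)
    (F : V -> R3) : Prop :=
  Ck k U (fun p => c1 (F p)) /\ Ck k U (fun p => c2 (F p)) /\
  Ck k U (fun p => c3 (F p)).

(* Subsets of [R3] are diffeomorphic when there are mutually inverse bijections
   between them that are restrictions of maps of class [C^2] on open sets;
   [C^2] is the class of the surfaces below. *)
Definition diffeomorphic (A B : R3 -> Prop) : Prop :=
  exists (F G : R3 -> R3) (U V : R3 -> Prop),
    open U /\ open V /\
    (forall p, A p -> U p) /\ (forall q, B q -> V q) /\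
    Ck3 2 U F /\ Ck3 2 V G /\
    (forall p, A p -> B (F p) /\ G (F p) = p) /\
    (forall q, B q -> A (G q) /\ F (G q) = q).

(* S^1 x (0,1) *)
Definition open_cylinder (p : R3) : Prop :=
  c1 p ^ 2 + c2 p ^ 2 = 1 /\ 0 < c3 p < 1.

(** * Simple connectedness *)

Definition I01 (t : R) : Prop := 0 <= t <= 1.

Definition path_in (A : R3 -> Prop) (g : R -> R3) : Prop :=
  continuous_on I01 g /\ forall t, I01 t -> A (g t).

Definition simply_connected (A : R3 -> Prop) : Prop :=
  (exists p, A p) /\
  (forall p q, A p -> A q ->
     exists g, path_in A g /\ g 0 = p /\ g 1 = q) /\
  (forall g, path_in A g -> g 0 = g 1 ->
     exists H : R2 -> R3,
       continuous_on (fun q => I01 (fst q) /\ I01 (snd q)) H /\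
       (forall t u, I01 t -> I01 u -> A (H (t, u))) /\
       (forall u, I01 u -> H (0, u) = g u /\ H (1, u) = g 0) /\
       (forall t, I01 t -> H (t, 0) = g 0 /\ H (t, 1) = g 0)).

(** * Immersed oriented surfaces

    Every condition imposed on surfaces is local, so an immersed oriented
    surface is given by its parametrizations [Y], defined on open sets [U] of
    the plane.  The orientation is that of the parametrization; the opposite
    one is obtained by exchanging the two parameters. *)

Definition pder (v : R2) (Y : R2 -> R3) (q : R2) : R3 :=
  (dder v (fun w : R2 => c1 (Y w)) q,
   dder v (fun w : R2 => c2 (Y w)) q,
   dder v (fun w : R2 => c3 (Y w)) q).

Definition du (Y : R2 -> R3) : R2 -> R3 := pder (1, 0) Y.
Definition dv (Y : R2 -> R3) : R2 -> R3 := pder (0, 1) Y.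

Definition immersed_surface (U : R2 -> Prop) (Y : R2 -> R3) : Prop :=
  open U /\ Ck3 2 U Y /\
  forall q, U q -> cross (du Y q) (dv Y q) <> (0, 0, 0).

Definition gauss_map (Y : R2 -> R3) (q : R2) : R3 :=
  let n := cross (du Y q) (dv Y q) in
  let m := sqrt (dot n n) in
  (c1 n / m, c2 n / m, c3 n / m).

Definition angle_function (Y : R2 -> R3) (q : R2) : R :=
  dot (gauss_map Y q) e3.

Definition gauss_curvature (Y : R2 -> R3) (q : R2) : R :=
  let eta := gauss_map Y q in
  let E := dot (du Y q) (du Y q) in
  let F := dot (du Y q) (dv Y q) in
  let G := dot (dv Y q) (dv Y q) in
  let L := dot (du (du Y) q) eta in
  let M := dot (dv (du Y) q) eta in
  let N := dot (dv (dv Y) q) eta in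
  (L * N - M ^ 2) / (E * G - F ^ 2).

Definition K_surface (K : R -> R) (U : R2 -> Prop) (Y : R2 -> R3) : Prop :=
  immersed_surface U Y /\
  forall q, U q -> gauss_curvature Y q = K (angle_function Y q).

(** * Orbits and rotational K-surfaces *)

(* Intervals of any kind with more than one point; an orbit reaching [x = 0]
   has an interval of definition containing the corresponding endpoint. *)
Definition interval (I : R -> Prop) : Prop :=
  (forall s t u, I s -> I t -> s <= u <= t -> I u) /\
  exists s t, I s /\ I t /\ s < t.

Definition phase_solution (K : R -> R) (I : R -> Prop) (x th : R -> R) : Prop :=
  interval I /\
  forall s, I s ->
    0 <= x s /\ 0 < th s < PI /\
    deriv_within I x s (cos (th s)) /\
    deriv_within I th s (x s * K (cos (th s)) / sin (th s)).

Definition orbit (K : R -> R) (I : R -> Prop) (x th : R -> R) : Prop :=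
  phase_solution K I x th /\
  forall (J : R -> Prop) (y ph : R -> R),
    phase_solution K J y ph ->
    (forall s, I s -> J s /\ y s = x s /\ ph s = th s) ->
    forall s, J s -> I s.

(* The curve [(xc s, 0, zc s)] with angle [th s], for [s] in [dom]; the values
   of the three functions outside [dom] are irrelevant. *)
Record profile := Profile {
  dom : R -> Prop;
  xc : R -> R;
  zc : R -> R;
  th : R -> R
}.

Definition rotational_K_surface (K : R -> R) (g : profile) : Prop :=
  orbit K (dom g) (xc g) (th g) /\
  (forall s, dom g s -> deriv_within (dom g) (zc g) s (sin (th g s))) /\
  ~ (forall s, dom g s -> xc g s = 0 /\ th g s = PI / 2).

Definition rot_param (g : profile) (q : R2) : R3 :=
  (xc g (fst q) * cos (snd q), xc g (fst q) * sin (snd q), zc g (fst q)).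

Definition surface (g : profile) (p : R3) : Prop :=
  exists q : R2, dom g (fst q) /\ p = rot_param g q.

(* The parameters in the interior of [dom]: only points on the axis are lost. *)
Definition rot_dom (g : profile) (q : R2) : Prop := locally (fst q) (dom g).

Definition vertical_translate (A B : R3 -> Prop) : Prop :=
  exists c : R, forall a b d : R, B (a, b, d) <-> A (a, b, d - c).

(** * Ends and boundary circumferences *)

Definition is_end (I : R -> Prop) (e : Rbar) : Prop :=
  (forall s, e = Finite s -> ~ I s) /\
  (forall P, Rbar_locally e P -> exists s, I s /\ P s).

Definition toward (g : profile) (e : Rbar) : (R -> Prop) -> Prop :=
  within (dom g) (Rbar_locally e).

Definition circumference (r h : R) (p : R3) : Prop :=
  c1 p ^ 2 + c2 p ^ 2 = r ^ 2 /\ c3 p = h.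

Definition boundary_circumference (g : profile) (e : Rbar) (r h : R) : Prop :=
  is_end (dom g) e /\ 0 < r /\
  filterlim (xc g) (toward g e) (locally r) /\
  filterlim (zc g) (toward g e) (locally h) /\
  (filterlim (th g) (toward g e) (locally 0) \/
   filterlim (th g) (toward g e) (locally PI)).

Definition boundary (A : R3 -> Prop) (p : R3) : Prop := closure A p /\ ~ A p.

(** * The three types of surfaces *)

Definition waist_radius (g : profile) (x0 : R) : Prop :=
  exists s0, dom g s0 /\ xc g s0 = x0 /\
    forall s, dom g s -> s <> s0 -> x0 < xc g s.

Definition waist_type (x0 : R) (g : profile) : Prop :=
  diffeomorphic (surface g) open_cylinder /\
  waist_radius g x0 /\
  exists (e1 e2 : Rbar) (r1 r2 h1 h2 : R),
    e1 <> e2 /\ h1 <> h2 /\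
    boundary_circumference g e1 r1 h1 /\
    boundary_circumference g e2 r2 h2 /\
    forall p, boundary (surface g) p <->
      circumference r1 h1 p \/ circumference r2 h2 p.

Definition meets_axis_with (g : profile) (nu0 : R) : Prop :=
  exists s0, dom g s0 /\ xc g s0 = 0 /\ cos (th g s0) = nu0 /\
    forall s, dom g s -> xc g s = 0 -> s = s0.

Definition axis_type (nu0 : R) (g : profile) : Prop :=
  simply_connected (surface g) /\
  meets_axis_with g nu0 /\
  exists (e : Rbar) (r h : R),
    boundary_circumference g e r h /\
    forall p, boundary (surface g) p <-> circumference r h p.

Definition asymptotic_to_axis (g : profile) (e : Rbar) : Prop :=
  is_end (dom g) e /\
  filterlim (xc g) (toward g e) (locally 0) /\
  filterlim (fun s => Rabs (zc g s)) (toward g e) (Rbar_locally p_infty).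

Definition asymptotic_type (g : profile) : Prop :=
  diffeomorphic (surface g) open_cylinder /\
  exists (e1 e2 : Rbar) (r h : R),
    e1 <> e2 /\
    asymptotic_to_axis g e1 /\
    boundary_circumference g e2 r h /\
    forall p, boundary (surface g) p <-> circumference r h p.

Definition exactly_one_surface (K : R -> R) (P : profile -> Prop) : Prop :=
  exists g, rotational_K_surface K g /\ P g /\
    forall g', rotational_K_surface K g' -> P g' ->
      vertical_translate (surface g) (surface g').

Definition exactly_two_surfaces (K : R -> R) (P : profile -> Prop) : Prop :=
  exists g1 g2,
    rotational_K_surface K g1 /\ P g1 /\
    rotational_K_surface K g2 /\ P g2 /\
    ~ vertical_translate (surface g1) (surface g2) /\
    forall g', rotational_K_surface K g' -> P g' ->
      vertical_translate (surface g1) (surface g') \/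
      vertical_translate (surface g2) (surface g').

(** * Singular boundary points *)

(* The immersed surface [Y] passes through [p] and is, on one side of [p], a
   piece of [A].  A condition on the mere image of [Y] would be void, since
   every point of space lies on some K-surface unrelated to [A]. *)
Definition extends_through (A : R3 -> Prop) (U : R2 -> Prop) (Y : R2 -> R3)
    (p : R3) : Prop :=
  exists (q : R2) (V : R2 -> Prop),
    U q /\ Y q = p /\ open V /\ closure V q /\
    forall w, V w -> U w /\ A (Y w).

(* No [C^2] surface contains [p] and the part of [A] near [p]. *)
Definition singular_point (A : R3 -> Prop) (p : R3) : Prop :=
  closure A p /\
  forall U Y, immersed_surface U Y -> ~ extends_through A U Y p.

(* Main.v *)
(* In the phase plane with coordinates [x] and [v = cos th] the equations become
   [x' = v], [v' = x k(v)] with [k = - K > 0], and [x^2 - G v] is constant, where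
   [G v] is the integral of [2 u / k u] from [0] to [v].  On a level set the system
   is a scalar equation, solved by quadrature: for a positive level [v] is a
   coordinate and [v] runs over all of (-1, 1), reaching the waist at [v = 0]; for a
   nonpositive level [x] is a coordinate, the sign of [v] is constant, and the axis
   is reached at a point with [G v] equal to minus the level, or only asymptotically
   when the level is zero.  Since the time function of the quadrature increases at
   unit speed along every solution, the same formula gives uniqueness and
   maximality.  Extending [k] by constants prolongs the solutions beyond
   [v = -1, 1], so that the behaviour at the boundary circumferences follows by
   continuity.  A C^2 surface through such a circumference would have bounded second
   derivatives there, while the curvature of the profile is
   [- x k / sin th], which is unbounded. *)
From Stdlib Require Import Reals Lra ClassicalEpsilon.
From Coquelicot Require Import Coquelicot.
Require Import Defs.
Open Scope R_scope.

(** * Calculus on intervals *)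

(** Two singularities shape the argument. The equation for [th] degenerates at the rims, where
    [sin th] vanishes; passing to [v] removes this. The equilibrium [x = v = 0] stays: there the
    speed of the quadrature vanishes. It is controlled by one estimate, [|v| <= M x] on the level
    zero, which gives exponential bounds for [x]. Hence no other solution meets the equilibrium in
    finite time, [v] keeps its sign on nonpositive levels, and the asymptotic orbits last for
    infinite time. Each level branch is described once, by a curve on an open interval that
    overshoots the strip [-1 < v < 1]; the bound 2 for [|v|] only serves to pass beyond 1.
    Existence, uniqueness up to translation and maximality are all read off from that curve.
    Branches with [v < 0] are reflections of branches with [v > 0] for [k (- t)]. The types of
    surfaces are geometric predicates, not levels, so uniqueness within a type also needs that other
    levels do not satisfy the predicate. For the singular circumferences no local form of the
    immersion is chosen: only its height and its squared distance to the axis are differentiated. *)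

Lemma continuous_of_is_derive (f : R -> R) (s l : R) :
  is_derive f s l -> continuous f s.
Proof.
  intros H. apply (ex_derive_continuous f). exists l. exact H.
Qed.

Lemma continuous_of_ex_derive (f : R -> R) (s : R) : ex_derive f s -> continuous f s.
Proof. exact (ex_derive_continuous f s). Qed.

(** The right-hand side has the shape of [deriv_within] over the whole line. This is the bridge
    between the one-sided derivatives of the definitions and ordinary calculus at interior
    points. *)
Lemma filterlim_difference_quotient (f : R -> R) (s l : R) :
  is_derive f s l <->
  filterlim (fun t => (f t - f s) / (t - s)) (locally' s) (locally l).
Proof.
  rewrite is_derive_Reals. split.
  - intros H P [eps HP]. destruct (H eps (cond_pos eps)) as [d Hd].
    exists d. intros t Ht Hts. apply HP.
    change (Rabs (t - s) < d) in Ht.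
    change (Rabs ((f t - f s) / (t - s) - l) < eps).
    replace (f t) with (f (s + (t - s))) by (f_equal; ring).
    apply Hd; auto. lra.
  - intros H eps Heps.
    destruct (H _ (locally_ball l (mkposreal eps Heps))) as [d Hd].
    exists d. intros h Hh Hhd.
    replace ((f (s + h) - f s) / h) with ((f (s + h) - f s) / (s + h - s))
      by (f_equal; ring).
    apply (Hd (s + h)).
    + change (Rabs (s + h - s) < d). replace (s + h - s) with h by ring. auto.
    + lra.
Qed.

Lemma deriv_within_of_is_derive (I : R -> Prop) (f : R -> R) (s l : R) :
  is_derive f s l -> deriv_within I f s l.
Proof.
  intros H%filterlim_difference_quotient P HP.
  specialize (H P HP). unfold filtermap, locally', within in *.
  revert H. apply filter_imp. intros t Ht [_ Hts]. auto.
Qed.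

Lemma is_derive_of_deriv_within (I : R -> Prop) (f : R -> R) (s l : R) :
  locally s I -> deriv_within I f s l -> is_derive f s l.
Proof.
  intros HI H. apply filterlim_difference_quotient. intros P HP.
  specialize (H P HP). unfold filtermap, locally', within in *.
  generalize (filter_and _ _ HI H). apply filter_imp. intuition.
Qed.

(** Near [s] the quotient is within 1 of [l], so the increment of [f] is less than [|l| + 1] times
    that of the variable; hence the radius [eps / (|l| + 1)]. *)
Lemma continuous_within_of_deriv_within (I : R -> Prop) (f : R -> R) (s l : R) :
  deriv_within I f s l -> filterlim f (within I (locally s)) (locally (f s)).
Proof.
  intros H P [eps HP].
  destruct (H (ball l (mkposreal 1 Rlt_0_1)) (locally_ball _ _)) as [d Hd].
  pose proof (Rabs_pos l) as Hl.
  assert (He : 0 < Rmin d (eps / (Rabs l + 1))).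
  { apply Rmin_pos. apply cond_pos. apply Rdiv_lt_0_compat. apply cond_pos. lra. }
  exists (mkposreal _ He). intros t Ht HIt. apply HP.
  change (Rabs (t - s) < Rmin d (eps / (Rabs l + 1))) in Ht.
  change (Rabs (f t - f s) < eps).
  destruct (Req_dec t s) as [->|Hts].
  { rewrite Rminus_diag_eq, Rabs_R0 by reflexivity. apply cond_pos. }
  assert (Hq : Rabs ((f t - f s) / (t - s) - l) < 1).
  { apply Hd; [| now split].
    apply Rlt_le_trans with (1 := Ht), Rmin_l. }
  assert (Hq' : Rabs ((f t - f s) / (t - s)) < Rabs l + 1).
  { pose proof (Rabs_triang_inv ((f t - f s) / (t - s)) l). lra. }
  replace (f t - f s) with ((f t - f s) / (t - s) * (t - s)) by (field; lra).
  rewrite Rabs_mult.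
  assert (Ht2 : Rabs (t - s) < eps / (Rabs l + 1)).
  { apply Rlt_le_trans with (1 := Ht), Rmin_r. }
  replace (pos eps) with ((Rabs l + 1) * (eps / (Rabs l + 1))) by (field; lra).
  apply Rmult_le_0_lt_compat; auto using Rabs_pos.
Qed.

Definition convex (D : R -> Prop) : Prop :=
  forall s t u, D s -> D t -> s <= u <= t -> D u.

Lemma convex_True : convex (fun _ => True).
Proof. intros s t u _ _ _. exact I. Qed.

Definition interior (D : R -> Prop) (s : R) : Prop := locally s D.

Lemma convex_interior (D : R -> Prop) (s t u : R) :
  convex D -> D s -> D t -> s < u < t -> locally u D.
Proof.
  intros HD Hs Ht Hu.
  assert (He : 0 < Rmin (u - s) (t - u)) by (apply Rmin_pos; lra).
  exists (mkposreal _ He). intros y Hy.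
  change (Rabs (y - u) < Rmin (u - s) (t - u)) in Hy.
  pose proof (Rmin_l (u - s) (t - u)). pose proof (Rmin_r (u - s) (t - u)).
  apply Rabs_def2 in Hy. apply (HD s t); auto. lra.
Qed.

Lemma convex_of_interior (D : R -> Prop) : convex D -> convex (interior D).
Proof.
  intros HD s t u Hs Ht Hu.
  destruct (Req_dec u s) as [->|Hus]; auto.
  destruct (Req_dec u t) as [->|Hut]; auto.
  apply (convex_interior D s t); auto. exact (locally_singleton s _ Hs).
  exact (locally_singleton t _ Ht). lra.
Qed.

Lemma open_interior (D : R -> Prop) : open (interior D).
Proof. intros s Hs. apply locally_locally. exact Hs. Qed.

(** Retraction of the line onto [[a, b]]. Composition with it turns continuity relative to an
    interval into continuity at every real number, and it also extends [K] by constants beyond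
    [[-1, 1]]. *)
Definition clamp (a b t : R) : R := Rmax a (Rmin b t).

Lemma clamp_in (a b t : R) : a <= b -> a <= clamp a b t <= b.
Proof.
  intros H. unfold clamp, Rmax, Rmin. destruct (Rle_dec b t); destruct (Rle_dec a _); lra.
Qed.

Lemma clamp_id (a b t : R) : a <= t <= b -> clamp a b t = t.
Proof.
  intros H. unfold clamp, Rmax, Rmin. destruct (Rle_dec b t); destruct (Rle_dec a _); lra.
Qed.

Lemma clamp_lipschitz (a b s t : R) :
  a <= b -> Rabs (clamp a b t - clamp a b s) <= Rabs (t - s).
Proof.
  intros H. unfold clamp, Rmax, Rmin.
  destruct (Rle_dec b t); destruct (Rle_dec b s);
    repeat destruct (Rle_dec a _); unfold Rabs; repeat destruct (Rcase_abs _); lra.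
Qed.

Lemma continuous_clamped (I : R -> Prop) (f : R -> R) (a b : R) :
  a <= b -> (forall u, a <= u <= b -> I u) -> continuous_on I f ->
  forall u, continuous (fun t => f (clamp a b t)) u.
Proof.
  intros Hab HI Hf u P HP.
  pose proof (clamp_in a b u Hab) as Hu.
  destruct (Hf _ (HI _ Hu) P HP) as [d Hd]. exists d. intros t Ht.
  apply Hd. 2: now apply HI, clamp_in.
  change (Rabs (t - u) < d) in Ht.
  change (Rabs (clamp a b t - clamp a b u) < d).
  apply Rle_lt_trans with (2 := Ht). now apply clamp_lipschitz.
Qed.

(** Continuity is relative to [I] and the derivative is taken at interior points only, so that [I]
    may be the domain of an orbit that contains its endpoint on the axis. The classical theorem is
    applied to the clamped function. *)
Lemma mean_value (I : R -> Prop) (f df : R -> R) (s t : R) :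
  convex I -> continuous_on I f ->
  (forall u, locally u I -> is_derive f u (df u)) ->
  I s -> I t -> s < t ->
  exists c, s < c < t /\ f t - f s = df c * (t - s).
Proof.
  intros HI Hf Hd Hs Ht Hst.
  set (F := fun u => f (clamp s t u)).
  assert (HF : forall u, continuous F u).
  { apply continuous_clamped with I; auto. lra. intros u Hu. now apply (HI s t). }
  assert (Hder : forall u, s < u < t -> is_derive F u (df u)).
  { intros u Hu. apply is_derive_ext_loc with f.
    - assert (He : 0 < Rmin (u - s) (t - u)) by (apply Rmin_pos; lra).
      exists (mkposreal _ He). intros y Hy.
      change (Rabs (y - u) < Rmin (u - s) (t - u)) in Hy.
      pose proof (Rmin_l (u - s) (t - u)). pose proof (Rmin_r (u - s) (t - u)).
      apply Rabs_def2 in Hy. unfold F. rewrite clamp_id; auto. lra.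
    - apply Hd. now apply (convex_interior I s t). }
  assert (pr1 : forall c, s < c < t -> derivable_pt F c).
  { intros c Hc. exists (df c). apply is_derive_Reals. auto. }
  assert (pr2 : forall c, s < c < t -> derivable_pt id c).
  { intros c Hc. apply derivable_pt_id. }
  destruct (MVT F id s t pr1 pr2 Hst) as (c & Hc & He).
  { intros c _. apply continuity_pt_filterlim. apply HF. }
  { intros c _. apply derivable_continuous_pt, derivable_pt_id. }
  exists c. split; auto.
  assert (E1 : derive_pt F c (pr1 c Hc) = df c).
  { apply derive_pt_eq_0. apply is_derive_Reals. auto. }
  assert (E2 : derive_pt id c (pr2 c Hc) = 1).
  { apply derive_pt_eq_0. apply derivable_pt_lim_id. }
  rewrite E1, E2 in He. unfold F, id in He. rewrite !clamp_id in He by lra. lra.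
Qed.

Lemma constant_of_derive_zero (I : R -> Prop) (f : R -> R) (s t : R) :
  convex I -> continuous_on I f ->
  (forall u, locally u I -> is_derive f u 0) ->
  I s -> I t -> f s = f t.
Proof.
  intros HI Hf Hd Hs Ht.
  destruct (Rtotal_order s t) as [H|[->|H]]; auto.
  - destruct (mean_value I f (fun _ => 0) s t HI Hf Hd Hs Ht H) as (c & _ & E). lra.
  - destruct (mean_value I f (fun _ => 0) t s HI Hf Hd Ht Hs H) as (c & _ & E). lra.
Qed.

Lemma nondecreasing_of_derive (I : R -> Prop) (f df : R -> R) (s t : R) :
  convex I -> continuous_on I f ->
  (forall u, locally u I -> is_derive f u (df u) /\ 0 <= df u) ->
  I s -> I t -> s <= t -> f s <= f t.
Proof.
  intros HI Hf Hd Hs Ht [Hst| ->]; [| lra].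
  destruct (mean_value I f df s t HI Hf) as (c & Hc & E); auto.
  { intros u Hu. now apply Hd. }
  destruct (Hd c) as [_ H]. now apply (convex_interior I s t).
  enough (0 <= df c * (t - s)) by lra. apply Rmult_le_pos; lra.
Qed.

Lemma increasing_of_derive (I : R -> Prop) (f df : R -> R) (s t : R) :
  convex I -> continuous_on I f ->
  (forall u, locally u I -> is_derive f u (df u) /\ 0 < df u) ->
  I s -> I t -> s < t -> f s < f t.
Proof.
  intros HI Hf Hd Hs Ht Hst.
  destruct (mean_value I f df s t HI Hf) as (c & Hc & E); auto.
  { intros u Hu. now apply Hd. }
  destruct (Hd c) as [_ H]. now apply (convex_interior I s t).
  enough (0 < df c * (t - s)) by lra. apply Rmult_lt_0_compat; lra.
Qed.

Lemma intermediate_value (I : R -> Prop) (f : R -> R) (s t y : R) :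
  convex I -> continuous_on I f -> I s -> I t -> s <= t ->
  (f s <= y <= f t \/ f t <= y <= f s) ->
  exists c, s <= c <= t /\ f c = y.
Proof.
  intros HI Hf Hs Ht Hst Hy.
  set (F := fun u => f (clamp s t u)).
  assert (HF : continuity F).
  { intros u. apply continuity_pt_filterlim, continuous_clamped with I; auto.
    intros v Hv. now apply (HI s t). }
  destruct (IVT_gen F s t y HF) as (c & Hc & E).
  { unfold F. rewrite !clamp_id by lra. unfold Rmin, Rmax. destruct (Rle_dec _ _); lra. }
  rewrite Rmin_left, Rmax_right in Hc by lra.
  exists c. split; auto. unfold F in E. now rewrite clamp_id in E.
Qed.

(** Compare with the values at [s - d / 2] and [s + d / 2]. If one of these points is outside [D],
    convexity excludes everything further out on that side, and any [e] will do there. *)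
Lemma increasing_inverse_continuous (D : R -> Prop) (f : R -> R) (s : R) (d : posreal) :
  convex D -> (forall u v, D u -> D v -> u < v -> f u < f v) -> D s ->
  exists e : posreal, forall u, D u -> Rabs (f u - f s) < e -> Rabs (u - s) < d.
Proof.
  intros HD Hf Hs. destruct d as [d Hd]; simpl.
  assert (H1 : exists e : posreal, forall u, D u -> f s - e < f u -> s - d < u).
  { destruct (classic (D (s - d / 2))) as [H|H].
    - assert (He : 0 < f s - f (s - d / 2)) by (specialize (Hf (s - d / 2) s H Hs); lra).
      exists (mkposreal _ He). simpl. intros u Hu Hfu.
      destruct (Rlt_or_le (s - d) u) as [|Hle]; auto.
      specialize (Hf u (s - d / 2) Hu H). lra.
    - exists (mkposreal _ Rlt_0_1). intros u Hu _.
      destruct (Rlt_or_le (s - d) u) as [|Hle]; auto.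
      exfalso. apply H. apply (HD u s); auto. lra. }
  assert (H2 : exists e : posreal, forall u, D u -> f u < f s + e -> u < s + d).
  { destruct (classic (D (s + d / 2))) as [H|H].
    - assert (He : 0 < f (s + d / 2) - f s) by (specialize (Hf s (s + d / 2) Hs H); lra).
      exists (mkposreal _ He). simpl. intros u Hu Hfu.
      destruct (Rlt_or_le u (s + d)) as [|Hle]; auto.
      specialize (Hf (s + d / 2) u H Hu). lra.
    - exists (mkposreal _ Rlt_0_1). intros u Hu _.
      destruct (Rlt_or_le u (s + d)) as [|Hle]; auto.
      exfalso. apply H. apply (HD s u); auto. lra. }
  destruct H1 as [e1 H1]. destruct H2 as [e2 H2].
  assert (He : 0 < Rmin e1 e2) by (apply Rmin_pos; apply cond_pos).
  exists (mkposreal _ He). simpl. intros u Hu Hfu.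
  pose proof (Rmin_l e1 e2). pose proof (Rmin_r e1 e2).
  apply Rabs_def2 in Hfu. apply Rabs_def1.
  - specialize (H2 u Hu). lra.
  - specialize (H1 u Hu). lra.
Qed.

(** * Inverse of a function with positive derivative *)

Definition image (f : R -> R) (D : R -> Prop) (y : R) : Prop := exists u, D u /\ f u = y.

Section Inverse.

Variables (D : R -> Prop) (f df : R -> R).
Hypothesis openD : open D.
Hypothesis convexD : convex D.
Hypothesis derf : forall u, D u -> is_derive f u (df u).
Hypothesis df_pos : forall u, D u -> 0 < df u.

Let contf : continuous_on D f.
Proof.
  apply continuous_on_forall. intros u Hu. apply continuous_of_is_derive with (df u). auto.
Qed.

Let incf (u v : R) : D u -> D v -> u < v -> f u < f v.
Proof.
  apply increasing_of_derive with df; auto.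
  intros w Hw%locally_singleton. auto.
Qed.

Lemma convex_image : convex (image f D).
Proof.
  intros y1 y2 y (u1 & H1 & E1) (u2 & H2 & E2) Hy.
  destruct (Rle_or_lt u1 u2) as [Hu|Hu].
  - destruct (intermediate_value D f u1 u2 y convexD contf H1 H2 Hu) as (c & Hc & E); [lra|].
    exists c. split; auto. now apply (convexD u1 u2).
  - exists u1. split; auto. specialize (incf _ _ H2 H1 Hu). lra.
Qed.

Lemma open_image : open (image f D).
Proof.
  intros y (u & Hu & E). destruct (openD u Hu) as [d Hd].
  assert (H1 : D (u - d / 2)).
  { apply Hd. change (Rabs (u - d / 2 - u) < d). destruct d as [d Hd']; simpl.
    apply Rabs_def1; lra. }
  assert (H2 : D (u + d / 2)).
  { apply Hd. change (Rabs (u + d / 2 - u) < d). destruct d as [d Hd']; simpl.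
    apply Rabs_def1; lra. }
  apply (convex_interior _ (f (u - d / 2)) (f (u + d / 2))).
  - exact convex_image.
  - now exists (u - d / 2).
  - now exists (u + d / 2).
  - subst y. destruct d as [d Hd']; simpl in *. split; apply incf; auto; lra.
Qed.

(** [g] is picked by [epsilon] and is meaningful only on the image of [D]. Its difference quotient
    at [f u] is the reciprocal of that of [f] at [u], and [g y] tends to [u] by
    [increasing_inverse_continuous]. *)
Lemma inverse_of_increasing :
  exists g : R -> R, forall u, D u -> g (f u) = u /\ is_derive g (f u) (/ df u).
Proof.
  set (g := fun y => epsilon (inhabits 0) (fun u => D u /\ f u = y)).
  assert (Hg : forall u, D u -> g (f u) = u).
  { intros u Hu.
    destruct (epsilon_spec (inhabits 0) (fun v => D v /\ f v = f u)) as [H1 H2].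
    { now exists u. }
    fold (g (f u)) in H1, H2.
    destruct (Rtotal_order (g (f u)) u) as [H|[H|H]]; auto;
      [specialize (incf _ _ H1 Hu H) | specialize (incf _ _ Hu H1 H)]; lra. }
  exists g. intros u Hu. split; auto.
  apply filterlim_difference_quotient.
  rewrite Hg by auto.
  pose proof (derf u Hu) as Hd. apply filterlim_difference_quotient in Hd.
  pose proof (df_pos u Hu) as Hp.
  apply filterlim_ext_loc with (fun y => / ((f (g y) - f u) / (g y - u))).
  - destruct (open_image (f u)) as [d Hd']. { now exists u. }
    exists d. intros y Hy Hne. destruct (Hd' y Hy) as (v & Hv & E). subst y.
    rewrite Hg by auto. field.
    assert (v <> u) by (intros ->; auto). split; lra.
  - apply filterlim_comp with (locally (df u)).
    + apply (filterlim_comp _ _ _ g (fun v => (f v - f u) / (v - u)) _ (locally' u)); auto.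
      intros P [e He].
      destruct (increasing_inverse_continuous D f u e convexD incf Hu) as [d Hd1].
      destruct (open_image (f u)) as [d' Hd']. { now exists u. }
      assert (Hm : 0 < Rmin d d') by (apply Rmin_pos; apply cond_pos).
      exists (mkposreal _ Hm). intros y Hy Hne.
      change (Rabs (y - f u) < Rmin d d') in Hy.
      destruct (Hd' y) as (v & Hv & E).
      { apply Rlt_le_trans with (1 := Hy), Rmin_r. }
      subst y. rewrite Hg by auto. apply He.
      * apply Hd1; auto. apply Rlt_le_trans with (1 := Hy), Rmin_l.
      * intros ->; auto.
    + apply (filterlim_Rbar_inv (df u)). intros H. inversion H. lra.
Qed.

End Inverse.

Lemma continuous_on_plus (I : R -> Prop) (f g : R -> R) :
  continuous_on I f -> continuous_on I g -> continuous_on I (fun s => f s + g s).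
Proof.
  intros Hf Hg s Hs.
  apply (filterlim_comp_2 (G := locally (f s)) (H := locally (g s)));
    [apply Hf | apply Hg | apply (filterlim_plus (f s) (g s))]; auto.
Qed.

Lemma continuous_on_mult (I : R -> Prop) (f g : R -> R) :
  continuous_on I f -> continuous_on I g -> continuous_on I (fun s => f s * g s).
Proof.
  intros Hf Hg s Hs.
  apply (filterlim_comp_2 (G := locally (f s)) (H := locally (g s)));
    [apply Hf | apply Hg | apply (filterlim_mult (f s) (g s))]; auto.
Qed.

Lemma continuous_on_comp (I : R -> Prop) (f g : R -> R) :
  continuous_on I f -> (forall s, I s -> continuous g (f s)) ->
  continuous_on I (fun s => g (f s)).
Proof.
  intros Hf Hg s Hs. apply filterlim_comp with (locally (f s)); [apply Hf | apply Hg]; auto.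
Qed.

Lemma continuous_Ropp (f : R -> R) (s : R) :
  continuous f s -> continuous (fun t => - f t) s.
Proof.
  intros H. apply (continuous_comp f (fun y => - y)); auto.
  apply continuous_of_is_derive with (-1). auto_derive; auto.
Qed.

(* Solves [p' = phi p] by inverting the time function [S], a primitive of [1 / phi]. *)
Lemma quadrature (D : R -> Prop) (phi : R -> R) (p0 : R) :
  open D -> convex D -> D p0 ->
  (forall p, D p -> continuous phi p /\ 0 < phi p) ->
  exists (J : R -> Prop) (S P : R -> R),
    open J /\ convex J /\ S p0 = 0 /\
    (forall p, D p -> J (S p) /\ P (S p) = p /\ is_derive S p (/ phi p)) /\
    (forall s, J s -> D (P s) /\ S (P s) = s /\ is_derive P s (phi (P s))).
Proof.
  intros oD cD Hp0 Hphi.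
  set (S := fun p => RInt (fun q => / phi q) p0 p).
  assert (HS : forall p, D p -> is_derive S p (/ phi p)).
  { intros p Hp. apply (is_derive_RInt (fun q => / phi q) S p0 p).
    - generalize (oD p Hp). apply filter_imp. intros q Hq.
      apply (RInt_correct (fun q => / phi q)), ex_RInt_continuous.
      intros z Hz. apply continuous_Rinv_comp.
      + apply Hphi. unfold Rmin, Rmax in Hz.
        destruct (Rle_dec p0 q); [apply (cD p0 q) | apply (cD q p0)]; auto.
      + apply Rgt_not_eq, Hphi. unfold Rmin, Rmax in Hz.
        destruct (Rle_dec p0 q); [apply (cD p0 q) | apply (cD q p0)]; auto.
    - apply continuous_Rinv_comp; [apply Hphi | apply Rgt_not_eq, Hphi]; auto. }
  assert (Hpos : forall p, D p -> 0 < / phi p).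
  { intros p Hp. now apply Rinv_0_lt_compat, Hphi. }
  destruct (inverse_of_increasing D S (fun p => / phi p) oD cD HS Hpos) as [P HP].
  exists (image S D), S, P. split; [| split; [| split; [| split]]].
  - now apply open_image with (fun p => / phi p).
  - now apply convex_image with (fun p => / phi p).
  - unfold S. rewrite RInt_point. reflexivity.
  - intros p Hp. split; [now exists p |]. split; [apply HP | apply HS]; auto.
  - intros s (p & Hp & <-). rewrite (proj1 (HP p Hp)). do 2 (split; auto).
    rewrite <- (Rinv_inv (phi p)). now apply HP.
Qed.

(* The time function increases at unit speed along every solution. *)
Lemma quadrature_time (I D : R -> Prop) (S phi p : R -> R) (s t : R) :
  convex I -> continuous_on I p -> (forall u, I u -> D (p u)) ->
  (forall q, D q -> 0 < phi q /\ is_derive S q (/ phi q)) ->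
  (forall u, locally u I -> is_derive p u (phi (p u))) ->
  I s -> I t -> S (p s) - s = S (p t) - t.
Proof.
  intros cI cp HD HS Hp. apply (constant_of_derive_zero I (fun s => S (p s) - s)); auto.
  - apply (continuous_on_plus I (fun s => S (p s)) (fun s => - s)).
    + apply continuous_on_comp; auto. intros u Hu.
      exact (continuous_of_is_derive _ _ _ (proj2 (HS _ (HD u Hu)))).
    + apply continuous_on_forall. intros u _.
      apply (continuous_Ropp (fun u => u)), continuous_id.
  - intros u Hu. destruct (HS _ (HD u (locally_singleton _ _ Hu))) as [Hphi dS]. evar_last.
    + apply (is_derive_minus (fun s => S (p s)) (fun s => s)).
      * apply (is_derive_comp S p); [exact dS | exact (Hp u Hu)].
      * apply is_derive_id.
    + unfold minus, plus, opp, scal, one; simpl; unfold mult; simpl. field. lra.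
Qed.

(** * The first integral *)

Section Energy.

Variable k : R -> R.
Hypothesis k_cont : forall t, continuous k t.
Hypothesis k_pos : forall t, 0 < k t.

Definition energy (t : R) : R := RInt (fun u => 2 * u / k u) 0 t.

Lemma energy_derive (t : R) : is_derive energy t (2 * t / k t).
Proof.
  assert (Hc : forall u, continuous (fun u => 2 * u / k u) u).
  { intros u. apply (continuous_mult (fun u => 2 * u) (fun u => / k u)).
    - apply (continuous_mult (fun _ => 2) (fun u => u)).
      apply continuous_const. apply continuous_id.
    - apply continuous_Rinv_comp. apply k_cont. apply Rgt_not_eq, k_pos. }
  apply (is_derive_RInt (fun u => 2 * u / k u) energy 0 t); auto.
  apply filter_forall. intros y.
  apply (RInt_correct (fun u => 2 * u / k u)), ex_RInt_continuous. auto.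
Qed.

Lemma energy_continuous (t : R) : continuous energy t.
Proof. apply continuous_of_is_derive with (2 * t / k t), energy_derive. Qed.

Lemma energy_0 : energy 0 = 0.
Proof. unfold energy. rewrite RInt_point. reflexivity. Qed.

Lemma energy_increasing (s t : R) : 0 <= s < t -> energy s < energy t.
Proof.
  intros Hst.
  destruct (mean_value (fun _ => True) energy (fun u => 2 * u / k u) s t) as (c & Hc & E);
    auto; try lra.
  - exact convex_True.
  - apply continuous_on_forall. intros x _. apply energy_continuous.
  - intros u _. apply energy_derive.
  - enough (0 < 2 * c / k c * (t - s)) by lra.
    apply Rmult_lt_0_compat; [apply Rdiv_lt_0_compat; [lra | apply k_pos] | lra].
Qed.

End Energy.

Lemma is_derive_reflect (f : R -> R) (t l : R) :
  is_derive f (- t) l -> is_derive (fun u => f (- u)) t (- l).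
Proof.
  intros H.
  assert (Ho : is_derive (fun u : R => - u) t (-1)) by (auto_derive; auto).
  evar_last. apply (is_derive_comp f (fun u => - u) t l (-1) H Ho).
  unfold scal; simpl; unfold mult; simpl. ring.
Qed.

(** The substitution of [- u] for [u] preserves [2 u du] and replaces [k] by its reflection. This
    carries facts about [v > 0] over to [v < 0]. *)
Lemma energy_opp (k : R -> R) (t : R) :
  (forall u, continuous k u) -> (forall u, 0 < k u) ->
  energy (fun u => k (- u)) (- t) = energy k t.
Proof.
  intros Hk Hp.
  assert (Hk' : forall u, continuous (fun u => k (- u)) u).
  { intros u. apply continuous_comp; [| apply Hk].
    apply (continuous_Ropp (fun u => u)), continuous_id. }
  assert (Hd : forall u, is_derive (fun u => energy (fun v => k (- v)) (- u) - energy k u) u 0).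
  { intros u. evar_last.
    - apply (is_derive_minus (fun u => energy (fun v => k (- v)) (- u)) (energy k)).
      + apply is_derive_reflect, energy_derive; auto.
      + apply energy_derive; auto.
    - unfold minus, plus, opp; simpl. rewrite Ropp_involutive. field.
      apply Rgt_not_eq, Hp. }
  assert (E := constant_of_derive_zero (fun _ => True)
                 (fun u => energy (fun v => k (- v)) (- u) - energy k u) t 0).
  simpl in E. rewrite Ropp_0, !energy_0 in E.
  enough (energy (fun v => k (- v)) (- t) - energy k t = 0 - 0) by lra.
  apply E; auto.
  - exact convex_True.
  - apply continuous_on_forall. intros u _. apply continuous_of_is_derive with 0, Hd.
Qed.

Lemma continuous_reflect (k : R -> R) :
  (forall u, continuous k u) -> forall u, continuous (fun t => k (- t)) u.
Proof.
  intros Hk u. apply continuous_comp; [| apply Hk].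
  apply (continuous_Ropp (fun u => u)), continuous_id.
Qed.

Lemma energy_pos (k : R -> R) (t : R) :
  (forall u, continuous k u) -> (forall u, 0 < k u) -> t <> 0 -> 0 < energy k t.
Proof.
  intros Hk Hp Ht. destruct (Rlt_or_le 0 t) as [H|H].
  - rewrite <- (energy_0 k). apply energy_increasing; auto; lra.
  - rewrite <- energy_opp, <- (energy_0 (fun u => k (- u))); auto.
    apply energy_increasing; auto using continuous_reflect. lra.
Qed.

(* Curves [(x, v)] with [v = cos th], the equations being required at interior points only. *)
Record phase_curve (k : R -> R) (I : R -> Prop) (x v : R -> R) : Prop := {
  pc_convex : convex I;
  pc_cont_x : continuous_on I x;
  pc_cont_v : continuous_on I v;
  pc_range : forall s, I s -> 0 <= x s /\ -1 < v s < 1;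
  pc_derive : forall s, locally s I -> is_derive x s (v s) /\ is_derive v s (x s * k (v s))
}.

(** The derivative of [x ^ 2] is [2 x v], and that of [energy k v] is [2 v / k v] times [x k v],
    which is the same. The weight [1 / k] in [energy] is there for this cancellation. *)
Lemma first_integral (k : R -> R) (I : R -> Prop) (x v : R -> R) (s t : R) :
  (forall u, continuous k u) -> (forall u, 0 < k u) -> phase_curve k I x v ->
  I s -> I t -> x s ^ 2 - energy k (v s) = x t ^ 2 - energy k (v t).
Proof.
  intros Hk Hp [cI cx cv _ Hd] Hs Ht.
  apply (constant_of_derive_zero I (fun u => x u ^ 2 - energy k (v u))); auto.
  - apply (continuous_on_plus I (fun u => x u ^ 2) (fun u => - energy k (v u))).
    + apply (continuous_on_comp I x (fun y => y ^ 2)); auto. intros u _.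
      apply continuous_of_is_derive with (2 * x u). auto_derive; auto. ring.
    + apply (continuous_on_comp I v (fun y => - energy k y)); auto. intros u _.
      apply (continuous_Ropp (energy k)), energy_continuous; auto.
  - intros u Hu. destruct (Hd u Hu) as [Hx Hv]. evar_last.
    + apply (is_derive_minus (fun u => x u ^ 2) (fun u => energy k (v u))).
      * apply is_derive_pow, Hx.
      * apply (is_derive_comp (energy k) v); [apply energy_derive | apply Hv]; auto.
    + unfold minus, plus, opp, scal; simpl; unfold mult; simpl.
      field. apply Rgt_not_eq, Hp.
Qed.

(** On the level zero, where [x ^ 2 = energy k v], this reads [|v| <= M x]: the speed of [x] is at
    most linear in [x], which is what exponential comparison near the equilibrium requires. *)
Lemma kinetic_bound (k : R -> R) :
  (forall u, continuous k u) -> (forall u, 0 < k u) ->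
  exists M, 0 < M /\ forall t, -1 <= t <= 1 -> t ^ 2 <= M ^ 2 * energy k t.
Proof.
  assert (Hplus : forall k, (forall u, continuous k u) -> (forall u, 0 < k u) ->
    exists M, 0 < M /\ forall t, 0 <= t <= 1 -> t ^ 2 <= M * energy k t).
  { clear k. intros k Hk Hp.
    (* With [k m] the maximum of [k] on [[0, 1]], the difference [k m * energy k t - t ^ 2] vanishes
       at 0 and has derivative [2 t (k m - k t) / k t >= 0]. *)
    destruct (continuity_ab_maj k 0 1) as (m & Hm & _); [lra | |].
    { intros c _. apply continuity_pt_filterlim, Hk. }
    exists (k m). split. apply Hp. intros t [[Ht| <-] Ht1].
    2: { rewrite energy_0. lra. }
    destruct (mean_value (fun _ => True) (fun u => k m * energy k u - u ^ 2)
      (fun u => k m * (2 * u / k u) - 2 * u) 0 t) as (c & Hc & E); auto.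
    - exact convex_True.
    - apply continuous_on_forall. intros x _.
      apply (continuous_minus (fun u => k m * energy k u) (fun u => u ^ 2)).
      + apply (continuous_mult (fun _ => k m) (energy k)). apply continuous_const.
        apply energy_continuous; auto.
      + apply continuous_of_is_derive with (2 * x). auto_derive; auto. ring.
    - intros u _. evar_last.
      + apply (is_derive_minus (fun u => k m * energy k u) (fun u => u ^ 2)).
        * apply is_derive_scal, energy_derive; auto.
        * apply is_derive_pow, is_derive_id.
      + unfold minus, plus, opp, one; simpl. ring.
    - rewrite energy_0 in E.
      enough (0 <= (k m * (2 * c / k c) - 2 * c) * (t - 0)) by lra.
      apply Rmult_le_pos; [| lra].
      replace (k m * (2 * c / k c) - 2 * c) with (2 * c * (k m - k c) / k c)
        by (field; apply Rgt_not_eq, Hp).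
      specialize (Hm c ltac:(lra)). specialize (Hp c).
      apply Rmult_le_pos; [| apply Rlt_le, Rinv_0_lt_compat; auto].
      apply Rmult_le_pos; lra. }
  intros Hk Hp.
  destruct (Hplus k Hk Hp) as (M1 & P1 & H1).
  destruct (Hplus (fun u => k (- u)) (continuous_reflect k Hk) (fun u => Hp (- u)))
    as (M2 & P2 & H2).
  (* The summand 1 makes the square of this constant at least [M1 + M2]. *)
  exists (M1 + M2 + 1). split. lra. intros t Ht.
  assert (He : 0 <= energy k t).
  { destruct (Req_dec t 0) as [->|]. rewrite energy_0; lra.
    apply Rlt_le, energy_pos; auto. }
  assert (Hb : t ^ 2 <= (M1 + M2) * energy k t).
  { destruct (Rle_or_lt 0 t).
    - specialize (H1 t ltac:(lra)). nra.
    - specialize (H2 (- t) ltac:(lra)). rewrite energy_opp in H2 by auto. nra. }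
  apply Rle_trans with (1 := Hb). apply Rmult_le_compat_r; auto. nra.
Qed.

(** A curve through the equilibrium has level zero, so [|x'| <= M x]. Then [x exp (- M t)] does not
    increase and [x exp (M t)] does not decrease; both vanish at [s0], so [x] vanishes after and
    before [s0], and then [v] vanishes because [energy] is positive off 0. *)
Lemma equilibrium_isolated (k : R -> R) (I : R -> Prop) (x v : R -> R) (s0 s : R) :
  (forall u, continuous k u) -> (forall u, 0 < k u) -> phase_curve k I x v ->
  I s0 -> x s0 = 0 -> v s0 = 0 -> I s -> x s = 0 /\ v s = 0.
Proof.
  intros Hk Hp Hpc Hs0 Ex Ev Hs.
  assert (HC : forall t, I t -> x t ^ 2 = energy k (v t)).
  { intros t Ht. pose proof (first_integral k I x v t s0 Hk Hp Hpc Ht Hs0) as E.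
    rewrite Ex, Ev, energy_0 in E. lra. }
  destruct (kinetic_bound k Hk Hp) as (M & HM & Hb).
  destruct Hpc as [cI cx cv Hr Hd].
  assert (Hv : forall t, I t -> Rabs (v t) <= M * x t).
  { intros t Ht. destruct (Hr t Ht) as [Hx Hv].
    rewrite <- (Rabs_pos_eq (M * x t)) by (apply Rmult_le_pos; lra).
    apply Rsqr_le_abs_0. unfold Rsqr. specialize (Hb (v t) ltac:(lra)).
    rewrite <- HC in Hb by auto. nra. }
  assert (Hexp : forall c, continuous_on I (fun t => x t * exp (c * t))).
  { intros c. apply continuous_on_mult; auto. apply continuous_on_forall. intros t _.
    apply continuous_of_is_derive with (c * exp (c * t)). auto_derive; auto. ring. }
  assert (Hdexp : forall c t, locally t I ->
    is_derive (fun t => x t * exp (c * t)) t ((v t + c * x t) * exp (c * t))).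
  { intros c t Ht. destruct (Hd t Ht) as [Hx _]. evar_last.
    - apply (is_derive_mult x (fun t => exp (c * t)) t (v t) (c * exp (c * t))); auto.
      + auto_derive; auto. ring.
      + intros; apply Rmult_comm.
    - unfold plus, mult; simpl. ring. }
  assert (Hx0 : x s = 0).
  { destruct (Hr s Hs) as [Hx _]. apply Rle_antisym; auto.
    destruct (Rle_or_lt s0 s) as [Hle|Hlt].
    - assert (H : - (x s0 * exp (- M * s0)) <= - (x s * exp (- M * s))).
      { apply (nondecreasing_of_derive I (fun t => - (x t * exp (- M * t)))
          (fun t => - ((v t + - M * x t) * exp (- M * t)))); auto.
        - apply (continuous_on_comp I (fun t => x t * exp (- M * t)) (fun y => - y)); auto.
          intros t _. apply (continuous_Ropp (fun y => y)), continuous_id.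
        - intros t Ht. split.
          + apply (is_derive_opp (fun t => x t * exp (- M * t))), Hdexp, Ht.
          + pose proof (exp_pos (- M * t)).
            pose proof (Rle_abs (v t)). specialize (Hv t (locally_singleton _ _ Ht)). nra. }
      rewrite Ex in H. pose proof (exp_pos (- M * s)). nra.
    - assert (H : x s * exp (M * s) <= x s0 * exp (M * s0)).
      { apply (nondecreasing_of_derive I (fun t => x t * exp (M * t))
          (fun t => (v t + M * x t) * exp (M * t))); auto.
        - intros t Ht. split.
          + apply Hdexp, Ht.
          + pose proof (exp_pos (M * t)). pose proof (Rle_abs (- v t)).
            rewrite Rabs_Ropp in H0. specialize (Hv t (locally_singleton _ _ Ht)). nra.
        - lra. }
      rewrite Ex in H. pose proof (exp_pos (M * s)). nra. }
  split; auto.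
  destruct (Req_dec (v s) 0) as [|Hne]; auto.
  pose proof (energy_pos k (v s) Hk Hp Hne) as Hpos. rewrite <- HC, Hx0 in Hpos by auto. lra.
Qed.

(** * Solutions by quadrature *)

Definition flow (k : R -> R) (J : R -> Prop) (X V : R -> R) : Prop :=
  open J /\ convex J /\
  forall s, J s -> is_derive X s (V s) /\ is_derive V s (X s * k (V s)).

(** Cuts out of the larger interval [J] of the prolonged curve the part belonging to an orbit: the
    axis [X = 0] is kept, the rims [V = -1, 1] are not. *)
Definition admissible (J : R -> Prop) (X V : R -> R) (s : R) : Prop :=
  J s /\ 0 <= X s /\ -1 < V s < 1.

(* [(X, V)] represents, up to time shifts, every phase curve through a point satisfying [Q]. *)
Record canonical (k : R -> R) (J : R -> Prop) (X V : R -> R) (Q : R -> R -> Prop) : Prop := {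
  can_flow : flow k J X V;
  can_inj : forall s t, J s -> J t -> X s = X t -> V s = V t -> s = t;
  can_convex : convex (admissible J X V);
  can_nontrivial : exists s t, admissible J X V s /\ admissible J X V t /\ s < t;
  can_axis : forall s, J s -> X s = 0 -> V s <> 0;
  can_invariant : forall s, admissible J X V s -> Q (X s) (V s);
  can_universal : forall I x v s0, phase_curve k I x v -> I s0 -> Q (x s0) (v s0) ->
    exists c, forall s, I s ->
      admissible J X V (s - c) /\ x s = X (s - c) /\ v s = V (s - c)
}.

Arguments can_axis {k J X V Q}.
Arguments can_convex {k J X V Q}.
Arguments can_flow {k J X V Q}.
Arguments can_inj {k J X V Q}.
Arguments can_invariant {k J X V Q}.
Arguments can_nontrivial {k J X V Q}.
Arguments can_universal {k J X V Q}.

(** [a] and [b] are the times of the rims and [c] that of the waist; the rims belong to [J] but not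
    to [D]. *)
Definition waist_shape (J : R -> Prop) (X V : R -> R) (D : R -> Prop) (x0 : R) : Prop :=
  exists a c b, a < c < b /\ J a /\ J b /\ V a = -1 /\ V b = 1 /\ X c = x0 /\ 0 < x0 /\
    (forall s, D s <-> a < s < b) /\ (forall s, J s -> s <> c -> x0 < X s).

(* [sg = 1] when the axis endpoint [a] precedes the rim endpoint [b], [sg = -1] otherwise. *)
Definition axis_shape (J : R -> Prop) (X V : R -> R) (D : R -> Prop) (nu0 : R) : Prop :=
  exists sg a b S, (sg = 1 \/ sg = -1) /\ 0 < sg * (b - a) /\ J a /\ J b /\
    X a = 0 /\ V a = nu0 /\ V b = sg /\ 0 < X b /\
    (forall s, D s <-> 0 <= sg * (s - a) /\ 0 < sg * (b - s)) /\
    (forall s, D s -> 0 <= X s < X b /\ S (X s) = s) /\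
    (forall x, 0 <= x < X b -> D (S x) /\ X (S x) = x /\ continuous S x).

(** [sg] is the sign of [V]; the rim [b] comes after the unbounded end when [sg = 1] and before it
    when [sg = -1]. The last clause keeps [|V|] away from 1 far out, so that the height changes at a
    definite rate there. *)
Definition asymptotic_shape (J : R -> Prop) (X V : R -> R) (D : R -> Prop) (sg : R) : Prop :=
  exists b, J b /\ V b = sg /\ (forall s, D s <-> 0 < sg * (b - s)) /\
    (forall s, 0 < sg * (b - s) -> J s) /\
    (forall s, J s -> 0 < X s) /\
    (forall e, 0 < e -> exists t, forall s, 0 < sg * (t - s) -> X s < e) /\
    (exists d t, 0 < d /\ forall s, 0 < sg * (t - s) -> Rabs (V s) <= 1 - d).

Section Canonical.

Variable k : R -> R.
Hypothesis k_cont : forall t, continuous k t.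
Hypothesis k_pos : forall t, 0 < k t.

Let k_neq0 (t : R) : k t <> 0.
Proof. apply Rgt_not_eq, k_pos. Qed.

Notation G := (energy k).

(** On the level [x0 ^ 2] the radius is [f v = sqrt (x0 ^ 2 + G v)], and [v' = f v * k v] is a
    scalar equation with positive right-hand side. The minimum of [f] is at [v = 0], where it equals
    [x0]. *)
Lemma canonical_waist (x0 : R) : 0 < x0 ->
  exists J X V, canonical k J X V (fun x v => x ^ 2 - G v = x0 ^ 2) /\
    waist_shape J X V (admissible J X V) x0.
Proof.
  intros Hx0.
  set (f := fun p => sqrt (x0 ^ 2 + G p)).
  assert (HG : forall p, 0 <= G p).
  { intros p. destruct (Req_dec p 0) as [->|]. rewrite energy_0; lra.
    apply Rlt_le, energy_pos; auto. }
  assert (Hpos : forall p, 0 < x0 ^ 2 + G p) by (intros p; specialize (HG p); nra).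
  assert (Hf : forall p, 0 < f p) by (intros p; apply sqrt_lt_R0, Hpos).
  assert (Hf0 : forall p, f p <> 0) by (intros p; apply Rgt_not_eq, Hf).
  assert (Hf2 : forall p, f p ^ 2 = x0 ^ 2 + G p).
  { intros p. unfold f. rewrite pow2_sqrt; auto. now apply Rlt_le. }
  assert (dW : forall p, is_derive (fun p => x0 ^ 2 + G p) p (2 * p / k p)).
  { intros p. evar_last. apply (is_derive_plus (fun _ => x0 ^ 2) G).
    apply is_derive_const. apply energy_derive; auto. unfold plus, zero; simpl. ring. }
  assert (df : forall p, is_derive f p (p / k p / f p)).
  { intros p. evar_last. apply (is_derive_sqrt (fun p => x0 ^ 2 + G p)). apply dW. apply Hpos.
    fold (f p). field. auto. }
  (* The interval exceeds [[-1, 1]], so that the times of both rims are interior to [J]. *)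
  destruct (quadrature (fun p => -2 < p < 2) (fun p => f p * k p) 0)
    as (J & S & P & oJ & cJ & S0 & HS & HP).
  - apply (open_and (fun p => -2 < p) (fun p => p < 2)). apply open_gt. apply open_lt.
  - intros s t u. simpl. intros; lra.
  - lra.
  - intros p _. split.
    + apply (continuous_mult f k); auto. eapply continuous_of_is_derive, df.
    + apply Rmult_lt_0_compat; auto.
  - set (X := fun s => f (P s)).
    assert (Hfl : flow k J X P).
    { split; [| split]; auto. intros s Hs. destruct (HP s Hs) as (_ & _ & d). split.
      - evar_last. apply (is_derive_comp f P). apply df. exact d.
        unfold scal; simpl; unfold mult; simpl. field.
        auto.
      - exact d. }
    assert (incP : forall s t, J s -> J t -> s < t -> P s < P t).
    { intros s t. apply increasing_of_derive with (fun s => f (P s) * k (P s)); auto.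
      - apply continuous_on_forall. intros u Hu. eapply continuous_of_is_derive, HP, Hu.
      - intros u Hu%locally_singleton. split. now apply HP. apply Rmult_lt_0_compat; auto. }
    assert (Ja : J (S (-1))) by (apply HS; lra).
    assert (Jb : J (S 1)) by (apply HS; lra).
    assert (J0 : J (S 0)) by (apply HS; lra).
    assert (Pa : P (S (-1)) = -1) by (apply HS; lra).
    assert (Pb : P (S 1) = 1) by (apply HS; lra).
    assert (P0 : P (S 0) = 0) by (apply HS; lra).
    assert (Hadm : forall s, admissible J X P s <-> S (-1) < s < S 1).
    { intros s. split.
      - intros (Hs & _ & Hv). split.
        + destruct (Rtotal_order (S (-1)) s) as [H|[<-|H]]; auto. lra.
          specialize (incP _ _ Hs Ja H). lra.
        + destruct (Rtotal_order s (S 1)) as [H|[->|H]]; auto. lra.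
          specialize (incP _ _ Jb Hs H). lra.
      - intros [Ha Hb]. assert (Hs : J s) by (apply (cJ (S (-1)) (S 1)); auto; lra).
        split; auto. split. apply Rlt_le, Hf.
        specialize (incP _ _ Ja Hs Ha) as H1. specialize (incP _ _ Hs Jb Hb) as H2. lra. }
    assert (Hord : S (-1) < S 0 < S 1).
    { apply Hadm. split; auto. split. apply Rlt_le, Hf. lra. }
    exists J, X, P. split; [constructor |]; auto.
    + intros s t Hs Ht _ E. destruct (HP s Hs) as (_ & <- & _).
      destruct (HP t Ht) as (_ & <- & _). now rewrite E.
    + intros s t u Hs%Hadm Ht%Hadm Hu. apply Hadm. lra.
    + exists (S 0), ((S 0 + S 1) / 2). rewrite !Hadm. lra.
    + intros s _ H. specialize (Hf (P s)). unfold X in H. lra.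
    + intros s _. unfold X. rewrite Hf2. ring.
    + intros I x v s0 Hpc Hs0 HQ.
      assert (HC : forall s, I s -> x s = f (v s)).
      { intros s Hs. pose proof (first_integral k I x v s s0 k_cont k_pos Hpc Hs Hs0) as E.
        destruct (pc_range _ _ _ _ Hpc s Hs) as [Hx _].
        apply Rsqr_inj; auto. apply Rlt_le, Hf. unfold Rsqr.
        specialize (Hf2 (v s)). lra. }
      destruct Hpc as [cI cx cv Hr Hd].
      (* The conserved quantity [S (v s) - s] is, up to sign, the time shift [c] between the given
         curve and the canonical one. *)
      assert (HI : forall s, I s -> S (v s) - s = S (v s0) - s0).
      { intros s Hs.
        apply (quadrature_time I (fun p => -2 < p < 2) S (fun p => f p * k p)); auto.
        - intros u Hu. specialize (Hr u Hu). lra.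
        - intros p Hp. split. now apply Rmult_lt_0_compat. now apply HS.
        - intros u Hu. rewrite <- HC by exact (locally_singleton _ _ Hu).
          exact (proj2 (Hd u Hu)). }
      exists (s0 - S (v s0)). intros s Hs. specialize (HI s Hs).
      replace (s - (s0 - S (v s0))) with (S (v s)) by lra.
      destruct (HS (v s)) as (H1 & H2 & _). specialize (Hr s Hs); lra.
      unfold X. rewrite H2, <- HC by auto. specialize (Hr s Hs).
      split; auto. split; auto. unfold X. rewrite H2, <- HC by auto. tauto.
    + exists (S (-1)), (S 0), (S 1). do 5 (split; auto). split; [| split; [| split]]; auto.
      * unfold X. rewrite P0. unfold f. rewrite energy_0, Rplus_0_r. apply sqrt_pow2. lra.
      * intros s Hs Hne. unfold X.
        assert (Hn : P s <> 0).
        { intros E. apply Hne. destruct (HP s Hs) as (_ & <- & _). now rewrite E. }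
        pose proof (energy_pos k (P s) k_cont k_pos Hn).
        specialize (Hf2 (P s)). specialize (Hf (P s)). nra.
Qed.

Lemma energy_inj_pos (u v : R) : 0 < u -> 0 < v -> G u = G v -> u = v.
Proof.
  intros Hu Hv E. destruct (Rtotal_order u v) as [H|[H|H]]; auto.
  - pose proof (energy_increasing k k_cont k_pos u v). lra.
  - pose proof (energy_increasing k k_cont k_pos v u). lra.
Qed.

Lemma energy_lt_pos (u v : R) : 0 < u -> 0 < v -> (G u < G v <-> u < v).
Proof.
  intros Hu Hv. split; intros H.
  - destruct (Rtotal_order u v) as [H1|[->|H1]]; auto. lra.
    pose proof (energy_increasing k k_cont k_pos v u). lra.
  - apply energy_increasing; auto. lra.
Qed.

(** The branch [v > 0] of the inverse of [energy]. The upper end 2 keeps values beyond the rim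
    [v = 1] in range; the lower end 0 is excluded because the derivative of [energy] vanishes
    there. *)
Lemma energy_inverse :
  exists N : R -> R, forall y, 0 < y < G 2 ->
    0 < N y /\ G (N y) = y /\ is_derive N y (k (N y) / (2 * N y)).
Proof.
  destruct (inverse_of_increasing (fun u => 0 < u < 2) G (fun u => 2 * u / k u))
    as [N HN].
  - apply (open_and (fun p => 0 < p) (fun p => p < 2)). apply open_gt. apply open_lt.
  - intros s t u. simpl. intros; lra.
  - intros u _. apply energy_derive; auto.
  - intros u Hu. apply Rdiv_lt_0_compat; auto. lra.
  - exists N. intros y Hy.
    destruct (intermediate_value (fun _ => True) G 0 2 y) as (u & Hu & <-); auto.
    + exact convex_True.
    + apply continuous_on_forall. intros u _. apply energy_continuous; auto.
    + lra.
    + rewrite energy_0. lra.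
    + assert (Hu' : 0 < u < 2).
      { split.
        - destruct (Req_dec u 0) as [->|]. rewrite energy_0 in Hy. lra. lra.
        - destruct (Req_dec u 2) as [->|]; lra. }
      destruct (HN u Hu') as [E d]. rewrite E. do 2 (split; [tauto|]).
      evar_last. exact d. field. split; [lra | auto].
Qed.

(** On the branch [v > 0] of a level [C <= 0] one has [v = N (x ^ 2 - C)], so [x' = v] is a scalar
    equation in [x]. The axis case [C < 0] and the asymptotic case [C = 0] are treated together;
    [- C < G 1] makes the rim radius [r] positive. The time function [S], inverse to [X], is
    returned because both shapes are read off from it. *)
Lemma canonical_nonneg (C : R) : C <= 0 -> - C < G 1 ->
  exists J X V S r,
    canonical k J X V (fun x v => x ^ 2 - G v = C /\ 0 < v) /\
    0 < r /\ r ^ 2 - C = G 1 /\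
    (forall s, J s -> 0 < V s /\ X s ^ 2 - C = G (V s) /\ (0 < X s \/ C < 0) /\ S (X s) = s) /\
    (forall x, x ^ 2 - C < G 2 -> 0 < x \/ C < 0 ->
       J (S x) /\ X (S x) = x /\ is_derive S x (/ V (S x))) /\
    (forall s, admissible J X V s <-> J s /\ 0 <= X s < r) /\
    (forall s t, J s -> J t -> s < t -> X s < X t).
Proof.
  intros HC HC1.
  destruct energy_inverse as [N HN].
  (* For [C < 0] negative [x] are allowed, so that the curve is prolonged across the axis and
     [x = 0] is interior to [D]. For [C = 0] the speed would vanish at [x = 0], which is therefore
     left out. *)
  set (D := fun x => x ^ 2 - C < G 2 /\ (0 < x \/ C < 0)).
  assert (HD : forall x, D x -> 0 < x ^ 2 - C < G 2).
  { intros x [H1 H2]. split; auto. nra. }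
  set (f := fun x => N (x ^ 2 - C)).
  assert (Hf : forall x, D x -> 0 < f x) by (intros x Hx; apply HN, HD, Hx).
  assert (Hf2 : forall x, D x -> G (f x) = x ^ 2 - C) by (intros x Hx; apply HN, HD, Hx).
  assert (df : forall x, D x -> is_derive f x (k (f x) * x / f x)).
  { intros x Hx.
    assert (d2 : is_derive (fun x => x ^ 2 - C) x (2 * x)) by (auto_derive; auto; ring).
    evar_last.
    - apply (is_derive_comp N (fun x => x ^ 2 - C)); [apply HN, HD, Hx | exact d2].
    - change (2 * x * (k (f x) / (2 * f x)) = k (f x) * x / f x).
      specialize (Hf x Hx). field. lra. }
  assert (H12 : G 1 < G 2) by (apply energy_increasing; auto; lra).
  (* The value of [x] on this level at [v = 1], that is, the radius of the rim. *)
  set (r := sqrt (G 1 + C)).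
  assert (Hr : 0 < r) by (apply sqrt_lt_R0; lra).
  assert (Hr2 : r ^ 2 - C = G 1) by (unfold r; rewrite pow2_sqrt; lra).
  assert (Dr : forall x, 0 < x <= r -> D x) by (intros x Hx; split; [nra | tauto]).
  destruct (quadrature D f r) as (J & S & X & oJ & cJ & _ & HS & HX).
  - apply open_and.
    + apply (open_comp (fun x => x ^ 2 - C) (fun y => y < G 2)); [| apply open_lt].
      intros x _. apply (continuous_of_ex_derive (fun x => x ^ 2 - C)). auto_derive; auto.
    + apply open_or. apply open_gt. intros x Hx. apply filter_forall. intros _. exact Hx.
  - intros s t u [Hs1 Hs2] [Ht1 Ht2] Hu. split; [| lra].
    destruct (Rle_or_lt 0 u).
    + assert (u ^ 2 <= t ^ 2) by (apply pow_incr; lra). lra.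
    + assert ((- u) ^ 2 <= (- s) ^ 2) by (apply pow_incr; lra). lra.
  - apply Dr. lra.
  - intros x Hx. split; auto. eapply continuous_of_is_derive, df, Hx.
  - set (V := fun s => f (X s)).
    assert (HV : forall s, J s -> 0 < V s) by (intros s Hs; apply Hf, HX, Hs).
    assert (HGV : forall s, J s -> G (V s) = X s ^ 2 - C) by (intros s Hs; apply Hf2, HX, Hs).
    assert (Hfl : flow k J X V).
    { split; [| split]; auto. intros s Hs. destruct (HX s Hs) as (H1 & _ & d). split; auto.
      evar_last. apply (is_derive_comp f X). apply df, H1. exact d.
      change (V s * (k (V s) * X s / V s) = X s * k (V s)).
      specialize (HV s Hs). field. lra. }
    assert (incX : forall s t, J s -> J t -> s < t -> X s < X t).
    { intros s t. apply increasing_of_derive with V; auto.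
      - apply continuous_on_forall. intros u Hu. eapply continuous_of_is_derive, HX, Hu.
      - intros u Hu%locally_singleton. split; auto. now apply HX. }
    assert (Hadm : forall s, admissible J X V s <-> J s /\ 0 <= X s < r).
    { intros s. split.
      - intros (Hs & Hx & Hv). split; auto. split; auto.
        assert (H : G (V s) < G 1) by (apply energy_lt_pos; auto; lra).
        rewrite HGV in H by auto. nra.
      - intros (Hs & Hx). split; auto. split. tauto. specialize (HV s Hs). split. lra.
        apply energy_lt_pos; auto. lra. rewrite HGV by auto. nra. }
    exists J, X, V, S, r. split; [constructor |]; auto.
    + intros s t Hs Ht E _. destruct (HX s Hs) as (_ & <- & _).
      destruct (HX t Ht) as (_ & <- & _). now rewrite E.
    + intros s t u [Hs1 Hs2]%Hadm [Ht1 Ht2]%Hadm Hu. apply Hadm.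
      assert (Hu' : J u) by (apply (cJ s t); auto). split; auto.
      destruct (Req_dec s u) as [->|]; auto. destruct (Req_dec u t) as [->|]; auto.
      pose proof (incX s u Hs1 Hu' ltac:(lra)). pose proof (incX u t Hu' Ht1 ltac:(lra)). lra.
    + assert (D1 : D (r / 3)) by (apply Dr; lra). assert (D2 : D (r / 2)) by (apply Dr; lra).
      destruct (HS _ D1) as (J1 & X1 & _). destruct (HS _ D2) as (J2 & X2 & _).
      exists (S (r / 3)), (S (r / 2)). rewrite !Hadm, X1, X2.
      split; [split; [auto | lra] |]. split; [split; [auto | lra] |].
      destruct (Rtotal_order (S (r / 3)) (S (r / 2))) as [H|[H|H]]; auto.
      * rewrite H, X2 in X1. lra.
      * specialize (incX _ _ J2 J1 H). lra.
    + intros s Hs _. specialize (HV s Hs). lra.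
    + intros s (Hs & _). split; auto. rewrite HGV by auto. ring.
    + intros I x v s0 Hpc Hs0 [HQ Hv0].
      assert (HE : forall s, I s -> x s ^ 2 - G (v s) = C).
      { intros s Hs. rewrite <- HQ. now apply first_integral with I. }
      (* [v = 0] forces [x ^ 2 = C <= 0], hence the equilibrium, which a curve with [v s0 > 0]
         cannot meet. By the intermediate value theorem [v] then stays positive. *)
      assert (Hne : forall s, I s -> v s <> 0).
      { intros s Hs E. pose proof (HE s Hs) as E1. rewrite E, energy_0 in E1.
        assert (x s = 0) by nra.
        destruct (equilibrium_isolated k I x v s s0) as [_ E2]; auto. lra. }
      pose proof Hpc as [cI cx cv Hrg Hd].
      assert (Hpos : forall s, I s -> 0 < v s).
      { intros s Hs. destruct (Rlt_or_le 0 (v s)) as [|Hle]; auto. exfalso.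
        destruct (Rle_or_lt s s0) as [H|H].
        - destruct (intermediate_value I v s s0 0) as (c & Hc & E); auto. lra.
          apply (Hne c); auto. now apply (cI s s0).
        - destruct (intermediate_value I v s0 s 0) as (c & Hc & E); auto; try lra.
          apply (Hne c); auto. apply (cI s0 s); auto. }
      assert (HDx : forall s, I s -> D (x s)).
      { intros s Hs. specialize (HE s Hs). destruct (Hrg s Hs) as [Hx Hv].
        specialize (Hpos s Hs). split.
        - enough (G (v s) < G 2) by lra. apply energy_lt_pos; lra.
        - destruct HC as [HC|HC]; auto. left.
          pose proof (energy_pos k (v s) k_cont k_pos (Hne s Hs)). nra. }
      assert (Hfx : forall s, I s -> f (x s) = v s).
      { intros s Hs. apply energy_inj_pos; auto. rewrite Hf2 by auto.
        specialize (HE s Hs). lra. }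
      assert (HI : forall s, I s -> S (x s) - s = S (x s0) - s0).
      { intros s Hs. apply (quadrature_time I D S f); auto.
        - intros p Hp. split; auto. now apply HS.
        - intros u Hu. rewrite Hfx by exact (locally_singleton _ _ Hu).
          exact (proj1 (Hd u Hu)). }
      exists (s0 - S (x s0)). intros s Hs. specialize (HI s Hs).
      replace (s - (s0 - S (x s0))) with (S (x s)) by lra.
      destruct (HS (x s) (HDx s Hs)) as (H1 & H2 & _). specialize (Hrg s Hs).
      unfold admissible, V. rewrite H2, Hfx by auto. tauto.
    + do 2 (split; auto). split; [| split; [| split]]; auto.
      * intros s Hs. destruct (HX s Hs) as ([_ H1] & H2 & _). rewrite HGV; auto.
      * intros x Hx1 Hx2. assert (Hx : D x) by (split; auto).
        destruct (HS x Hx) as (H1 & H2 & H3). unfold V. rewrite H2. auto.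
Qed.

Lemma canonical_axis_pos (nu0 : R) : 0 < nu0 < 1 ->
  exists J X V, canonical k J X V (fun x v => x ^ 2 - G v = - G nu0 /\ 0 < v) /\
    axis_shape J X V (admissible J X V) nu0.
Proof.
  intros Hnu.
  pose proof (energy_pos k nu0 k_cont k_pos ltac:(lra)) as H0.
  pose proof (energy_increasing k k_cont k_pos nu0 1 ltac:(lra)) as H1.
  pose proof (energy_increasing k k_cont k_pos 1 2 ltac:(lra)) as H2.
  destruct (canonical_nonneg (- G nu0)) as (J & X & V & S & r & Hcan & Hr & Hr2 & HJ & HS & Hadm & inc);
    try lra.
  destruct (HS 0) as (Ja & Xa & _); [lra | lra |].
  destruct (HS r) as (Jb & Xb & _); [lra | lra |].
  assert (inc' : forall s t, J s -> J t -> X s < X t -> s < t).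
  { intros s t Hs Ht H. destruct (Rtotal_order s t) as [|[->|H']]; auto. lra.
    specialize (inc t s Ht Hs H'). lra. }
  exists J, X, V. split; auto. exists 1, (S 0), (S r), S. rewrite Xb.
  split; [now left |]. split.
  { specialize (inc' (S 0) (S r) Ja Jb). lra. }
  do 2 (split; auto). split; auto. split.
  { destruct (HJ _ Ja) as (Hv & E & _). rewrite Xa in E. apply energy_inj_pos; lra. }
  split.
  { destruct (HJ _ Jb) as (Hv & E & _). rewrite Xb in E. apply energy_inj_pos; lra. }
  split; auto. split; [| split].
  - intros s. rewrite Hadm. destruct (can_flow Hcan) as (_ & cJ & _). split.
    + intros (Hs & [Hx|Hx] & Hxr); specialize (inc' s (S r) Hs Jb) as H3.
      * specialize (inc' (S 0) s Ja Hs). lra.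
      * destruct (HJ s Hs) as (_ & _ & _ & E). rewrite <- Hx in E. subst s. lra.
    + intros [Hs1 Hs2]. assert (Hs : J s) by (apply (cJ (S 0) (S r)); auto; lra).
      split; auto. split.
      * destruct (Req_dec (S 0) s) as [<-|]. lra. specialize (inc (S 0) s Ja Hs). lra.
      * specialize (inc s (S r) Hs Jb). lra.
  - intros s [Hs Hx]%Hadm. split; auto. now apply HJ.
  - intros x Hx. destruct (HS x) as (H3 & H4 & H5). nra. lra.
    split; [| split]; auto.
    + apply Hadm. rewrite H4. auto.
    + eapply continuous_of_is_derive, H5.
Qed.

(** The level zero. What has to be added to [canonical_nonneg] is that the axis is approached only
    in infinite time, so that [J] contains a whole half-line. *)
Lemma canonical_asymptotic_pos :
  exists J X V, canonical k J X V (fun x v => x ^ 2 - G v = 0 /\ 0 < v) /\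
    asymptotic_shape J X V (admissible J X V) 1.
Proof.
  pose proof (energy_pos k 1 k_cont k_pos ltac:(lra)) as H1.
  pose proof (energy_increasing k k_cont k_pos 1 2 ltac:(lra)) as H2.
  destruct (canonical_nonneg 0) as (J & X & V & S & r & Hcan & Hr & Hr2 & HJ & HS & Hadm & inc);
    try lra.
  assert (HS' : forall x, 0 < x <= r -> J (S x) /\ X (S x) = x).
  { intros x Hx. destruct (HS x) as (H3 & H4 & _). nra. lra. auto. }
  destruct (HS' r) as (Jb & Xb); [lra |].
  assert (Vb : V (S r) = 1).
  { destruct (HJ _ Jb) as (Hv & E & _). rewrite Xb in E. apply energy_inj_pos; lra. }
  assert (Xpos : forall s, J s -> 0 < X s).
  { intros s Hs. destruct (HJ s Hs) as (_ & _ & H & _). lra. }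
  assert (inc' : forall s t, J s -> J t -> X s < X t -> s < t).
  { intros s t Hs Ht H. destruct (Rtotal_order s t) as [|[->|H']]; auto. lra.
    specialize (inc t s Ht Hs H'). lra. }
  destruct (can_flow Hcan) as (_ & cJ & Hd).
  destruct (kinetic_bound k k_cont k_pos) as (M & HM & HMb).
  (* Since [V <= M * X] before the rim, [X t * exp (M * (S r - t))] does not increase: going
     backwards from the rim, [X] decays at most exponentially. *)
  assert (Hlow : forall s, J s -> s <= S r -> r * exp (M * (s - S r)) <= X s).
  { intros s Hs Hsr.
    assert (H : - (X s * exp (M * (S r - s))) <= - (X (S r) * exp (M * (S r - S r)))).
    { apply (nondecreasing_of_derive (fun t => J t /\ t <= S r)
        (fun t => - (X t * exp (M * (S r - t))))
        (fun t => (M * X t - V t) * exp (M * (S r - t)))); try (split; auto; lra); auto.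
      - intros u v w [Hu1 Hu2] [Hv1 Hv2] Hw. split; [apply (cJ u v); auto | lra].
      - apply continuous_on_forall. intros t [Ht _].
        eapply continuous_of_is_derive. auto_derive; [| reflexivity].
        exists (V t). now apply Hd.
      - intros t [Ht Htr]%locally_singleton. split.
        + destruct (Hd t Ht) as [dX _]. auto_derive; [now exists (V t) |].
          replace (Derive (fun x => X x) t) with (V t)
            by (symmetry; apply is_derive_unique, dX). unfold Rminus. ring.
        + apply Rmult_le_pos; [| apply Rlt_le, exp_pos].
          assert (HVt : 0 < V t <= 1).
          { destruct (HJ t Ht) as (Hv & E & _). split; auto.
            destruct (Rle_or_lt (V t) 1) as [|Hgt]; auto.
            assert (G 1 < G (V t)) by (apply energy_lt_pos; lra).
            assert (X t <= r).
            { rewrite <- Xb. destruct Htr as [Htr | ->]; [| lra].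
              apply Rlt_le, inc; auto. }
            specialize (Xpos t Ht). nra. }
          specialize (HMb (V t) ltac:(lra)). destruct (HJ t Ht) as (Hv & E & _).
          rewrite <- E in HMb. specialize (Xpos t Ht).
          enough (V t <= M * X t) by lra. apply Rsqr_incr_0; unfold Rsqr; nra. }
    replace (M * (S r - S r)) with 0 in H by ring.
    rewrite exp_0, Xb in H.
    replace (M * (s - S r)) with (- (M * (S r - s))) by ring.
    rewrite exp_Ropp. pose proof (exp_pos (M * (S r - s))).
    apply Rmult_le_reg_r with (exp (M * (S r - s))); auto.
    rewrite Rmult_assoc, Rinv_l by lra. lra. }
  (* If [t] were missing from [J], all times of [J] up to [S r] would exceed [t] and [X] would be at
     least [e] on them; but [X] takes every value in [(0, r]], in particular one below [e]. *)
  assert (HJall : forall s, s < S r -> J s).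
  { intros t Ht. destruct (classic (J t)) as [|Hnt]; auto. exfalso.
    set (e := r * exp (M * (t - S r))).
    assert (He : 0 < e) by (apply Rmult_lt_0_compat; [auto | apply exp_pos]).
    assert (Hx : exists x, 0 < x < e /\ x < r).
    { exists (Rmin (e / 2) (r / 2)).
      pose proof (Rmin_l (e / 2) (r / 2)). pose proof (Rmin_r (e / 2) (r / 2)).
      pose proof (Rmin_pos (e / 2) (r / 2)). lra. }
    destruct Hx as (x & Hx & Hxr0).
    destruct (HS' x) as [Jx Xx]. lra.
    assert (Hxr : S x < S r) by (apply inc'; auto; rewrite Xx, Xb; lra).
    assert (Htx : t <= S x).
    { destruct (Rle_or_lt t (S x)) as [|Hlt]; auto. exfalso. apply Hnt.
      apply (cJ (S x) (S r)); auto. lra. }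
    specialize (Hlow (S x) Jx ltac:(lra)). rewrite Xx in Hlow.
    assert (exp (M * (t - S r)) <= exp (M * (S x - S r))).
    { destruct Htx as [Htx | ->]; [| lra]. apply Rlt_le, exp_increasing. nra. }
    unfold e in *. nra. }
  exists J, X, V. split.
  { destruct Hcan. constructor; auto. }
  exists (S r). do 2 (split; auto). split; [| split; [| split; [| split]]]; auto.
  - intros s. rewrite Hadm. split.
    + intros (Hs & Hx). enough (s < S r) by lra. apply inc'; auto. lra.
    + intros Hs. assert (Hs' : J s) by (apply HJall; lra). split; auto.
      specialize (inc s (S r) Hs' Jb ltac:(lra)). specialize (Xpos s Hs'). lra.
  - intros s Hs. apply HJall. lra.
  - intros e He. exists (S (Rmin e r)). intros s Hs.
    assert (Hm : 0 < Rmin e r <= r) by (split; [apply Rmin_pos; auto | apply Rmin_r]).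
    destruct (HS' _ Hm) as [Jm Xm].
    assert (Hle : S (Rmin e r) <= S r).
    { destruct (Rle_or_lt (S (Rmin e r)) (S r)) as [|H]; auto.
      specialize (inc _ _ Jb Jm H). lra. }
    specialize (inc s _ (HJall s ltac:(lra)) Jm ltac:(lra)).
    pose proof (Rmin_l e r). lra.
  (* On this level [V] increases with [X]. Before the time at which [X = r / 2] it is therefore
     below its value at that time, which is less than 1. *)
  - destruct (HS' (r / 2)) as [Jm Xm]; [lra |].
    assert (Hm : S (r / 2) < S r) by (apply inc'; auto; lra).
    destruct (HJ _ Jm) as (Hv & E & _).
    assert (HV1 : V (S (r / 2)) < 1) by (apply energy_lt_pos; auto; [lra | rewrite <- E, Xm; nra]).
    exists (1 - V (S (r / 2))), (S (r / 2)). split. lra. intros s Hs.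
    assert (Js : J s) by (apply HJall; lra).
    destruct (HJ _ Js) as (Hv' & E' & _).
    specialize (inc _ _ Js Jm ltac:(lra)). specialize (Xpos s Js).
    rewrite Rabs_pos_eq by lra. enough (V s < V (S (r / 2))) by lra.
    apply energy_lt_pos; auto. rewrite <- E, <- E'. nra.
Qed.

End Canonical.

Lemma canonical_ext (k : R -> R) (J : R -> Prop) (X V : R -> R) (Q Q' : R -> R -> Prop) :
  (forall x v, Q x v <-> Q' x v) -> canonical k J X V Q -> canonical k J X V Q'.
Proof.
  intros HQ [H1 H2 H3 H4 H5 H6 H7]. constructor; auto.
  - intros s Hs. now apply HQ, H6.
  - intros I x v s0 Hpc Hs0 H. apply (H7 I x v s0); auto. now apply HQ.
Qed.

(** * Reflection in a horizontal plane *)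

Lemma locally_opp (P : R -> Prop) (s : R) :
  locally s (fun t => P (- t)) <-> locally (- s) P.
Proof.
  assert (H : forall (P : R -> Prop) s, locally (- s) P -> locally s (fun t => P (- t))).
  { clear. intros P s [d Hd]. exists d. intros t Ht. apply Hd.
    change (Rabs (t - s) < d) in Ht. change (Rabs (- t - - s) < d).
    now replace (- t - - s) with (- (t - s)) by ring; rewrite Rabs_Ropp. }
  split; auto. intros Hl. rewrite <- (Ropp_involutive s) in Hl. apply H in Hl.
  revert Hl. apply filter_imp. intros t. now rewrite Ropp_involutive.
Qed.

(** Reflecting the profile in a horizontal plane and reversing its parameter turns [th] into
    [PI - th], so [v] changes sign and [k (- t)] takes the place of [k t]. *)
Lemma phase_curve_reflect (k : R -> R) (I : R -> Prop) (x v : R -> R) :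
  phase_curve k I x v ->
  phase_curve (fun t => k (- t)) (fun s => I (- s)) (fun s => x (- s)) (fun s => - v (- s)).
Proof.
  intros [cI cx cv Hr Hd].
  assert (Hc : forall f : R -> R, continuous_on I f -> continuous_on (fun s => I (- s)) (fun s => f (- s))).
  { intros f Hf s Hs P HP. specialize (Hf (- s) Hs P HP). unfold filtermap, within in *.
    now apply (locally_opp (fun t => I t -> P (f t))). }
  constructor.
  - intros s t u Hs Ht Hu. apply (cI (- t) (- s)); auto. lra.
  - now apply Hc.
  - apply (continuous_on_comp _ (fun s => v (- s)) (fun y => - y)). now apply Hc.
    intros s _. apply (continuous_Ropp (fun y => y)), continuous_id.
  - intros s Hs. specialize (Hr _ Hs). lra.
  - intros s Hs%locally_opp. destruct (Hd _ Hs) as [dx dv]. split.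
    + now apply is_derive_reflect.
    + rewrite Ropp_involutive. apply (is_derive_reflect v) in dv.
      evar_last. apply (is_derive_opp (fun s => v (- s))), dv.
      unfold opp; simpl. ring.
Qed.

Lemma canonical_reflect (k : R -> R) (J : R -> Prop) (X V : R -> R) (Q : R -> R -> Prop) :
  canonical (fun t => k (- t)) J X V Q ->
  canonical k (fun s => J (- s)) (fun s => X (- s)) (fun s => - V (- s)) (fun x v => Q x (- v)).
Proof.
  intros [(oJ & cJ & Hd) H2 H3 H4 H5 H6 H7].
  assert (Hadm : forall s, admissible (fun s => J (- s)) (fun s => X (- s)) (fun s => - V (- s)) s
                           <-> admissible J X V (- s)).
  { intros s. unfold admissible. intuition lra. }
  constructor.
  - split; [| split].
    + intros s Hs. apply locally_opp, oJ, Hs.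
    + intros s t u Hs Ht Hu. apply (cJ (- t) (- s)); auto. lra.
    + intros s Hs. destruct (Hd _ Hs) as [dx dv]. split.
      * now apply is_derive_reflect.
      * apply (is_derive_reflect V) in dv.
        evar_last. apply (is_derive_opp (fun s => V (- s))), dv.
        unfold opp; simpl. ring.
  - intros s t Hs Ht E1 E2. enough (- s = - t) by lra. apply H2; auto. lra.
  - intros s t u Hs%Hadm Ht%Hadm Hu. apply Hadm, (H3 (- t) (- s)); auto. lra.
  - destruct H4 as (s & t & Hs & Ht & Hst). exists (- t), (- s).
    rewrite !Hadm, !Ropp_involutive. repeat split; try apply Hs; try apply Ht. lra.
  - intros s Hs E. specialize (H5 _ Hs E). lra.
  - intros s Hs%Hadm. rewrite Ropp_involutive. now apply H6.
  - intros I x v s0 Hpc Hs0 HQ.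
    destruct (H7 _ _ _ (- s0) (phase_curve_reflect k I x v Hpc)) as [c Hc];
      rewrite ?Ropp_involutive; auto.
    exists (- c). intros s Hs. destruct (Hc (- s)) as (E1 & E2 & E3);
      rewrite ?Ropp_involutive in *; auto.
    rewrite Hadm. replace (- (s - - c)) with (- s - c) by ring.
    repeat split; try apply E1; auto. lra.
Qed.

Lemma admissible_reflect (J : R -> Prop) (X V : R -> R) (s : R) :
  admissible (fun s => J (- s)) (fun s => X (- s)) (fun s => - V (- s)) s
  <-> admissible J X V (- s).
Proof. unfold admissible. intuition lra. Qed.

Lemma axis_shape_reflect (J : R -> Prop) (X V : R -> R) (D D' : R -> Prop) (nu0 : R) :
  (forall s, D' s <-> D (- s)) ->
  axis_shape J X V D nu0 ->
  axis_shape (fun s => J (- s)) (fun s => X (- s)) (fun s => - V (- s)) D' (- nu0).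
Proof.
  intros HD (sg & a & b & S & Hsg & Hab & Ja & Jb & Xa & Va & Vb & Xb & HDs & HS & HX).
  exists (- sg), (- a), (- b), (fun x => - S x).
  rewrite !Ropp_involutive, Va, Vb.
  split; [lra |]. split; [nra |]. do 3 (split; auto). do 3 (split; auto). split; [| split].
  - intros s. rewrite HD, HDs. split; intros; nra.
  - intros s Hs%HD. destruct (HS _ Hs). split; auto. lra.
  - intros x Hx. rewrite HD, Ropp_involutive. destruct (HX x Hx) as (H1 & H2 & H3).
    do 2 (split; auto). now apply continuous_Ropp.
Qed.

Lemma asymptotic_shape_reflect (J : R -> Prop) (X V : R -> R) (D D' : R -> Prop) (sg : R) :
  (forall s, D' s <-> D (- s)) ->
  asymptotic_shape J X V D sg ->
  asymptotic_shape (fun s => J (- s)) (fun s => X (- s)) (fun s => - V (- s)) D' (- sg).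
Proof.
  intros HD (b & Jb & Vb & HDs & HJ & HX & Hlim & d & t & Hd & Ht).
  exists (- b). rewrite !Ropp_involutive, Vb. do 2 (split; auto).
  split; [| split; [| split; [| split]]].
  - intros s. rewrite HD, HDs. split; intros; nra.
  - intros s Hs. apply HJ. nra.
  - auto.
  - intros e He. destruct (Hlim e He) as [u Hu]. exists (- u). intros s Hs. apply Hu. nra.
  - exists d, (- t). split; auto. intros s Hs. rewrite Rabs_Ropp. apply Ht. nra.
Qed.

(** The level [- energy k nu0] has a branch with [v > 0] and one with [v < 0]; the condition
    [0 < v * nu0] selects the one that meets the axis with angle function [nu0]. *)
Lemma canonical_axis (k : R -> R) (nu0 : R) :
  (forall t, continuous k t) -> (forall t, 0 < k t) -> -1 < nu0 < 1 -> nu0 <> 0 ->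
  exists J X V,
    canonical k J X V (fun x v => x ^ 2 - energy k v = - energy k nu0 /\ 0 < v * nu0) /\
    axis_shape J X V (admissible J X V) nu0.
Proof.
  intros Hk Hp Hnu Hne. destruct (Rlt_or_le 0 nu0) as [H|H].
  - destruct (canonical_axis_pos k Hk Hp nu0) as (J & X & V & Hcan & Hsh); [lra |].
    exists J, X, V. split; auto. revert Hcan. apply canonical_ext.
    intros x v. split; intros; nra.
  - destruct (canonical_axis_pos (fun t => k (- t)) (continuous_reflect k Hk)
      (fun t => Hp (- t)) (- nu0)) as (J & X & V & Hcan & Hsh); [lra |].
    exists (fun s => J (- s)), (fun s => X (- s)), (fun s => - V (- s)). split.
    + apply canonical_reflect in Hcan. revert Hcan. apply canonical_ext.
      intros x v. rewrite !energy_opp by auto. split; intros; nra.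
    + rewrite <- (Ropp_involutive nu0). revert Hsh. apply axis_shape_reflect.
      apply admissible_reflect.
Qed.

Lemma canonical_asymptotic (k : R -> R) (sg : R) :
  (forall t, continuous k t) -> (forall t, 0 < k t) -> sg = 1 \/ sg = -1 ->
  exists J X V,
    canonical k J X V (fun x v => x ^ 2 - energy k v = 0 /\ 0 < v * sg) /\
    asymptotic_shape J X V (admissible J X V) sg.
Proof.
  intros Hk Hp [-> | ->].
  - destruct (canonical_asymptotic_pos k Hk Hp) as (J & X & V & Hcan & Hsh).
    exists J, X, V. split; auto. revert Hcan. apply canonical_ext.
    intros x v. split; intros; nra.
  - destruct (canonical_asymptotic_pos (fun t => k (- t)) (continuous_reflect k Hk)
      (fun t => Hp (- t))) as (J & X & V & Hcan & Hsh).
    exists (fun s => J (- s)), (fun s => X (- s)), (fun s => - V (- s)). split.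
    + apply canonical_reflect in Hcan. revert Hcan. apply canonical_ext.
      intros x v. rewrite !energy_opp by auto. split; intros; nra.
    + replace (-1) with (- (1)) by ring. revert Hsh. apply asymptotic_shape_reflect.
      apply admissible_reflect.
Qed.

(** The cases are the signs of the level. When it is negative, [energy k v - x ^ 2] lies between 0
    and [energy k v], so it is the energy of some [nu0] between 0 and [v]. *)
Lemma phase_curve_classification (k : R -> R) (x v : R) :
  (forall t, continuous k t) -> (forall t, 0 < k t) ->
  0 <= x -> -1 < v < 1 -> x <> 0 \/ v <> 0 ->
  (exists x0, 0 < x0 /\ x ^ 2 - energy k v = x0 ^ 2) \/
  (exists nu0, -1 < nu0 < 1 /\ nu0 <> 0 /\
     x ^ 2 - energy k v = - energy k nu0 /\ 0 < v * nu0) \/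
  (exists sg, (sg = 1 \/ sg = -1) /\ x ^ 2 - energy k v = 0 /\ 0 < v * sg).
Proof.
  intros Hk Hp Hx Hv Hne.
  destruct (Rtotal_order (x ^ 2 - energy k v) 0) as [H|[H|H]].
  - right; left.
    assert (Hv0 : v <> 0). { intros ->. rewrite energy_0 in H. nra. }
    assert (Hpos : forall k v, (forall t, continuous k t) -> (forall t, 0 < k t) ->
      0 < v < 1 -> x ^ 2 - energy k v < 0 ->
      exists nu0, 0 < nu0 < 1 /\ x ^ 2 - energy k v = - energy k nu0).
    { clear. intros k v Hk Hp Hv H.
      destruct (intermediate_value (fun _ => True) (energy k) 0 v (energy k v - x ^ 2))
        as (nu0 & H0 & E); auto.
      - exact convex_True.
      - apply continuous_on_forall. intros u _. apply energy_continuous; auto.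
      - lra.
      - rewrite energy_0. nra.
      - exists nu0. split; [| lra].
        destruct (Req_dec nu0 0) as [->|]; [rewrite energy_0 in E; lra | lra]. }
    destruct (Rlt_or_le 0 v) as [Hv1|Hv1].
    + destruct (Hpos k v Hk Hp) as (nu0 & H0 & E); try lra.
      exists nu0. repeat split; try lra. nra.
    + destruct (Hpos (fun t => k (- t)) (- v)) as (nu0 & H0 & E);
        auto using continuous_reflect; try lra.
      { now rewrite energy_opp. }
      exists (- nu0). rewrite energy_opp in E by auto.
      rewrite <- (energy_opp k (- nu0)), Ropp_involutive by auto.
      repeat split; [lra | lra | lra | exact E | nra].
  - right; right.
    assert (Hv0 : v <> 0). { intros ->. rewrite energy_0 in H. destruct Hne; [nra | lra]. }
    destruct (Rlt_or_le 0 v) as [Hv1|Hv1].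
    + exists 1. split; [now left | lra].
    + exists (-1). split; [now right | lra].
  - left. exists (sqrt (x ^ 2 - energy k v)). split. now apply sqrt_lt_R0.
    rewrite pow2_sqrt; lra.
Qed.

(** * Orbits and rotational surfaces *)

Definition kext (K : R -> R) (t : R) : R := - K (clamp (-1) 1 t).

Lemma kext_eq (K : R -> R) (t : R) : -1 <= t <= 1 -> kext K t = - K t.
Proof. intros H. unfold kext. now rewrite clamp_id. Qed.

Lemma kext_continuous (K : R -> R) :
  C1_on (fun t => -1 <= t <= 1) K -> forall t, continuous (kext K) t.
Proof.
  intros (dK & H & _) t. apply (continuous_Ropp (fun t => K (clamp (-1) 1 t))).
  apply continuous_clamped with (fun t => -1 <= t <= 1); auto. lra.
  intros s Hs. exact (continuous_within_of_deriv_within _ _ _ _ (H s Hs)).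
Qed.

Lemma kext_pos (K : R -> R) :
  (forall t, -1 <= t <= 1 -> K t < 0) -> forall t, 0 < kext K t.
Proof.
  intros H t. unfold kext. specialize (H (clamp (-1) 1 t)).
  pose proof (clamp_in (-1) 1 t). lra.
Qed.

Lemma cos_bound_strict (t : R) : 0 < t < PI -> -1 < cos t < 1.
Proof.
  intros Ht. pose proof (sin_gt_0 t ltac:(lra) ltac:(lra)) as Hs.
  pose proof (sin2_cos2 t) as H. unfold Rsqr in H. nra.
Qed.

(** The derivative of [cos th] is [- sin th] times [x K / sin th]: the singular factor cancels, and
    the equation for [v] makes sense at the rims too. *)
Lemma phase_curve_of_solution (K : R -> R) (I : R -> Prop) (x th : R -> R) :
  phase_solution K I x th -> phase_curve (kext K) I x (fun s => cos (th s)).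
Proof.
  intros [[cI _] H].
  assert (cth : continuous_on I th).
  { intros s Hs. destruct (H s Hs) as (_ & _ & _ & d).
    exact (continuous_within_of_deriv_within _ _ _ _ d). }
  constructor.
  - exact cI.
  - intros s Hs. destruct (H s Hs) as (_ & _ & d & _).
    exact (continuous_within_of_deriv_within _ _ _ _ d).
  - apply continuous_on_comp; auto. intros s _. apply continuous_cos.
  - intros s Hs. destruct (H s Hs) as (H1 & H2 & _). split; auto. now apply cos_bound_strict.
  - intros s Hs. destruct (H s (locally_singleton _ _ Hs)) as (H1 & H2 & d1 & d2).
    apply (is_derive_of_deriv_within I) in d1, d2; auto. split; auto.
    evar_last. apply (is_derive_comp cos th); [apply is_derive_cos | exact d2].
    pose proof (sin_gt_0 (th s) ltac:(lra) ltac:(lra)).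
    rewrite kext_eq by apply COS_bound.
    change (x s * K (cos (th s)) / sin (th s) * - sin (th s) = x s * - K (cos (th s))).
    field. lra.
Qed.

Lemma is_derive_acos (v : R) : -1 < v < 1 -> is_derive acos v (- / sqrt (1 - v ^ 2)).
Proof.
  intros Hv. apply is_derive_Reals.
  replace (- / sqrt (1 - v ^ 2)) with (derive_pt acos v (derivable_pt_acos v Hv)).
  - apply derive_pt_eq_1 with (derivable_pt_acos v Hv). reflexivity.
  - rewrite derive_pt_acos. unfold Rsqr. replace (v * v) with (v ^ 2) by ring.
    unfold Rdiv. ring.
Qed.

Lemma phase_solution_of_flow (K : R -> R) (J : R -> Prop) (X V : R -> R) :
  flow (kext K) J X V -> interval (admissible J X V) ->
  phase_solution K (admissible J X V) X (fun s => acos (V s)).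
Proof.
  intros (_ & _ & Hd) HI. split; auto. intros s (Hs & Hx & Hv).
  destruct (Hd s Hs) as [dx dv].
  rewrite cos_acos by lra. split; [auto |]. split; [now apply acos_bound_lt |].
  split; apply deriv_within_of_is_derive; auto.
  evar_last. apply (is_derive_comp acos V); [apply is_derive_acos, Hv | exact dv].
  rewrite sin_acos, kext_eq by lra. unfold Rsqr. replace (V s * V s) with (V s ^ 2) by ring.
  change (X s * - K (V s) * - / sqrt (1 - V s ^ 2) = X s * K (V s) / sqrt (1 - V s ^ 2)).
  unfold Rdiv. ring.
Qed.

Lemma is_derive_shift (f : R -> R) (c s l : R) :
  is_derive f (s - c) l -> is_derive (fun t => f (t - c)) s l.
Proof.
  intros H. assert (d : is_derive (fun t : R => t - c) s 1) by (auto_derive; auto; ring).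
  evar_last. apply (is_derive_comp f (fun t => t - c) s l 1 H d).
  unfold scal; simpl; unfold mult; simpl. ring.
Qed.

Lemma flow_shift (k : R -> R) (J : R -> Prop) (X V : R -> R) (c : R) :
  flow k J X V ->
  flow k (fun s => J (s - c)) (fun s => X (s - c)) (fun s => V (s - c)).
Proof.
  intros (oJ & cJ & Hd). split; [| split].
  - apply (open_comp (fun s => s - c) J); auto. intros s _.
    apply (continuous_of_ex_derive (fun s => s - c)). auto_derive; auto.
  - intros s t u Hs Ht Hu. apply (cJ (s - c) (t - c)); auto. lra.
  - intros s Hs. destruct (Hd _ Hs). split; now apply is_derive_shift.
Qed.

Lemma continuous_flow_V (k : R -> R) (J : R -> Prop) (X V : R -> R) (s : R) :
  flow k J X V -> J s -> continuous V s.
Proof.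
  intros (_ & _ & H) Hs. exact (continuous_of_is_derive _ _ _ (proj2 (H s Hs))).
Qed.

Lemma continuous_flow_X (k : R -> R) (J : R -> Prop) (X V : R -> R) (s : R) :
  flow k J X V -> J s -> continuous X s.
Proof.
  intros (_ & _ & H) Hs. exact (continuous_of_is_derive _ _ _ (proj1 (H s Hs))).
Qed.

(** Where [|V| > 1] the radicand is negative and [sqrt] returns 0. The integrand remains continuous,
    so the height is prolonged, as a constant there, to all of [J]. *)
Lemma height_exists (k : R -> R) (J : R -> Prop) (X V : R -> R) (s0 : R) :
  flow k J X V -> J s0 ->
  exists Z, forall s, J s -> is_derive Z s (sqrt (1 - V s ^ 2)).
Proof.
  intros Hfl Hs0. pose proof Hfl as (oJ & cJ & Hd).
  assert (Hc : forall s, J s -> continuous (fun s => sqrt (1 - V s ^ 2)) s).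
  { intros s Hs. apply continuous_sqrt_comp.
    apply (continuous_comp V (fun v => 1 - v ^ 2)). now apply continuous_flow_V with k J X.
    apply (continuous_of_ex_derive (fun v => 1 - v ^ 2)). auto_derive; auto. }
  exists (RInt (fun s => sqrt (1 - V s ^ 2)) s0). intros s Hs.
  apply (is_derive_RInt (fun s => sqrt (1 - V s ^ 2)) _ s0 s); auto.
  generalize (oJ s Hs). apply filter_imp. intros t Ht.
  apply (RInt_correct (fun s => sqrt (1 - V s ^ 2))), ex_RInt_continuous.
  intros z Hz. apply Hc. unfold Rmin, Rmax in Hz.
  destruct (Rle_dec s0 t); [apply (cJ s0 t) | apply (cJ t s0)]; auto.
Qed.

Lemma sin_of_cos (t : R) : 0 < t < PI -> sin t = sqrt (1 - cos t ^ 2).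
Proof.
  intros Ht. pose proof (sin_gt_0 t ltac:(lra) ltac:(lra)) as Hs.
  pose proof (sin2_cos2 t) as H. unfold Rsqr in H.
  replace (1 - cos t ^ 2) with (sin t ^ 2) by (simpl; lra). rewrite sqrt_pow2; lra.
Qed.

(* [J] is larger than [dom g]: it contains the parameters of the boundary circumferences,
   where [V = -1, 1]. *)
Record represented (K : R -> R) (g : profile) (J : R -> Prop) (X V Z : R -> R) : Prop := {
  rep_flow : flow (kext K) J X V;
  rep_axis : forall s, J s -> X s = 0 -> V s <> 0;
  rep_dom : forall s, dom g s <-> admissible J X V s;
  rep_eq : forall s, dom g s ->
    xc g s = X s /\ cos (th g s) = V s /\ zc g s = Z s /\ 0 < th g s < PI;
  rep_height : forall s, J s -> is_derive Z s (sqrt (1 - V s ^ 2))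
}.

Arguments rep_flow {K g J X V Z}.
Arguments rep_axis {K g J X V Z}.
Arguments rep_dom {K g J X V Z}.
Arguments rep_eq {K g J X V Z}.
Arguments rep_height {K g J X V Z}.

(** On [dom g] both [zc g] and the integral over [J] are primitives of [sin th]; their constant
    difference is absorbed into [Z]. *)
Lemma height_extension (K : R -> R) (g : profile) (J : R -> Prop) (X V : R -> R) :
  rotational_K_surface K g -> flow (kext K) J X V -> (forall s, dom g s -> J s) ->
  (forall s, dom g s -> cos (th g s) = V s) ->
  exists Z, (forall s, J s -> is_derive Z s (sqrt (1 - V s ^ 2))) /\
    forall s, dom g s -> zc g s = Z s.
Proof.
  intros (([[cD (s0 & t0 & Hs0 & _ & _)] Hsol] & _) & Hz & _) Hfl HJ HV.
  destruct (height_exists _ _ _ _ s0 Hfl (HJ s0 Hs0)) as [Z HZ].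
  exists (fun s => Z s + (zc g s0 - Z s0)). split.
  - intros s Hs. specialize (HZ s Hs). evar_last.
    apply (is_derive_plus Z (fun _ => zc g s0 - Z s0)); [exact HZ | apply is_derive_const].
    unfold plus, zero; simpl. ring.
  - intros s Hs.
    enough (zc g s + - Z s = zc g s0 + - Z s0) by lra.
    apply (constant_of_derive_zero (dom g) (fun s => zc g s + - Z s)); auto.
    + apply (continuous_on_plus (dom g) (zc g) (fun s => - Z s)).
      * intros u Hu. exact (continuous_within_of_deriv_within _ _ _ _ (Hz u Hu)).
      * apply continuous_on_forall. intros u Hu. apply continuous_Ropp.
        exact (continuous_of_is_derive _ _ _ (HZ u (HJ u Hu))).
    + intros u Hu. pose proof (locally_singleton _ _ Hu) as Hu'. evar_last.
      * apply (is_derive_plus (zc g) (fun s => - Z s)).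
        -- exact (is_derive_of_deriv_within _ _ _ _ Hu (Hz u Hu')).
        -- apply (is_derive_opp Z). exact (HZ u (HJ u Hu')).
      * destruct (Hsol u Hu') as (_ & Hth & _).
        rewrite (sin_of_cos _ Hth), HV by auto. unfold plus, opp; simpl. ring.
Qed.

Lemma canonical_interval (k : R -> R) (J : R -> Prop) (X V : R -> R) (Q : R -> R -> Prop) (c : R) :
  canonical k J X V Q ->
  interval (admissible (fun s => J (s - c)) (fun s => X (s - c)) (fun s => V (s - c))).
Proof.
  intros Hcan. split.
  - intros s t u Hs Ht Hu. apply (can_convex Hcan (s - c) (t - c)); auto. lra.
  - destruct (can_nontrivial Hcan) as (s & t & Hs & Ht & Hst).
    exists (s + c), (t + c). unfold admissible in *.
    replace (s + c - c) with s by ring. replace (t + c - c) with t by ring.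
    repeat split; try tauto. lra.
Qed.

(** Existence: the admissible part of a canonical curve, with [th = acos V], is an orbit. It is not
    the excluded constant solution because of [can_axis]. *)
Lemma canonical_surface (K : R -> R) (J : R -> Prop) (X V : R -> R) (Q : R -> R -> Prop) :
  canonical (kext K) J X V Q ->
  exists g, rotational_K_surface K g /\ dom g = admissible J X V /\ xc g = X /\
    forall s, dom g s -> cos (th g s) = V s.
Proof.
  intros Hcan. destruct (can_nontrivial Hcan) as (s0 & t0 & Hs0 & Ht0 & Hst).
  pose proof (can_flow Hcan) as Hfl.
  destruct (height_exists _ _ _ _ s0 Hfl (proj1 Hs0)) as [Z HZ].
  assert (Hps : phase_solution K (admissible J X V) X (fun s => acos (V s))).
  { apply phase_solution_of_flow; auto. split; [exact (can_convex Hcan) |].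
    now exists s0, t0. }
  exists (Profile (admissible J X V) X Z (fun s => acos (V s))). simpl.
  split; [| split; [| split]]; auto.
  2: { intros s (_ & _ & Hv). apply cos_acos. lra. }
  split; [split |]; simpl; auto.
  (* Maximality: an extension has a point satisfying [Q], so it is a time shift of [(X, V)] within
     the admissible part. The shift is 0, because [(X, V)] takes no value twice. *)
  - intros J' y ph Hps' Hext s Hs.
    destruct (can_universal Hcan J' y (fun s => cos (ph s)) s0) as [c Hc].
    + now apply phase_curve_of_solution.
    + now apply Hext.
    + destruct (Hext s0 Hs0) as (_ & -> & ->). rewrite cos_acos by (destruct Hs0; lra).
      now apply (can_invariant Hcan).
    + destruct (Hc s0) as (H1 & H2 & H3). now apply Hext.
      destruct (Hext s0 Hs0) as (_ & E1 & E2). rewrite E1 in H2. rewrite E2 in H3.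
      rewrite cos_acos in H3 by (destruct Hs0; lra).
      assert (E : s0 = s0 - c) by (apply (can_inj Hcan); auto; [apply Hs0 | apply H1]).
      destruct (Hc s Hs) as (H & _). now replace (s - c) with s in H by lra.
  - split.
    + intros s Hs. apply deriv_within_of_is_derive.
      rewrite sin_acos by (destruct Hs; lra). unfold Rsqr.
      replace (V s * V s) with (V s ^ 2) by ring. apply HZ, Hs.
    + intros H. destruct (H s0 Hs0) as [H1 H2].
      apply (can_axis Hcan s0); auto. apply Hs0.
      rewrite <- (cos_acos (V s0)), H2 by (destruct Hs0; lra). apply cos_PI2.
Qed.

(** Universality puts [dom g] inside the shifted admissible set. Conversely, the shifted canonical
    curve is itself a solution extending [g], so the maximality of [g] gives the other inclusion. *)
Lemma surface_of_canonical (K : R -> R) (J : R -> Prop) (X V : R -> R) (Q : R -> R -> Prop)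
    (g : profile) (s0 : R) :
  canonical (kext K) J X V Q -> rotational_K_surface K g -> dom g s0 ->
  Q (xc g s0) (cos (th g s0)) ->
  exists c Z, represented K g (fun s => J (s - c)) (fun s => X (s - c)) (fun s => V (s - c)) Z.
Proof.
  intros Hcan Hg Hs0 HQ. pose proof Hg as [[Hsol Hmax] _].
  pose proof (can_flow Hcan) as Hfl.
  destruct (can_universal Hcan _ _ _ s0 (phase_curve_of_solution K _ _ _ Hsol) Hs0 HQ)
    as [c Hc].
  pose proof (flow_shift _ _ _ _ c Hfl) as Hfl'.
  assert (Hdom : forall s, dom g s <->
    admissible (fun s => J (s - c)) (fun s => X (s - c)) (fun s => V (s - c)) s).
  { intros s. split. { intros Hs. now apply Hc. }
    revert s. apply (Hmax _ (fun s => X (s - c)) (fun s => acos (V (s - c)))).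
    - apply phase_solution_of_flow; auto. now apply canonical_interval with (kext K) Q.
    - intros s Hs. destruct (Hc s Hs) as (H1 & H2 & H3). split; auto. split; auto.
      rewrite <- H3. apply acos_cos. destruct (proj2 Hsol s Hs) as (_ & H & _). lra. }
  destruct (height_extension K g _ _ _ Hg Hfl') as (Z & HZ & HZ').
  { intros s Hs%Hdom. apply Hs. }
  { intros s Hs. now apply Hc. }
  exists c, Z. constructor; auto.
  - intros s Hs. now apply (can_axis Hcan).
  - intros s Hs. destruct (Hc s Hs) as (_ & H2 & H3). repeat split; auto;
      destruct (proj2 Hsol s Hs) as (_ & H & _); apply H.
Qed.

(** * Time shifts of the three shapes *)

Lemma waist_shape_shift (J : R -> Prop) (X V : R -> R) (D D' : R -> Prop) (x0 c : R) :
  (forall s, D' s <-> D (s - c)) -> waist_shape J X V D x0 ->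
  waist_shape (fun s => J (s - c)) (fun s => X (s - c)) (fun s => V (s - c)) D' x0.
Proof.
  intros HD (a & m & b & Ham & Ja & Jb & Va & Vb & Xm & Hx0 & HDs & HX).
  exists (a + c), (m + c), (b + c).
  assert (E : forall t, t + c - c = t) by (intros; ring). rewrite !E.
  split; [lra |]. do 6 (split; auto). split.
  - intros s. rewrite HD, HDs. lra.
  - intros s Hs Hne. apply HX; auto. lra.
Qed.

Lemma axis_shape_shift (J : R -> Prop) (X V : R -> R) (D D' : R -> Prop) (nu0 c : R) :
  (forall s, D' s <-> D (s - c)) -> axis_shape J X V D nu0 ->
  axis_shape (fun s => J (s - c)) (fun s => X (s - c)) (fun s => V (s - c)) D' nu0.
Proof.
  intros HD (sg & a & b & S & Hsg & Hab & Ja & Jb & Xa & Va & Vb & Xb & HDs & HS & HX).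
  exists sg, (a + c), (b + c), (fun x => S x + c).
  assert (E : forall t, t + c - c = t) by (intros; ring). rewrite !E.
  split; auto. split; [lra |]. do 6 (split; auto). split; [| split].
  - intros s. rewrite HD, HDs. replace (s - c - a) with (s - (a + c)) by ring.
    replace (b - (s - c)) with (b + c - s) by ring. reflexivity.
  - intros s Hs%HD. destruct (HS _ Hs). split; auto. lra.
  - intros x Hx. destruct (HX x Hx) as (H1 & H2 & H3). rewrite HD, E.
    do 2 (split; auto). apply (continuous_plus S (fun _ => c)); auto. apply continuous_const.
Qed.

Lemma asymptotic_shape_shift (J : R -> Prop) (X V : R -> R) (D D' : R -> Prop) (sg c : R) :
  (forall s, D' s <-> D (s - c)) -> asymptotic_shape J X V D sg ->
  asymptotic_shape (fun s => J (s - c)) (fun s => X (s - c)) (fun s => V (s - c)) D' sg.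
Proof.
  intros HD (b & Jb & Vb & HDs & HJ & HX & Hlim & d & t & Hd & Ht).
  assert (E : forall t, t + c - c = t) by (intros; ring).
  assert (E' : forall t s, t - (s - c) = t + c - s) by (intros; ring).
  exists (b + c). rewrite !E. do 2 (split; auto).
  split; [| split; [| split; [| split]]].
  - intros s. rewrite HD, HDs, E'. reflexivity.
  - intros s Hs. apply HJ. now rewrite E'.
  - auto.
  - intros e He. destruct (Hlim e He) as [u Hu]. exists (u + c). intros s Hs. apply Hu.
    now rewrite E'.
  - exists d, (t + c). split; auto. intros s Hs. apply Ht. now rewrite E'.
Qed.

(** * Functions of class C^k *)

Section Ck.

Context {V : NormedModule R_AbsRing}.

Implicit Types (U : V -> Prop) (f g : V -> R).

Lemma line_continuous (p v : V) (t : R) : continuous (fun t : R => plus p (scal t v)) t.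
Proof.
  apply (continuous_plus (fun _ => p) (fun t : R => scal t v)).
  apply continuous_const.
  apply (continuous_scal (fun t : R => t) (fun _ => v)). apply continuous_id.
  apply continuous_const.
Qed.

Lemma line_0 (p v : V) : plus p (scal (0 : R) v) = p.
Proof.
  replace (scal (0 : R) v) with (@zero V). apply plus_zero_r.
  symmetry. exact (scal_zero_l v).
Qed.

Lemma locally_line U (p v : V) :
  open U -> U p -> locally 0 (fun t : R => U (plus p (scal t v))).
Proof.
  intros oU Hp. apply (line_continuous p v 0). rewrite line_0. now apply oU.
Qed.

Lemma dder_ext U f g (v p : V) :
  open U -> U p -> (forall q, U q -> f q = g q) -> dder v f p = dder v g p.
Proof.
  intros oU Hp H. apply Derive_ext_loc.
  generalize (locally_line U p v oU Hp). apply filter_imp. auto.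
Qed.

Lemma dder_unique f (v p : V) (l : R) :
  is_derive (fun t : R => f (plus p (scal t v))) 0 l -> dder v f p = l.
Proof. apply is_derive_unique. Qed.

Lemma dder_correct f (v p : V) :
  ex_derive (fun t : R => f (plus p (scal t v))) 0 ->
  is_derive (fun t : R => f (plus p (scal t v))) 0 (dder v f p).
Proof. apply Derive_correct. Qed.

Lemma Ck_ext (k : nat) U f g :
  open U -> (forall p, U p -> f p = g p) -> Ck k U f -> Ck k U g.
Proof.
  intros oU. revert f g. induction k as [|k IH]; intros f g E [Hc Hd].
  all: split; [intros p Hp; apply (continuous_ext_loc _ f); [| now apply Hc];
    generalize (oU p Hp); apply filter_imp; exact E |].
  exact I.
  intros v. destruct (Hd v) as [H1 H2]. split.
  - intros p Hp. specialize (H1 p Hp). revert H1. apply ex_derive_ext_loc.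
    generalize (locally_line U p v oU Hp). apply filter_imp. auto.
  - revert H2. apply IH. intros p Hp. now apply dder_ext with U.
Qed.

Lemma Ck_weaken (k : nat) U f : Ck (S k) U f -> Ck k U f.
Proof.
  revert f. induction k as [|k IH]; intros f [Hc Hd]; split; auto.
  intros v. destruct (Hd v) as [H1 H2]. split; auto.
Qed.

Lemma Ck_const (k : nat) U (c : R) : open U -> Ck k U (fun _ => c).
Proof.
  intros oU. revert c. induction k as [|k IH]; intros c.
  all: split; [intros p _; apply continuous_const |].
  exact I.
  intros v. split. intros p _. apply ex_derive_const.
  apply Ck_ext with (fun _ => 0); auto.
  intros p _. symmetry. exact (Derive_const c 0).
Qed.

Lemma Ck_linear (k : nat) U f :
  open U -> (forall p, continuous f p) ->
  (forall p v (t : R), f (plus p (scal t v)) = f p + t * f v) -> Ck k U f.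
Proof.
  intros oU Hc Hf.
  assert (Hd : forall p v, is_derive (fun t : R => f (plus p (scal t v))) 0 (f v)).
  { intros p v. apply is_derive_ext with (fun t : R => f p + t * f v).
    intros t. now rewrite Hf. auto_derive; auto. ring. }
  destruct k as [|k]; split; auto.
  intros v. split. intros p _. now exists (f v).
  apply Ck_ext with (fun _ => f v); auto using Ck_const.
  intros p _. symmetry. now apply dder_unique.
Qed.

Lemma dder_plus f g (v p : V) :
  ex_derive (fun t : R => f (plus p (scal t v))) 0 ->
  ex_derive (fun t : R => g (plus p (scal t v))) 0 ->
  dder v (fun p => f p + g p) p = dder v f p + dder v g p.
Proof.
  exact (Derive_plus (fun t : R => f (plus p (scal t v)))
    (fun t : R => g (plus p (scal t v))) 0).
Qed.

Lemma Ck_plus (k : nat) U f g :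
  open U -> Ck k U f -> Ck k U g -> Ck k U (fun p => f p + g p).
Proof.
  intros oU. revert f g. induction k as [|k IH]; intros f g [cf df] [cg dg].
  all: split; [intros p Hp; apply (continuous_plus f g); auto |].
  exact I.
  intros v. destruct (df v) as [f1 f2]. destruct (dg v) as [g1 g2]. split.
  - intros p Hp. apply (ex_derive_plus (fun t : R => f (plus p (scal t v)))
      (fun t : R => g (plus p (scal t v)))); auto.
  - apply Ck_ext with (fun p => dder v f p + dder v g p); auto.
    intros p Hp. symmetry. apply dder_plus; auto.
Qed.

Lemma dder_mult f g (v p : V) :
  ex_derive (fun t : R => f (plus p (scal t v))) 0 ->
  ex_derive (fun t : R => g (plus p (scal t v))) 0 ->
  dder v (fun p => f p * g p) p = dder v f p * g p + f p * dder v g p.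
Proof.
  intros Hf Hg. unfold dder.
  rewrite (Derive_mult (fun t : R => f (plus p (scal t v)))
    (fun t : R => g (plus p (scal t v)))) by auto.
  now rewrite !line_0.
Qed.

Lemma Ck_mult (k : nat) U f g :
  open U -> Ck k U f -> Ck k U g -> Ck k U (fun p => f p * g p).
Proof.
  intros oU. revert f g. induction k as [|k IH]; intros f g Hf Hg.
  all: pose proof Hf as [cf df]; pose proof Hg as [cg dg].
  all: split; [intros p Hp; apply (continuous_mult f g); auto |].
  exact I.
  intros v. destruct (df v) as [f1 f2]. destruct (dg v) as [g1 g2]. split.
  - intros p Hp. apply (ex_derive_mult (fun t : R => f (plus p (scal t v)))
      (fun t : R => g (plus p (scal t v)))); auto.
  - apply Ck_ext with (fun p => dder v f p * g p + f p * dder v g p); auto.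
    + intros p Hp. symmetry. apply dder_mult; auto.
    + apply Ck_plus; auto; apply IH; auto; now apply Ck_weaken.
Qed.

End Ck.

(** The one-variable class of the outer functions in [Ck_comp]. Derivatives are given as witnesses,
    so that explicit formulas can be supplied for them. *)
Fixpoint Cn (k : nat) (D : R -> Prop) (phi : R -> R) : Prop :=
  (forall t, D t -> continuous phi t) /\
  match k with
  | O => True
  | S k' => exists dphi : R -> R,
      (forall t, D t -> is_derive phi t (dphi t)) /\ Cn k' D dphi
  end.

Lemma Cn_2 (D : R -> Prop) (f f1 f2 : R -> R) :
  (forall t, D t -> is_derive f t (f1 t)) -> (forall t, D t -> is_derive f1 t (f2 t)) ->
  (forall t, D t -> continuous f2 t) -> Cn 2 D f.
Proof.
  intros H1 H2 H3. split.
  { intros t Ht. exact (continuous_of_is_derive _ _ _ (H1 t Ht)). }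
  exists f1. split; auto. split.
  { intros t Ht. exact (continuous_of_is_derive _ _ _ (H2 t Ht)). }
  exists f2. split; auto. split; auto.
Qed.

Lemma Ck_comp {V : NormedModule R_AbsRing} (k : nat) (U : V -> Prop) (f : V -> R)
    (D : R -> Prop) (phi : R -> R) :
  open U -> (forall p, U p -> D (f p)) -> Ck k U f -> Cn k D phi ->
  Ck k U (fun p => phi (f p)).
Proof.
  intros oU HD. revert phi. induction k as [|k IH]; intros phi Hf Hphi.
  all: pose proof Hf as [cf df]; destruct Hphi as [cphi Hphi].
  all: split; [intros p Hp; apply (continuous_comp f phi); auto |].
  exact I.
  destruct Hphi as (dphi & d1 & d2). intros v. destruct (df v) as [f1 f2].
  assert (Hd : forall p, U p ->
    is_derive (fun t : R => phi (f (plus p (scal t v)))) 0 (dder v f p * dphi (f p))).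
  { intros p Hp. apply (is_derive_comp phi (fun t : R => f (plus p (scal t v)))).
    - rewrite line_0. auto.
    - apply dder_correct. auto. }
  split.
  - intros p Hp. eexists. now apply Hd.
  - apply Ck_ext with (fun p => dder v f p * dphi (f p)); auto.
    + intros p Hp. symmetry. apply dder_unique. auto.
    + apply Ck_mult; auto. apply IH; auto. now apply Ck_weaken.
Qed.

(** The induction runs over all functions [c * (/ t) ^ (n + 1)], a family closed under
    differentiation. *)
Lemma Cn_inv (k : nat) : Cn k (fun t => t <> 0) Rinv.
Proof.
  assert (Hi : forall t, t <> 0 -> is_derive Rinv t (- (/ t) ^ 2)).
  { intros t Ht. apply (is_derive_ext (fun t => / t)); auto.
    auto_derive; auto. field. auto. }
  assert (H : forall k c (n : nat), Cn k (fun t => t <> 0) (fun t => c * (/ t) ^ S n)).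
  { clear k. intros k. induction k as [|k IH]; intros c n.
    all: assert (Hd : forall t, t <> 0 ->
      is_derive (fun t => c * (/ t) ^ S n) t (- (c * INR (S n)) * (/ t) ^ S (S n))) by
      (intros t Ht; evar_last;
       [apply is_derive_scal, (is_derive_pow Rinv (S n) t (- (/ t) ^ 2)), Hi, Ht |
        unfold pred; rewrite <- !tech_pow_Rmult; ring]).
    all: split; [intros t Ht; exact (continuous_of_is_derive _ _ _ (Hd t Ht)) |].
    exact I.
    exists (fun t => - (c * INR (S n)) * (/ t) ^ S (S n)). split; auto. }
  destruct k as [|k].
  - split; auto. intros t Ht. now apply continuous_Rinv.
  - split. intros t Ht. now apply continuous_Rinv.
    exists (fun t => -1 * (/ t) ^ 2). split; [| apply (H k (-1) 1%nat)].
    intros t Ht. replace (-1 * (/ t) ^ 2) with (- (/ t) ^ 2) by ring. auto.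
Qed.

Lemma Ck_fst (k : nat) (U : R2 -> Prop) : open U -> Ck k U (fun q => fst q).
Proof.
  intros oU. apply Ck_linear; auto. intros [a b]. apply continuous_fst.
Qed.

Lemma Ck_snd (k : nat) (U : R2 -> Prop) : open U -> Ck k U (fun q => snd q).
Proof.
  intros oU. apply Ck_linear; auto. intros [a b]. apply continuous_snd.
Qed.

Lemma continuous_c1 (p : R3) : continuous c1 p.
Proof.
  apply (continuous_comp fst fst); destruct p as [[a b] c].
  apply continuous_fst. apply continuous_fst.
Qed.

Lemma continuous_c2 (p : R3) : continuous c2 p.
Proof.
  apply (continuous_comp fst snd); destruct p as [[a b] c].
  apply continuous_fst. apply continuous_snd.
Qed.

Lemma continuous_c3 (p : R3) : continuous c3 p.
Proof. destruct p as [[a b] c]. apply continuous_snd. Qed.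

Lemma Ck_c1 (k : nat) (U : R3 -> Prop) : open U -> Ck k U c1.
Proof.
  intros oU. apply Ck_linear; auto using continuous_c1.
Qed.

Lemma Ck_c2 (k : nat) (U : R3 -> Prop) : open U -> Ck k U c2.
Proof.
  intros oU. apply Ck_linear; auto using continuous_c2.
Qed.

Lemma Ck_c3 (k : nat) (U : R3 -> Prop) : open U -> Ck k U c3.
Proof.
  intros oU. apply Ck_linear; auto using continuous_c3.
Qed.

(* The revolution surface [c1^2 + c2^2 = xi(c3)^2] over an interval of heights. *)
Lemma diffeomorphic_cylinder (A : R3 -> Prop) (H : R -> Prop) (xi la mu : R -> R) :
  open H -> Cn 2 H xi -> (forall z, H z -> 0 < xi z) ->
  (forall p, A p <-> H (c3 p) /\ c1 p ^ 2 + c2 p ^ 2 = xi (c3 p) ^ 2) ->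
  Cn 2 H la -> Cn 2 (fun t => 0 < t < 1) mu ->
  (forall z, H z -> 0 < la z < 1 /\ mu (la z) = z) ->
  (forall t, 0 < t < 1 -> H (mu t) /\ la (mu t) = t) ->
  diffeomorphic A open_cylinder.
Proof.
  intros oH Cxi xpos HA Cla Cmu Hla Hmu.
  exists (fun p => (c1 p * / xi (c3 p), c2 p * / xi (c3 p), la (c3 p))).
  exists (fun q => (c1 q * xi (mu (c3 q)), c2 q * xi (mu (c3 q)), mu (c3 q))).
  exists (fun p => H (c3 p)), (fun q => 0 < c3 q < 1).
  assert (oU : open (fun p : R3 => H (c3 p))).
  { apply (open_comp c3 H); auto. intros p _. apply continuous_c3. }
  assert (oV : open (fun q : R3 => 0 < c3 q < 1)).
  { apply (open_comp c3 (fun t => 0 < t < 1)). intros p _. apply continuous_c3.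
    apply (open_and (fun t => 0 < t) (fun t => t < 1)). apply open_gt. apply open_lt. }
  assert (Cinv : Ck 2 (fun p : R3 => H (c3 p)) (fun p => / xi (c3 p))).
  { apply Ck_comp with (fun t => t <> 0); auto using Cn_inv.
    - intros p Hp. specialize (xpos _ Hp). lra.
    - apply Ck_comp with H; auto using Ck_c3. }
  assert (Cm : Ck 2 (fun q : R3 => 0 < c3 q < 1) (fun q => mu (c3 q))).
  { apply Ck_comp with (fun t => 0 < t < 1); auto using Ck_c3. }
  assert (Cxm : Ck 2 (fun q : R3 => 0 < c3 q < 1) (fun q => xi (mu (c3 q)))).
  { apply Ck_comp with H; auto. intros p Hp. now apply Hmu. }
  do 2 (split; auto). split. { intros p Hp. now apply HA. }
  split. { intros q Hq. apply Hq. }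
  split.
  { split; [| split]; simpl.
    - apply (Ck_mult 2 _ c1 (fun p => / xi (c3 p))); auto using Ck_c1.
    - apply (Ck_mult 2 _ c2 (fun p => / xi (c3 p))); auto using Ck_c2.
    - apply (Ck_comp 2 _ c3 H la); auto using Ck_c3. }
  split.
  { split; [| split]; simpl; auto.
    - apply (Ck_mult 2 _ c1 (fun q => xi (mu (c3 q)))); auto using Ck_c1.
    - apply (Ck_mult 2 _ c2 (fun q => xi (mu (c3 q)))); auto using Ck_c2. }
  split.
  - intros [[a b] c] [Hc E]%HA. unfold open_cylinder, c1, c2, c3 in *. simpl in *.
    specialize (xpos c Hc). destruct (Hla c Hc) as [H1 H2]. rewrite H2. split; [split; auto |].
    + replace (a * / xi c * (a * / xi c * 1) + b * / xi c * (b * / xi c * 1))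
        with ((a * (a * 1) + b * (b * 1)) / (xi c * xi c)) by (field; lra).
      rewrite E. field. lra.
    + do 2 f_equal; field; lra.
  - intros [[a b] c] [E Hc]. unfold c1, c2, c3 in *. simpl in *.
    destruct (Hmu c Hc) as [H1 H2]. specialize (xpos _ H1). rewrite H2. split.
    + apply HA. unfold c1, c2, c3. simpl. split; auto.
      replace (a * xi (mu c) * (a * xi (mu c) * 1) + b * xi (mu c) * (b * xi (mu c) * 1))
        with ((a * (a * 1) + b * (b * 1)) * (xi (mu c) * (xi (mu c) * 1))) by ring.
      rewrite E. ring.
    + do 2 f_equal; field; lra.
Qed.

(** * Curvature of rotational surfaces *)

(** Each coordinate of a rotational parametrization and of its first derivatives is a function of
    the profile parameter times a function of the angle, so this rule yields all derivatives up to
    order two. *)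
Lemma dder_product (A B : R -> R) (q : R2) (a b dA dB : R) :
  is_derive A (fst q) dA -> is_derive B (snd q) dB ->
  dder ((a, b) : R2) (fun w : R2 => A (fst w) * B (snd w)) q
  = a * dA * B (snd q) + A (fst q) * (b * dB).
Proof.
  intros HA HB. destruct q as [s p]. simpl in *. apply dder_unique. simpl.
  assert (Hl : forall c y : R, is_derive (fun t : R => plus y (scal t c)) 0 c).
  { intros c y. apply (is_derive_ext (fun t : R => y + t * c)).
    - intros t. reflexivity.
    - auto_derive; auto. ring. }
  assert (H0 : forall c y : R, plus y (scal 0 c) = y).
  { intros c y. change (y + 0 * c = y). ring. }
  evar_last.
  - apply (is_derive_mult (fun t : R => A (plus s (scal t a))) (fun t : R => B (plus p (scal t b)))).
    + apply (is_derive_comp A (fun t : R => plus s (scal t a))); [| apply Hl].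
      rewrite H0. exact HA.
    + apply (is_derive_comp B (fun t : R => plus p (scal t b))); [| apply Hl].
      rewrite H0. exact HB.
    + intros; apply Rmult_comm.
  - cbv beta. rewrite !H0. reflexivity.
Qed.

Section Rotation.

Variables (K : R -> R) (g : profile).
Hypothesis k_cont : forall t, continuous (kext K) t.
Hypothesis regular : forall s, locally s (dom g) ->
  0 < xc g s /\ 0 < th g s < PI /\
  is_derive (xc g) s (cos (th g s)) /\
  is_derive (th g) s (xc g s * K (cos (th g s)) / sin (th g s)) /\
  is_derive (zc g) s (sin (th g s)).

Let D : R -> Prop := interior (dom g).

Let sin_pos (s : R) : D s -> 0 < sin (th g s).
Proof. intros Hs. destruct (regular s Hs) as (_ & H & _). apply sin_gt_0; lra. Qed.

Lemma is_derive_cos_th (s : R) : D s ->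
  is_derive (fun s => cos (th g s)) s (xc g s * kext K (cos (th g s))).
Proof.
  intros Hs. destruct (regular s Hs) as (H1 & H2 & d1 & d2 & _). evar_last.
  - apply (is_derive_comp cos (th g)); [apply is_derive_cos | exact d2].
  - specialize (sin_pos s Hs). rewrite kext_eq by apply COS_bound.
    change (xc g s * K (cos (th g s)) / sin (th g s) * - sin (th g s)
            = xc g s * - K (cos (th g s))). field. lra.
Qed.

Lemma is_derive_sin_th (s : R) : D s ->
  is_derive (fun s => sin (th g s)) s
    (cos (th g s) * (- (xc g s * kext K (cos (th g s))) / sin (th g s))).
Proof.
  intros Hs. destruct (regular s Hs) as (H1 & H2 & d1 & d2 & _). evar_last.
  - apply (is_derive_comp sin (th g)); [apply is_derive_sin | exact d2].
  - specialize (sin_pos s Hs). rewrite kext_eq by apply COS_bound.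
    change (xc g s * K (cos (th g s)) / sin (th g s) * cos (th g s)
            = cos (th g s) * (- (xc g s * - K (cos (th g s))) / sin (th g s))).
    field. lra.
Qed.

Lemma continuous_curvature_term (s : R) : D s ->
  continuous (fun s => xc g s * kext K (cos (th g s))) s.
Proof.
  intros Hs. apply (continuous_mult (xc g) (fun s => kext K (cos (th g s)))).
  - destruct (regular s Hs) as (_ & _ & d & _). exact (continuous_of_is_derive _ _ _ d).
  - apply (continuous_comp (fun s => cos (th g s)) (kext K)); auto.
    exact (continuous_of_is_derive _ _ _ (is_derive_cos_th s Hs)).
Qed.

Lemma Cn_xc : Cn 2 D (xc g).
Proof.
  apply Cn_2 with (fun s => cos (th g s)) (fun s => xc g s * kext K (cos (th g s))).
  - intros s Hs. now apply regular.
  - exact is_derive_cos_th.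
  - exact continuous_curvature_term.
Qed.

Lemma Cn_zc : Cn 2 D (zc g).
Proof.
  apply Cn_2 with (fun s => sin (th g s))
    (fun s => cos (th g s) * (- (xc g s * kext K (cos (th g s))) / sin (th g s))).
  - intros s Hs. now apply regular.
  - exact is_derive_sin_th.
  - intros s Hs.
    apply (continuous_mult (fun s => cos (th g s))
      (fun s => - (xc g s * kext K (cos (th g s))) / sin (th g s))).
    + exact (continuous_of_is_derive _ _ _ (is_derive_cos_th s Hs)).
    + apply (continuous_mult (fun s => - (xc g s * kext K (cos (th g s))))
        (fun s => / sin (th g s))).
      * apply continuous_Ropp, continuous_curvature_term, Hs.
      * apply continuous_Rinv_comp.
        -- exact (continuous_of_is_derive _ _ _ (is_derive_sin_th s Hs)).
        -- apply Rgt_not_eq, sin_pos, Hs.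
Qed.

Lemma Cn_trig (T : R -> Prop) : Cn 2 T cos /\ Cn 2 T sin.
Proof.
  assert (Hc : forall t, is_derive cos t (- sin t)) by (intros t; apply is_derive_cos).
  assert (Hs : forall t, is_derive sin t (cos t)) by (intros t; apply is_derive_sin).
  assert (Ho : forall f t l, is_derive f t l -> is_derive (fun t => - f t) t (- l)).
  { intros f t l H. exact (is_derive_opp f t l H). }
  split.
  - apply Cn_2 with (fun t => - sin t) (fun t => - cos t); auto.
    intros t _. exact (continuous_of_is_derive _ _ _ (Ho _ _ _ (Hc t))).
  - apply Cn_2 with cos (fun t => - sin t); auto.
    intros t _. exact (continuous_of_is_derive _ _ _ (Ho _ _ _ (Hs t))).
Qed.

Lemma open_rot_dom : open (rot_dom g).
Proof.
  apply (open_comp fst D). intros [a b] _. apply continuous_fst. apply open_interior.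
Qed.

Lemma Ck_rot_param : Ck3 2 (rot_dom g) (rot_param g).
Proof.
  pose proof open_rot_dom as oU.
  assert (Cx : Ck 2 (rot_dom g) (fun q => xc g (fst q))).
  { apply Ck_comp with D; auto using Ck_fst, Cn_xc. }
  assert (Ctrig : Ck 2 (rot_dom g) (fun q => cos (snd q)) /\ Ck 2 (rot_dom g) (fun q => sin (snd q))).
  { destruct (Cn_trig (fun _ => True)). split;
      apply Ck_comp with (fun _ => True); auto using Ck_snd. }
  destruct Ctrig. split; [| split]; unfold rot_param, c1, c2, c3; simpl.
  - apply (Ck_mult 2 _ (fun q : R2 => xc g (fst q)) (fun q => cos (snd q))); auto.
  - apply (Ck_mult 2 _ (fun q : R2 => xc g (fst q)) (fun q => sin (snd q))); auto.
  - apply (Ck_comp 2 (rot_dom g) (fun q : R2 => fst q) D (zc g)); auto using Ck_fst, Cn_zc.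
Qed.

Lemma dder_rot (v : R2) (F : R2 -> R) (A B : R -> R) (q : R2) (dA dB : R) :
  rot_dom g q -> (forall w, rot_dom g w -> F w = A (fst w) * B (snd w)) ->
  is_derive A (fst q) dA -> is_derive B (snd q) dB ->
  dder v F q = fst v * dA * B (snd q) + A (fst q) * (snd v * dB).
Proof.
  intros Hq HF HA HB. destruct v as [a b]. simpl.
  rewrite (dder_ext (rot_dom g) F (fun w => A (fst w) * B (snd w)));
    auto using open_rot_dom. now apply dder_product.
Qed.

Let dcos (t : R) : is_derive cos t (- sin t).
Proof. apply is_derive_cos. Qed.

Let dsin (t : R) : is_derive sin t (cos t).
Proof. apply is_derive_sin. Qed.

Let dconst (t : R) : is_derive (fun _ : R => 1) t 0.
Proof. exact (is_derive_const 1 t). Qed.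

Lemma du_rot (q : R2) : rot_dom g q ->
  du (rot_param g) q
  = (cos (th g (fst q)) * cos (snd q), cos (th g (fst q)) * sin (snd q), sin (th g (fst q))).
Proof.
  intros Hq. destruct (regular _ Hq) as (_ & _ & dx & _ & dz). unfold du, pder.
  rewrite (dder_rot (1, 0) (fun w => c1 (rot_param g w)) (xc g) cos q _ _ Hq
    (fun _ _ => eq_refl) dx (dcos _)).
  rewrite (dder_rot (1, 0) (fun w => c2 (rot_param g w)) (xc g) sin q _ _ Hq
    (fun _ _ => eq_refl) dx (dsin _)).
  rewrite (dder_rot (1, 0) (fun w => c3 (rot_param g w)) (zc g) (fun _ => 1) q _ _ Hq
    (fun w _ => eq_sym (Rmult_1_r _)) dz (dconst _)).
  simpl. f_equal; [f_equal |]; ring.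
Qed.

Lemma dv_rot (q : R2) : rot_dom g q ->
  dv (rot_param g) q
  = (- (xc g (fst q) * sin (snd q)), xc g (fst q) * cos (snd q), 0).
Proof.
  intros Hq. destruct (regular _ Hq) as (_ & _ & dx & _ & dz). unfold dv, pder.
  rewrite (dder_rot (0, 1) (fun w => c1 (rot_param g w)) (xc g) cos q _ _ Hq
    (fun _ _ => eq_refl) dx (dcos _)).
  rewrite (dder_rot (0, 1) (fun w => c2 (rot_param g w)) (xc g) sin q _ _ Hq
    (fun _ _ => eq_refl) dx (dsin _)).
  rewrite (dder_rot (0, 1) (fun w => c3 (rot_param g w)) (zc g) (fun _ => 1) q _ _ Hq
    (fun w _ => eq_sym (Rmult_1_r _)) dz (dconst _)).
  simpl. f_equal; [f_equal |]; ring.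
Qed.

Lemma gauss_map_rot (q : R2) : rot_dom g q ->
  cross (du (rot_param g) q) (dv (rot_param g) q) <> (0, 0, 0) /\
  gauss_map (rot_param g) q
  = (- (sin (th g (fst q)) * cos (snd q)), - (sin (th g (fst q)) * sin (snd q)),
     cos (th g (fst q))).
Proof.
  intros Hq. destruct (regular _ Hq) as (Hx & _). unfold gauss_map.
  rewrite du_rot, dv_rot by auto.
  set (x := xc g (fst q)) in *. set (t := th g (fst q)). set (p := snd q).
  assert (E : cross (cos t * cos p, cos t * sin p, sin t) (- (x * sin p), x * cos p, 0)
              = (- (x * sin t * cos p), - (x * sin t * sin p), x * cos t)).
  { unfold cross, c1, c2, c3. simpl. pose proof (sin2_cos2 p) as H. unfold Rsqr in H.
    f_equal; [f_equal; ring |].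
    replace (x * cos t) with (x * cos t * (sin p * sin p + cos p * cos p)) by (rewrite H; ring).
    ring. }
  rewrite E.
  pose proof (sin2_cos2 p) as Hp. pose proof (sin2_cos2 t) as Ht. unfold Rsqr in Hp, Ht.
  assert (En : dot (- (x * sin t * cos p), - (x * sin t * sin p), x * cos t)
                   (- (x * sin t * cos p), - (x * sin t * sin p), x * cos t) = x ^ 2).
  { unfold dot, c1, c2, c3. simpl.
    replace (x * (x * 1)) with (x * x * (sin t * sin t * (sin p * sin p + cos p * cos p) + cos t * cos t))
      by (rewrite Hp, Rmult_1_r, Ht; ring). ring. }
  rewrite En, sqrt_pow2 by lra. split.
  - intros Hz. injection Hz as H1 H2 H3.
    assert (Hc : cos t = 0) by nra.
    assert (Hs1 : sin t * cos p = 0) by nra. assert (Hs2 : sin t * sin p = 0) by nra.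
    assert (Hs : sin t * sin t = 0).
    { replace (sin t * sin t) with (sin t * sin p * (sin t * sin p) + sin t * cos p * (sin t * cos p)).
      - rewrite Hs1, Hs2. ring.
      - transitivity (sin t * sin t * (sin p * sin p + cos p * cos p)); [ring |].
        rewrite Hp. ring. }
    rewrite Hc, Hs in Ht. lra.
  - unfold c1, c2, c3. simpl. f_equal; [f_equal |]; field; lra.
Qed.

(** In the usual notation [E = 1], [F = M = 0], [G = x ^ 2], [L = th'] and [N = x sin th]. The
    curvature is thus [th' sin th / x], which the equation for [th'] turns into [K (cos th)]. *)
Lemma K_surface_rot :
  K_surface K (rot_dom g) (rot_param g) /\
  forall q, rot_dom g q -> angle_function (rot_param g) q = cos (th g (fst q)).
Proof.
  assert (Ha : forall q, rot_dom g q -> angle_function (rot_param g) q = cos (th g (fst q))).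
  { intros q Hq. unfold angle_function. destruct (gauss_map_rot q Hq) as [_ ->].
    unfold dot, e3, c1, c2, c3. simpl. ring. }
  split; auto. split.
  { split; [apply open_rot_dom |]. split; [apply Ck_rot_param |].
    intros q Hq. now apply gauss_map_rot. }
  intros q Hq. rewrite Ha by auto. unfold gauss_curvature.
  destruct (gauss_map_rot q Hq) as [_ ->]. rewrite du_rot, dv_rot by auto.
  pose proof (is_derive_cos_th _ Hq) as dct. pose proof (is_derive_sin_th _ Hq) as dst.
  pose proof (sin_pos _ Hq) as Hs.
  destruct (regular _ Hq) as (Hx & _ & dx & _ & dz).
  assert (Eduu : du (du (rot_param g)) q =
    (xc g (fst q) * kext K (cos (th g (fst q))) * cos (snd q),
     xc g (fst q) * kext K (cos (th g (fst q))) * sin (snd q),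
     cos (th g (fst q)) * (- (xc g (fst q) * kext K (cos (th g (fst q)))) / sin (th g (fst q))))).
  { unfold du at 1, pder.
    rewrite (dder_rot (1, 0) _ (fun s => cos (th g s)) cos q _ _ Hq) with (2 := dct) (3 := dcos _)
      by (intros w Hw; now rewrite du_rot).
    rewrite (dder_rot (1, 0) _ (fun s => cos (th g s)) sin q _ _ Hq) with (2 := dct) (3 := dsin _)
      by (intros w Hw; now rewrite du_rot).
    rewrite (dder_rot (1, 0) _ (fun s => sin (th g s)) (fun _ => 1) q _ _ Hq)
      with (2 := dst) (3 := dconst _)
      by (intros w Hw; rewrite du_rot, Rmult_1_r by auto; reflexivity).
    simpl. f_equal; [f_equal |]; ring. }
  assert (Eduv : dv (du (rot_param g)) q =
    (- (cos (th g (fst q)) * sin (snd q)), cos (th g (fst q)) * cos (snd q), 0)).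
  { unfold dv, pder.
    rewrite (dder_rot (0, 1) _ (fun s => cos (th g s)) cos q _ _ Hq) with (2 := dct) (3 := dcos _)
      by (intros w Hw; now rewrite du_rot).
    rewrite (dder_rot (0, 1) _ (fun s => cos (th g s)) sin q _ _ Hq) with (2 := dct) (3 := dsin _)
      by (intros w Hw; now rewrite du_rot).
    rewrite (dder_rot (0, 1) _ (fun s => sin (th g s)) (fun _ => 1) q _ _ Hq)
      with (2 := dst) (3 := dconst _)
      by (intros w Hw; rewrite du_rot, Rmult_1_r by auto; reflexivity).
    simpl. f_equal; [f_equal |]; ring. }
  assert (Edvv : dv (dv (rot_param g)) q =
    (- (xc g (fst q) * cos (snd q)), - (xc g (fst q) * sin (snd q)), 0)).
  { assert (d0 : is_derive (fun _ : R => 0) (fst q) 0) by exact (is_derive_const 0 (fst q)).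
    assert (dns : is_derive (fun t => - sin t) (snd q) (- cos (snd q)))
      by exact (is_derive_opp sin _ _ (dsin _)).
    unfold dv at 1, pder.
    rewrite (dder_rot (0, 1) _ (xc g) (fun t => - sin t) q _ _ Hq) with (2 := dx) (3 := dns)
      by (intros w Hw; rewrite dv_rot by auto; unfold c1; simpl; ring).
    rewrite (dder_rot (0, 1) _ (xc g) cos q _ _ Hq) with (2 := dx) (3 := dcos _)
      by (intros w Hw; now rewrite dv_rot).
    rewrite (dder_rot (0, 1) _ (fun _ => 0) (fun _ => 1) q _ _ Hq) with (2 := d0) (3 := dconst _)
      by (intros w Hw; rewrite dv_rot by auto; unfold c3; simpl; ring).
    simpl. f_equal; [f_equal |]; ring. }
  rewrite Eduu, Eduv, Edvv. rewrite kext_eq by apply COS_bound.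
  unfold dot, c1, c2, c3. simpl.
  set (x := xc g (fst q)) in *. set (t := th g (fst q)) in *. set (p := snd q).
  pose proof (sin2_cos2 p) as Hp. pose proof (sin2_cos2 t) as Ht. unfold Rsqr in Hp, Ht.
  set (ct := cos t) in *. set (st := sin t) in *. set (cp := cos p) in *. set (sp := sin p) in *.
  set (kk := K ct).
  assert (EL : x * - kk * cp * - (st * cp) + x * - kk * sp * - (st * sp)
               + ct * (- (x * - kk) / st) * ct = x * kk / st).
  { replace (x * - kk * cp * - (st * cp) + x * - kk * sp * - (st * sp)
               + ct * (- (x * - kk) / st) * ct)
      with (x * kk / st * (st * st * (sp * sp + cp * cp) + ct * ct)) by (field; lra).
    rewrite Hp, Rmult_1_r, Ht. ring. }
  assert (EN : - (x * cp) * - (st * cp) + - (x * sp) * - (st * sp) + 0 * ct = x * st).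
  { replace (- (x * cp) * - (st * cp) + - (x * sp) * - (st * sp) + 0 * ct)
      with (x * st * (sp * sp + cp * cp)) by ring. rewrite Hp. ring. }
  assert (EM : - (ct * sp) * - (st * cp) + ct * cp * - (st * sp) + 0 * ct = 0) by ring.
  assert (EE : ct * cp * (ct * cp) + ct * sp * (ct * sp) + st * st = 1).
  { replace (ct * cp * (ct * cp) + ct * sp * (ct * sp) + st * st)
      with (ct * ct * (sp * sp + cp * cp) + st * st) by ring. rewrite Hp. lra. }
  assert (EF : ct * cp * - (x * sp) + ct * sp * (x * cp) + st * 0 = 0) by ring.
  assert (EG : - (x * sp) * - (x * sp) + x * cp * (x * cp) + 0 * 0 = x * x).
  { replace (- (x * sp) * - (x * sp) + x * cp * (x * cp) + 0 * 0)
      with (x * x * (sp * sp + cp * cp)) by ring. rewrite Hp. ring. }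
  rewrite EL, EN, EM, EE, EF, EG. field. split; lra.
Qed.

End Rotation.

(** * Topology of rotational surfaces *)

Lemma filterlim_pair_locally {T : Type} {U V : UniformSpace} (F : (T -> Prop) -> Prop)
    (f : T -> U) (g : T -> V) (x : U) (y : V) :
  Filter F -> filterlim f F (locally x) -> filterlim g F (locally y) ->
  filterlim (fun t => (f t, g t)) F (locally ((x, y) : prod_UniformSpace U V)).
Proof.
  intros FF Hf Hg P [e He].
  specialize (Hf _ (locally_ball x e)). specialize (Hg _ (locally_ball y e)).
  unfold filtermap in *. generalize (filter_and _ _ Hf Hg). apply filter_imp.
  intros t [H1 H2]. apply He. split; auto.
Qed.

(** The angle is [acos (a / r)] or its opposite, according to the sign of [b]. *)
Lemma polar (a b r : R) : 0 <= r -> a ^ 2 + b ^ 2 = r ^ 2 ->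
  exists p, a = r * cos p /\ b = r * sin p.
Proof.
  intros [Hr | <-] E.
  - assert (Ha : -1 <= a / r <= 1).
    { assert (-r <= a <= r) by nra.
      split; [apply Rmult_le_reg_r with r | apply Rmult_le_reg_r with r]; auto;
        unfold Rdiv; rewrite Rmult_assoc, Rinv_l by lra; lra. }
    assert (Hs : r * sqrt (1 - (a / r)²) = Rabs b).
    { rewrite <- (sqrt_pow2 r) at 1 by lra. rewrite <- sqrt_mult_alt by nra.
      rewrite <- sqrt_Rsqr_abs. f_equal. unfold Rsqr.
      replace (r ^ 2 * (1 - a / r * (a / r))) with (r ^ 2 - a ^ 2) by (field; lra). lra. }
    destruct (Rle_or_lt 0 b) as [Hb|Hb].
    + exists (acos (a / r)). rewrite cos_acos, sin_acos, Hs, Rabs_pos_eq by auto.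
      split; auto. field. lra.
    + exists (- acos (a / r)). rewrite cos_neg, sin_neg, cos_acos, sin_acos by auto.
      rewrite Ropp_mult_distr_r_reverse, Hs, Rabs_left by auto. split; [field |]; lra.
  - exists 0. split; nra.
Qed.

Section Geometry.

Context {K : R -> R} {g : profile} {J : R -> Prop} {X V Z : R -> R}.
Hypothesis k_cont : forall t, continuous (kext K) t.
Hypothesis rep : represented K g J X V Z.

Lemma rep_J (s : R) : dom g s -> J s.
Proof. intros H%(rep_dom rep). apply H. Qed.

Lemma rep_X_nonneg (s : R) : dom g s -> 0 <= X s.
Proof. intros H%(rep_dom rep). apply H. Qed.

Lemma rep_V_bound (s : R) : dom g s -> -1 < V s < 1.
Proof. intros H%(rep_dom rep). apply H. Qed.

Lemma rep_Z_continuous (s : R) : J s -> continuous Z s.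
Proof.
  intros Hs. exact (continuous_of_is_derive _ _ _ (rep_height rep s Hs)).
Qed.

Lemma rep_X_continuous (s : R) : J s -> continuous X s.
Proof. apply continuous_flow_X with (kext K) V. apply (rep_flow rep). Qed.

Lemma rep_V_continuous (s : R) : J s -> continuous V s.
Proof. apply continuous_flow_V with (kext K) X. apply (rep_flow rep). Qed.

Lemma rep_speed_pos (s : R) : dom g s -> 0 < sqrt (1 - V s ^ 2).
Proof. intros H%rep_V_bound. apply sqrt_lt_R0. nra. Qed.

(** Off the axis the conditions that define [admissible] are open, so only axis points can be
    endpoints belonging to the domain. *)
Lemma rep_dom_locally (s : R) : dom g s -> 0 < X s -> locally s (dom g).
Proof.
  intros Hs HX. pose proof (rep_J s Hs) as HJ.
  destruct (rep_flow rep) as (oJ & _ & _).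
  pose proof (rep_V_bound s Hs) as HV.
  assert (H1 : locally s (fun t => 0 < X t)).
  { apply (rep_X_continuous s HJ (fun y => 0 < y)). now apply (open_gt 0). }
  assert (H2 : locally s (fun t => -1 < V t)).
  { apply (rep_V_continuous s HJ (fun y => -1 < y)). now apply (open_gt (-1)). }
  assert (H3 : locally s (fun t => V t < 1)).
  { apply (rep_V_continuous s HJ (fun y => y < 1)). now apply (open_lt 1). }
  generalize (filter_and _ _ (oJ s HJ) (filter_and _ _ H1 (filter_and _ _ H2 H3))).
  apply filter_imp. intros t (Ht & Ht1 & Ht2 & Ht3).
  apply (rep_dom rep). split; auto. lra.
Qed.

(* At a zero of [X] in the interior, [X >= 0] would be minimal, so [X' = V] would vanish. *)
Lemma rep_interior_pos (s : R) : locally s (dom g) -> 0 < X s.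
Proof.
  intros Hs. pose proof (locally_singleton _ _ Hs) as Hd.
  destruct (rep_X_nonneg s Hd) as [|E]; auto. exfalso.
  apply (rep_axis rep s (rep_J s Hd)); auto.
  destruct (rep_flow rep) as (_ & _ & H).
  destruct (H s (rep_J s Hd)) as [d _].
  destruct Hs as [e He].
  assert (pr : derivable_pt X s). { exists (V s). now apply is_derive_Reals. }
  rewrite <- (deriv_minimum X (s - e) (s + e) s pr).
  - apply is_derive_Reals in d. symmetry. now apply derive_pt_eq_0.
  - destruct e; simpl; lra.
  - destruct e; simpl; lra.
  - intros t H1 H2. rewrite <- E. apply rep_X_nonneg, He.
    change (Rabs (t - s) < e). apply Rabs_def1; lra.
Qed.

Lemma surface_rep (p : R3) :
  surface g p <-> exists s, dom g s /\ c1 p ^ 2 + c2 p ^ 2 = X s ^ 2 /\ c3 p = Z s.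
Proof.
  destruct p as [[a b] c]. unfold c1, c2, c3. cbn [fst snd]. split.
  - intros ([s p] & Hs & E). unfold rot_param in E. cbn [fst snd] in *. injection E as -> -> ->.
    destruct (rep_eq rep s Hs) as (-> & _ & -> & _).
    exists s. split; auto. split; auto.
    pose proof (sin2_cos2 p) as H. unfold Rsqr in H.
    replace (X s ^ 2) with (X s ^ 2 * (sin p * sin p + cos p * cos p)) by (rewrite H; ring). ring.
  - intros (s & Hs & E & ->).
    destruct (polar a b (X s) (rep_X_nonneg s Hs) E) as (p & -> & ->).
    exists (s, p). split; auto. unfold rot_param. cbn [fst snd].
    now destruct (rep_eq rep s Hs) as (-> & _ & -> & _).
Qed.

(** [M] may contain rim parameters, at which the speed [sqrt (1 - V ^ 2)] vanishes; positivity at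
    its interior points is enough for strict monotonicity. *)
Lemma Z_increasing (M : R -> Prop) (s t : R) :
  convex M -> (forall s, M s -> J s) -> (forall s, locally s M -> dom g s) ->
  M s -> M t -> s < t -> Z s < Z t.
Proof.
  intros cM HJ HM. apply increasing_of_derive with (fun s => sqrt (1 - V s ^ 2)); auto.
  - apply continuous_on_forall. intros u Hu. apply rep_Z_continuous. auto.
  - intros u Hu. split. apply (rep_height rep), HJ, (locally_singleton _ _ Hu).
    apply rep_speed_pos. auto.
Qed.

Lemma rot_curve_continuous (s p : R) : J s ->
  continuous (fun u => (X u * cos p, X u * sin p, Z u)) s.
Proof.
  intros Hs. apply filterlim_pair_locally; [apply locally_filter | |].
  - apply (filterlim_pair_locally (U := R_UniformSpace) (V := R_UniformSpace));
      [apply locally_filter | |].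
    + apply (continuous_mult X (fun _ => cos p)). now apply rep_X_continuous.
      apply continuous_const.
    + apply (continuous_mult X (fun _ => sin p)). now apply rep_X_continuous.
      apply continuous_const.
  - now apply rep_Z_continuous.
Qed.

Lemma closure_surface_limit (s : R) (p : R3) :
  J s -> (forall P, locally s P -> exists u, dom g u /\ P u) -> 0 <= X s ->
  circumference (X s) (Z s) p -> closure (surface g) p.
Proof.
  intros Hs Hacc Hx [E1 E2] P HP. destruct p as [[a b] c].
  unfold c1, c2, c3 in E1, E2. cbn [fst snd] in E1, E2. subst c.
  destruct (polar a b (X s) Hx E1) as (phi & -> & ->).
  destruct (Hacc _ (rot_curve_continuous s phi Hs P HP)) as (u & Hu & HPu).
  exists (X u * cos phi, X u * sin phi, Z u). split; auto.
  exists (u, phi). split; auto. unfold rot_param. cbn [fst snd].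
  now destruct (rep_eq rep u Hu) as (-> & _ & -> & _).
Qed.

Lemma continuous_axis_distance (p : R3) : continuous (fun p : R3 => c1 p ^ 2 + c2 p ^ 2) p.
Proof.
  apply (continuous_plus (fun p : R3 => c1 p ^ 2) (fun p : R3 => c2 p ^ 2)).
  - apply (continuous_comp c1 (fun y => y ^ 2)). apply continuous_c1.
    apply (continuous_of_ex_derive (fun y => y ^ 2)). auto_derive; auto.
  - apply (continuous_comp c2 (fun y => y ^ 2)). apply continuous_c2.
    apply (continuous_of_ex_derive (fun y => y ^ 2)). auto_derive; auto.
Qed.

(** [M] stands for the domain completed by its rims. Its image under the increasing height is closed
    in the line, since on each side [M] has an extreme element or the heights are unbounded. The
    completed profile therefore generates a closed set, and the boundary consists of what was
    added. *)
Lemma boundary_rep (M : R -> Prop) :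
  convex M -> (forall s, dom g s -> M s) -> (forall s, M s -> J s /\ 0 <= X s) ->
  (forall s, locally s M -> dom g s) ->
  (forall s P, M s -> locally s P -> exists u, dom g u /\ P u) ->
  (exists a, M a /\ forall s, M s -> a <= s) \/ (forall y, exists s, M s /\ Z s < y) ->
  (exists b, M b /\ forall s, M s -> s <= b) \/ (forall y, exists s, M s /\ y < Z s) ->
  forall p, boundary (surface g) p <->
    exists s, M s /\ ~ dom g s /\ circumference (X s) (Z s) p.
Proof.
  intros cM HdM HMJ HMd Hacc Hlow Hupp p.
  assert (inc : forall s t, M s -> M t -> s < t -> Z s < Z t).
  { intros s t. apply Z_increasing; auto. intros u Hu. now apply HMJ. }
  assert (mono : forall s t, M s -> M t -> s <= t -> Z s <= Z t).
  { intros s t Hs Ht [H | ->]; [apply Rlt_le, inc; auto | lra]. }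
  split.
  - intros [Hcl Hnot].
    assert (Hnear : forall e : posreal, exists u, dom g u /\ Rabs (Z u - c3 p) < e /\
              Rabs (X u ^ 2 - (c1 p ^ 2 + c2 p ^ 2)) < e).
    { intros e.
      destruct (Hcl (fun q => Rabs (c3 q - c3 p) < e /\
        Rabs (c1 q ^ 2 + c2 q ^ 2 - (c1 p ^ 2 + c2 p ^ 2)) < e)) as (q & (Hq1 & Hq2) & Hq).
      - apply filter_and.
        + exact (continuous_c3 p _ (locally_ball (c3 p) e)).
        + exact (continuous_axis_distance p _ (locally_ball (c1 p ^ 2 + c2 p ^ 2) e)).
      - apply surface_rep in Hq. destruct Hq as (u & Hu & E1 & E2).
        exists u. rewrite <- E1, <- E2. auto. }
    (* [c3 p] is a limit of heights of the surface, so it cannot lie beyond the height of an extreme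
       element of [M]; the intermediate value theorem does the rest. *)
    assert (Hs : exists s, M s /\ Z s = c3 p).
    { destruct (classic (exists s, M s /\ Z s <= c3 p)) as [(s1 & M1 & H1) | Hno].
      - destruct (classic (exists s, M s /\ c3 p <= Z s)) as [(s2 & M2 & H2) | Hno].
        + destruct (Rle_or_lt s1 s2) as [Hle | Hlt].
          * destruct (intermediate_value M Z s1 s2 (c3 p)) as (s & Hs & E); auto.
            { apply continuous_on_forall. intros u Hu. apply rep_Z_continuous. now apply HMJ. }
            exists s. split; auto. now apply (cM s1 s2).
          * specialize (inc s2 s1 M2 M1 Hlt). lra.
        + destruct Hupp as [(b & Mb & Hb) | Hinf].
          * assert (Hzb : 0 < c3 p - Z b).
            { destruct (Rle_or_lt (c3 p) (Z b)); [| lra]. exfalso. apply Hno. now exists b. }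
            destruct (Hnear (mkposreal _ Hzb)) as (u & Hu & Hu1 & _). simpl in Hu1.
            apply HdM in Hu. specialize (mono u b Hu Mb (Hb u Hu)).
            apply Rabs_def2 in Hu1. lra.
          * destruct (Hinf (c3 p)) as (s & Hs & H). exfalso. apply Hno. exists s. split; auto. lra.
      - destruct Hlow as [(a & Ma & Ha) | Hinf].
        + assert (Hza : 0 < Z a - c3 p).
          { destruct (Rle_or_lt (Z a) (c3 p)); [| lra]. exfalso. apply Hno. now exists a. }
          destruct (Hnear (mkposreal _ Hza)) as (u & Hu & Hu1 & _). simpl in Hu1.
          apply HdM in Hu. specialize (mono a u Ma Hu (Ha u Hu)).
          apply Rabs_def2 in Hu1. lra.
        + destruct (Hinf (c3 p)) as (s & Hs & H). exfalso. apply Hno. exists s. split; auto. lra. }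
    destruct Hs as (s & Ms & Es). exists s.
    (* The inverse of [Z] is continuous on [M]: surface points with height near [Z s] have
       parameters near [s], hence radii near [X s]. *)
    assert (E : c1 p ^ 2 + c2 p ^ 2 = X s ^ 2).
    { destruct (Req_dec (c1 p ^ 2 + c2 p ^ 2) (X s ^ 2)) as [|Hne]; auto. exfalso.
      set (e := Rabs (c1 p ^ 2 + c2 p ^ 2 - X s ^ 2)).
      assert (He : 0 < e / 2).
      { assert (0 < e) by (apply Rabs_pos_lt; lra). lra. }
      assert (Hc : continuous (fun u => X u ^ 2) s).
      { apply (continuous_comp X (fun y => y ^ 2)). apply rep_X_continuous. now apply HMJ.
        apply (continuous_of_ex_derive (fun y => y ^ 2)). auto_derive; auto. }
      destruct (Hc _ (locally_ball (X s ^ 2) (mkposreal _ He))) as [d Hd].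
      destruct (increasing_inverse_continuous M Z s d cM inc Ms) as [d' Hd'].
      assert (Hm : 0 < Rmin d' (e / 2)) by (apply Rmin_pos; [apply cond_pos | auto]).
      destruct (Hnear (mkposreal _ Hm)) as (u & Hu & Hu1 & Hu2). simpl in Hu1, Hu2.
      rewrite <- Es in Hu1. specialize (Hd' u (HdM u Hu)).
      pose proof (Rmin_l d' (e / 2)). pose proof (Rmin_r d' (e / 2)).
      specialize (Hd u (Hd' ltac:(lra))).
      change (Rabs (X u ^ 2 - X s ^ 2) < e / 2) in Hd.
      apply Rabs_def2 in Hd. apply Rabs_def2 in Hu2.
      unfold e, Rabs in *. destruct (Rcase_abs _); lra. }
    split; auto. split; [| split; auto].
    intros Hd. apply Hnot. apply surface_rep. exists s. auto.
  - intros (s & Ms & Hnd & Hc). destruct (HMJ s Ms) as [HJ Hx]. split.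
    + apply closure_surface_limit with s; auto. intros P HP. now apply (Hacc s P).
    + intros Hp. apply surface_rep in Hp. destruct Hp as (u & Hu & _ & E).
      destruct Hc as [_ Hc]. rewrite E in Hc.
      destruct (Rtotal_order s u) as [H | [-> | H]]; auto.
      * specialize (inc s u Ms (HdM u Hu) H). lra.
      * specialize (inc u s (HdM u Hu) Ms H). lra.
Qed.

(** The prolonged functions are continuous at [b], so the limits are their values there. The limit
    of [th] is recovered from that of [cos th]: the cosine decreases on [(0, PI)], so a value close
    enough to 1 or -1 forces [th] close to 0 or [PI]. *)
Lemma boundary_circumference_rep (b sg : R) :
  J b -> 0 < X b -> sg = 1 \/ sg = -1 -> V b = sg ->
  (forall P, locally b P -> exists u, dom g u /\ P u) ->
  boundary_circumference g b (X b) (Z b).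
Proof.
  intros Jb Xb Hsg Vb Hacc. split; [split |].
  - intros s E Hs. injection E as <-. apply rep_V_bound in Hs. lra.
  - intros P HP. destruct (Hacc P HP) as (u & Hu & HPu). now exists u.
  - assert (Hlim : forall f h : R -> R, continuous h b -> (forall s, dom g s -> f s = h s) ->
      filterlim f (toward g b) (locally (h b))).
    { intros f h Hh E. unfold toward.
      apply (filterlim_within_ext (F := locally b) (dom g) h f).
      - intros s Hs. symmetry. auto.
      - apply filterlim_filter_le_1 with (2 := Hh).
        intros P HP. unfold within. revert HP. apply filter_imp. auto. }
    split; auto. split; [| split].
    + apply Hlim. now apply rep_X_continuous.
      intros s Hs. now apply (rep_eq rep).
    + apply Hlim. now apply rep_Z_continuous.
      intros s Hs. now apply (rep_eq rep).
    + assert (Hc : filterlim (fun s => cos (th g s)) (toward g b) (locally sg)).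
      { rewrite <- Vb. apply Hlim. now apply rep_V_continuous.
        intros s Hs. now apply (rep_eq rep). }
      assert (Hth : forall s, dom g s -> 0 < th g s < PI).
      { intros s Hs. now apply (rep_eq rep). }
      destruct Hsg as [-> | ->]; [left | right]; intros P [e He].
      * assert (H0 : 0 < Rmin e PI).
        { apply Rmin_pos. apply cond_pos. apply PI_RGT_0. }
        pose proof (Rmin_l e PI). pose proof (Rmin_r e PI).
        assert (Hm : 0 < Rmin e PI / 2 < PI) by lra.
        pose proof (cos_bound_strict _ Hm) as Hcb.
        assert (Hn : locally 1 (fun y => cos (Rmin e PI / 2) < y)).
        { apply (open_gt (cos (Rmin e PI / 2))). lra. }
        specialize (Hc _ Hn). unfold filtermap, toward, within in *.
        revert Hc. apply filter_imp. intros s Hcs Hs. specialize (Hcs Hs). apply He.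
        change (Rabs (th g s - 0) < e). specialize (Hth s Hs).
        rewrite Rabs_pos_eq by lra.
        assert (th g s < Rmin e PI / 2) by (apply cos_decreasing_0; lra). lra.
      * assert (H0 : 0 < Rmin e PI).
        { apply Rmin_pos. apply cond_pos. apply PI_RGT_0. }
        pose proof (Rmin_l e PI). pose proof (Rmin_r e PI).
        assert (Hm : 0 < PI - Rmin e PI / 2 < PI) by lra.
        pose proof (cos_bound_strict _ Hm) as Hcb.
        assert (Hn : locally (-1) (fun y => y < cos (PI - Rmin e PI / 2))).
        { apply (open_lt (cos (PI - Rmin e PI / 2))). lra. }
        specialize (Hc _ Hn). unfold filtermap, toward, within in *.
        revert Hc. apply filter_imp. intros s Hcs Hs. specialize (Hcs Hs). apply He.
        change (Rabs (th g s - PI) < e). specialize (Hth s Hs).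
        rewrite Rabs_left by lra.
        assert (PI - Rmin e PI / 2 < th g s) by (apply cos_decreasing_0; lra). lra.
Qed.

(** Height is a coordinate on the profile, since [Z' = w > 0]. As a function of height the radius
    has derivatives [V / w] and [X k / w ^ 4], the latter continuous, so it is of class C^2. The
    maps [la] and [mu] rescale the heights to [(0, 1)]. *)
Lemma diffeomorphic_rep (H : R -> Prop) (la mu : R -> R) :
  convex (dom g) -> (forall s, dom g s -> 0 < X s) ->
  (forall z, H z <-> exists s, dom g s /\ Z s = z) ->
  Cn 2 H la -> Cn 2 (fun t => 0 < t < 1) mu ->
  (forall z, H z -> 0 < la z < 1 /\ mu (la z) = z) ->
  (forall t, 0 < t < 1 -> H (mu t) /\ la (mu t) = t) ->
  diffeomorphic (surface g) open_cylinder.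
Proof.
  intros cD Xpos HH Cla Cmu Hla Hmu.
  assert (oD : open (dom g)). { intros s Hs. apply rep_dom_locally; auto. }
  set (w := fun s => sqrt (1 - V s ^ 2)).
  assert (dZ : forall s, dom g s -> is_derive Z s (w s)).
  { intros s Hs. apply (rep_height rep), rep_J, Hs. }
  destruct (inverse_of_increasing (dom g) Z w oD cD dZ rep_speed_pos) as [ze Hze].
  assert (oH : open H).
  { apply open_ext with (image Z (dom g)). intros z. symmetry. apply HH.
    exact (open_image (dom g) Z w oD cD dZ rep_speed_pos). }
  destruct (rep_flow rep) as (_ & _ & Hfl).
  assert (Hw : forall s, dom g s -> w s ^ 2 = 1 - V s ^ 2).
  { intros s Hs. unfold w. rewrite pow2_sqrt; auto.
    pose proof (rep_V_bound s Hs). nra. }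
  assert (dcomp : forall h s l, dom g s -> is_derive h s l ->
    is_derive (fun z => h (ze z)) (Z s) (/ w s * l)).
  { intros h s l Hs d. destruct (Hze s Hs) as [E1 E2].
    apply (is_derive_comp h ze); [now rewrite E1 | exact E2]. }
  assert (dV : forall s, dom g s -> is_derive V s (X s * kext K (V s))).
  { intros s Hs. exact (proj2 (Hfl s (rep_J s Hs))). }
  assert (dX : forall s, dom g s -> is_derive X s (V s)).
  { intros s Hs. exact (proj1 (Hfl s (rep_J s Hs))). }
  assert (dw : forall s, dom g s -> is_derive w s (- (V s * (X s * kext K (V s))) / w s)).
  { intros s Hs. pose proof (rep_speed_pos s Hs) as Hp. fold (w s) in Hp. evar_last.
    - apply (is_derive_sqrt (fun s => 1 - V s ^ 2)).
      + apply (is_derive_minus (fun _ => 1) (fun s => V s ^ 2)). apply is_derive_const.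
        apply is_derive_pow. exact (dV s Hs).
      + rewrite <- Hw by auto. nra.
    - fold (w s). unfold minus, plus, opp, zero; simpl. field. lra. }
  apply diffeomorphic_cylinder with H (fun z => X (ze z)) la mu; auto.
  - apply Cn_2 with (fun z => V (ze z) / w (ze z))
      (fun z => X (ze z) * kext K (V (ze z)) / (w (ze z)) ^ 4).
    + intros z (s & Hs & <-)%HH. destruct (Hze s Hs) as [E _]. rewrite E.
      replace (V s / w s) with (/ w s * V s) by (unfold Rdiv; ring). apply dcomp; auto.
    + intros z (s & Hs & <-)%HH. destruct (Hze s Hs) as [E _]. rewrite E.
      pose proof (rep_speed_pos s Hs) as Hp. fold (w s) in Hp.
      evar_last. apply (dcomp (fun s => V s / w s)); auto.
      apply (is_derive_div V w); auto. lra.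
      replace (X s * kext K (V s) * w s - V s * (- (V s * (X s * kext K (V s))) / w s))
        with (X s * kext K (V s) * (w s ^ 2 + V s ^ 2) / w s) by (field; lra).
      replace (w s ^ 2 + V s ^ 2) with 1 by (rewrite Hw by auto; ring). field. lra.
    + intros z (s & Hs & <-)%HH. destruct (Hze s Hs) as [E E2].
      pose proof (rep_speed_pos s Hs) as Hp. fold (w s) in Hp.
      apply (continuous_comp ze (fun s => X s * kext K (V s) / w s ^ 4)).
      { exact (continuous_of_is_derive _ _ _ E2). }
      rewrite E. apply (continuous_mult (fun s => X s * kext K (V s)) (fun s => / w s ^ 4)).
      * apply (continuous_mult X (fun s => kext K (V s))).
        -- apply rep_X_continuous, rep_J, Hs.
        -- apply (continuous_comp V (kext K)); auto. apply rep_V_continuous, rep_J, Hs.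
      * apply continuous_Rinv_comp.
        -- eapply continuous_of_is_derive. apply is_derive_pow, dw, Hs.
        -- apply pow_nonzero. lra.
  - intros z (s & Hs & <-)%HH. destruct (Hze s Hs) as [E _]. rewrite E. auto.
  - intros p. rewrite surface_rep. split.
    + intros (s & Hs & E1 & E2). split. { apply HH. exists s. auto. }
      rewrite E2. now rewrite (proj1 (Hze s Hs)).
    + intros [(s & Hs & E2)%HH E1]. exists s. split; auto. split; auto.
      rewrite <- E2 in E1. now rewrite (proj1 (Hze s Hs)) in E1.
Qed.

End Geometry.

(** Two representations of the same curve have, after undoing the shifts, heights with equal
    derivatives on [J]; the constant difference is the vertical translation. *)
Lemma surface_translate (K : R -> R) (J : R -> Prop) (X V Z1 Z2 : R -> R) (g1 g2 : profile)
    (t1 t2 s0 : R) :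
  represented K g1 (fun s => J (s - t1)) (fun s => X (s - t1)) (fun s => V (s - t1)) Z1 ->
  represented K g2 (fun s => J (s - t2)) (fun s => X (s - t2)) (fun s => V (s - t2)) Z2 ->
  dom g1 s0 ->
  vertical_translate (surface g1) (surface g2).
Proof.
  intros rep1 rep2 Hs0.
  (* A shift by [- c] undoes a shift by [c]; in the form [s - - c] it fits [is_derive_shift]. *)
  assert (E : forall s c, s - - c - c = s) by (intros; ring).
  assert (cJ : convex J).
  { intros s t u Hs Ht Hu. destruct (rep_flow rep1) as (_ & H & _).
    rewrite <- (E u t1). apply (H (s - - t1) (t - - t1)); rewrite ?E; auto. lra. }
  assert (HZ : forall g c Z, represented K g (fun s => J (s - c)) (fun s => X (s - c))
      (fun s => V (s - c)) Z ->
    forall s, J s -> is_derive (fun s => Z (s - - c)) s (sqrt (1 - V s ^ 2))).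
  { intros g c Z Hrep s Hs. apply is_derive_shift. rewrite <- (E s c) at 2.
    apply (rep_height Hrep). now rewrite E. }
  assert (Hconst : forall s, J s -> Z2 (s - - t2) + - Z1 (s - - t1)
    = Z2 (s0 - t1 - - t2) + - Z1 (s0 - t1 - - t1)).
  { assert (Hd : forall u, J u -> is_derive (fun s => Z2 (s - - t2) + - Z1 (s - - t1)) u 0).
    { intros u Hu. evar_last.
      - apply (is_derive_plus (fun s => Z2 (s - - t2)) (fun s => - Z1 (s - - t1))).
        + exact (HZ _ _ _ rep2 u Hu).
        + apply (is_derive_opp (fun s => Z1 (s - - t1))). exact (HZ _ _ _ rep1 u Hu).
      - unfold plus, opp; simpl. ring. }
    intros s Hs. apply (constant_of_derive_zero J (fun s => Z2 (s - - t2) + - Z1 (s - - t1))); auto.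
    - apply continuous_on_forall. intros u Hu. exact (continuous_of_is_derive _ _ _ (Hd u Hu)).
    - intros u Hu%locally_singleton. auto.
    - apply (rep_dom rep1 s0), Hs0. }
  set (m := Z2 (s0 - t1 - - t2) + - Z1 (s0 - t1 - - t1)) in Hconst.
  exists m. intros a b d. rewrite (surface_rep rep1), (surface_rep rep2).
  unfold c1, c2, c3; cbn [fst snd].
  split; intros (s & Hs & E1 & E2).
  - apply (rep_dom rep2) in Hs. exists (s - t2 - - t1). rewrite (rep_dom rep1).
    unfold admissible. rewrite !E. split; auto. split; auto.
    specialize (Hconst (s - t2) (proj1 Hs)). replace (s - t2 - - t2) with s in Hconst by ring. lra.
  - apply (rep_dom rep1) in Hs. exists (s - t1 - - t2). rewrite (rep_dom rep2).
    unfold admissible. rewrite !E. split; auto. split; auto.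
    specialize (Hconst (s - t1) (proj1 Hs)). replace (s - t1 - - t1) with s in Hconst by ring. lra.
Qed.

(** * The three types of surfaces *)

Lemma filterlim_restrict {T U : Type} (F : (T -> Prop) -> Prop) (G : (U -> Prop) -> Prop)
    (D : T -> Prop) (f : T -> U) :
  Filter F -> filterlim f F G -> filterlim f (within D F) G.
Proof.
  intros FF Hf P HP. specialize (Hf P HP). unfold filtermap, within in *.
  revert Hf. apply filter_imp. auto.
Qed.

Lemma filterlim_Rplus {T : Type} (F : (T -> Prop) -> Prop) (f g : T -> R) (x y : R) :
  Filter F -> filterlim f F (locally x) -> filterlim g F (locally y) ->
  filterlim (fun t => f t + g t) F (locally (x + y)).
Proof.
  intros FF Hf Hg. exact (filterlim_comp_2 f g Rplus Hf Hg (filterlim_plus x y)).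
Qed.

Lemma filterlim_Rmult {T : Type} (F : (T -> Prop) -> Prop) (f g : T -> R) (x y : R) :
  Filter F -> filterlim f F (locally x) -> filterlim g F (locally y) ->
  filterlim (fun t => f t * g t) F (locally (x * y)).
Proof.
  intros FF Hf Hg. exact (filterlim_comp_2 f g Rmult Hf Hg (filterlim_mult x y)).
Qed.

Lemma filterlim_sqr {T : Type} (F : (T -> Prop) -> Prop) (f : T -> R) (x : R) :
  Filter F -> filterlim f F (locally x) -> filterlim (fun t => f t ^ 2) F (locally (x ^ 2)).
Proof.
  intros FF Hf. apply (filterlim_comp _ _ _ f (fun y => y ^ 2) _ (locally x)); auto.
  apply (continuous_of_ex_derive (fun y => y ^ 2)). auto_derive; auto.
Qed.

(** The identity [E] displays the convexity defect of the square as a nonnegative term. Strictness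
    survives because one of the weights [t] and [1 - t] is at least one half. *)
Lemma disc_convex (a b a' b' r t : R) :
  a ^ 2 + b ^ 2 < r ^ 2 -> a' ^ 2 + b' ^ 2 < r ^ 2 -> 0 <= t <= 1 ->
  ((1 - t) * a + t * a') ^ 2 + ((1 - t) * b + t * b') ^ 2 < r ^ 2.
Proof.
  intros H1 H2 Ht.
  assert (E : forall x y, ((1 - t) * x + t * y) ^ 2
            = (1 - t) * x ^ 2 + t * y ^ 2 - t * (1 - t) * (x - y) ^ 2) by (intros; ring).
  rewrite !E.
  assert (H : forall x y, 0 <= t * (1 - t) * (x - y) ^ 2).
  { intros x y. apply Rmult_le_pos. nra. apply pow2_ge_0. }
  pose proof (H a a'). pose proof (H b b').
  destruct (Rle_or_lt t (1 / 2)); nra.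
Qed.

(* The surface is a graph over a disc, so the straight-line homotopy of the disc lifts. *)
Lemma simply_connected_graph (A : R3 -> Prop) (f : R -> R) (r : R) :
  0 < r -> (forall rho, 0 <= rho < r -> continuous f rho) ->
  (forall p, A p <-> c1 p ^ 2 + c2 p ^ 2 < r ^ 2 /\ c3 p = f (sqrt (c1 p ^ 2 + c2 p ^ 2))) ->
  simply_connected A.
Proof.
  intros Hr Hf HA.
  set (L := fun a b : R => (a, b, f (sqrt (a ^ 2 + b ^ 2))) : R3).
  assert (AL : forall a b, a ^ 2 + b ^ 2 < r ^ 2 -> A (L a b)).
  { intros a b H. apply HA. split; auto. }
  assert (LA : forall p, A p -> c1 p ^ 2 + c2 p ^ 2 < r ^ 2 /\ L (c1 p) (c2 p) = p).
  { intros p [H1 H2]%HA. split; auto. unfold L. rewrite <- H2. now destruct p as [[a b] c]. }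
  assert (Lc : forall (T : Type) (F : (T -> Prop) -> Prop) (a b : T -> R) x y, Filter F ->
    filterlim a F (locally x) -> filterlim b F (locally y) -> x ^ 2 + y ^ 2 < r ^ 2 ->
    filterlim (fun t => L (a t) (b t)) F (locally (L x y))).
  { intros T F a b x y FF Ha Hb Hxy.
    apply filterlim_pair_locally; auto.
    - now apply (filterlim_pair_locally (U := R_UniformSpace) (V := R_UniformSpace)).
    - apply (filterlim_comp _ _ _ (fun t => a t ^ 2 + b t ^ 2) (fun w => f (sqrt w)) _
        (locally (x ^ 2 + y ^ 2))).
      + apply filterlim_Rplus; auto; now apply filterlim_sqr.
      + apply (continuous_comp sqrt f). apply continuous_sqrt. apply Hf.
        split. apply sqrt_pos. rewrite <- (sqrt_pow2 r) by lra. apply sqrt_lt_1_alt.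
        split; auto. nra. }
  split; [| split].
  - exists (L 0 0). apply AL. nra.
  - intros p q Hp Hq. destruct (LA p Hp) as [Dp Ep]. destruct (LA q Hq) as [Dq Eq].
    exists (fun t => L ((1 - t) * c1 p + t * c1 q) ((1 - t) * c2 p + t * c2 q)).
    assert (Hl : forall x y t, filterlim (fun t => (1 - t) * x + t * y) (within I01 (locally t))
      (locally ((1 - t) * x + t * y))).
    { intros x y t. apply filterlim_restrict; [apply locally_filter |].
      apply (continuous_of_ex_derive (fun t => (1 - t) * x + t * y)). auto_derive; auto. }
    split; [split | split].
    + intros t Ht. apply Lc; auto; [apply within_filter, locally_filter |].
      now apply disc_convex.
    + intros t Ht. apply AL. now apply disc_convex.
    + rewrite <- Ep at 3. f_equal; ring.
    + rewrite <- Eq at 3. f_equal; ring.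
  - intros g [cg Ag] Eg.
    set (a0 := c1 (g 0)). set (b0 := c2 (g 0)).
    assert (H01 : I01 0 /\ I01 1) by (unfold I01; lra). destruct H01 as [I0 I1].
    destruct (LA (g 0) (Ag 0 I0)) as [D0 E0].
    exists (fun q => L ((1 - fst q) * c1 (g (snd q)) + fst q * a0)
                       ((1 - fst q) * c2 (g (snd q)) + fst q * b0)).
    split; [| split; [| split]].
    + intros [t u] [Ht Hu]. cbn [fst snd] in Ht, Hu.
      set (F := within (fun q : R2 => I01 (fst q) /\ I01 (snd q)) (locally ((t, u) : R2))).
      assert (FF : Filter F) by apply within_filter, locally_filter.
      assert (Hfst : filterlim (fun q : R2 => fst q) F (locally t)).
      { apply filterlim_restrict; [apply locally_filter |]. apply (continuous_fst t u). }
      assert (Hsnd : filterlim (fun q : R2 => snd q) F (within I01 (locally u))).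
      { intros P HP. unfold filtermap, F, within in *.
        pose proof (continuous_snd t u _ HP) as H. unfold filtermap in H. revert H. apply filter_imp.
        intros q Hq [_ H2]. now apply Hq. }
      assert (Hg : filterlim (fun q : R2 => g (snd q)) F (locally (g u))).
      { apply filterlim_comp with (1 := Hsnd). now apply cg. }
      assert (H1 : filterlim (fun q : R2 => 1 - fst q) F (locally (1 - t))).
      { apply (filterlim_comp _ _ _ (fun q : R2 => fst q) (fun y => 1 - y) _ (locally t)); auto.
        apply (continuous_of_ex_derive (fun y => 1 - y)). auto_derive; auto. }
      assert (Hlin : forall c : R3 -> R, (forall p, continuous c p) -> forall y,
        filterlim (fun q : R2 => (1 - fst q) * c (g (snd q)) + fst q * y) F
          (locally ((1 - t) * c (g u) + t * y))).
      { intros c Hc y. apply filterlim_Rplus; auto; apply filterlim_Rmult; auto.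
        - apply filterlim_comp with (1 := Hg). apply Hc.
        - apply filterlim_const. }
      cbn [fst snd].
      apply Lc; auto using continuous_c1, continuous_c2.
      apply disc_convex; auto. now apply LA, Ag.
    + intros t u Ht Hu. cbn [fst snd]. apply AL, disc_convex; auto. now apply LA, Ag.
    + intros u Hu. cbn [fst snd]. destruct (LA (g u) (Ag u Hu)) as [_ Eu]. split.
      * rewrite <- Eu at 3. f_equal; ring.
      * rewrite <- E0. fold a0 b0. f_equal; ring.
    + intros t Ht. cbn [fst snd]. rewrite <- Eg. fold a0 b0.
      assert (E : L ((1 - t) * a0 + t * a0) ((1 - t) * b0 + t * b0) = g 0).
      { rewrite <- E0. fold a0 b0. f_equal; ring. }
      auto.
Qed.

(** Move from [s] a small fraction [e] of the way toward [m]. The 1 added to [|m - s|] keeps the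
    quotient meaningful when [m = s]. *)
Lemma points_near (D P : R -> Prop) (s m : R) :
  (forall e, 0 < e < 1 -> D (s + e * (m - s))) -> locally s P -> exists u, D u /\ P u.
Proof.
  intros HD [d Hd]. pose proof (Rabs_pos (m - s)) as Hp. pose proof (cond_pos d) as Hd0.
  set (e := Rmin (1 / 2) (d / 2 / (Rabs (m - s) + 1))).
  assert (Hq : 0 < d / 2 / (Rabs (m - s) + 1)) by (apply Rdiv_lt_0_compat; lra).
  assert (He : 0 < e) by (apply Rmin_pos; lra).
  assert (He1 : e <= 1 / 2) by apply Rmin_l.
  assert (He2 : e <= d / 2 / (Rabs (m - s) + 1)) by apply Rmin_r.
  exists (s + e * (m - s)). split. apply HD. lra. apply Hd.
  change (Rabs (s + e * (m - s) - s) < d).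
  replace (s + e * (m - s) - s) with (e * (m - s)) by ring.
  rewrite Rabs_mult, (Rabs_pos_eq e) by lra.
  assert (e * (Rabs (m - s) + 1) <= d / 2).
  { replace (d / 2) with (d / 2 / (Rabs (m - s) + 1) * (Rabs (m - s) + 1)) by (field; lra).
    apply Rmult_le_compat_r; lra. }
  nra.
Qed.

Lemma locally_step (D : R -> Prop) (s sg : R) : sg = 1 \/ sg = -1 -> locally s D ->
  exists d, 0 < d /\ D (s + sg * d) /\ D (s - sg * d).
Proof.
  intros Hsg [d Hd]. exists (d / 2). pose proof (cond_pos d). split. lra.
  split; apply Hd.
  - change (Rabs (s + sg * (d / 2) - s) < d). apply Rabs_def1; destruct Hsg; subst; lra.
  - change (Rabs (s - sg * (d / 2) - s) < d). apply Rabs_def1; destruct Hsg; subst; lra.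
Qed.

Section Types.

Context {K : R -> R} {g : profile} {J : R -> Prop} {X V Z : R -> R}.
Hypothesis k_cont : forall t, continuous (kext K) t.
Hypothesis rep : represented K g J X V Z.

Let cJ : convex J.
Proof. apply (rep_flow rep). Qed.

Let xc_eq (s : R) : dom g s -> xc g s = X s.
Proof. intros Hs. now apply (rep_eq rep). Qed.

Lemma waist_type_rep (x0 : R) : waist_shape J X V (dom g) x0 -> waist_type x0 g.
Proof.
  intros (a & c & b & Hacb & Ja & Jb & Va & Vb & Xc & Hx0 & Hdom & HX).
  assert (Hpos : forall s, J s -> 0 < X s).
  { intros s Hs. destruct (Req_dec s c) as [-> | Hne]. lra. specialize (HX s Hs Hne). lra. }
  (* The domain completed by its two rims, as [boundary_rep] expects. *)
  set (M := fun s => a <= s <= b).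
  assert (cM : convex M) by (intros s t u; unfold M; lra).
  assert (MJ : forall s, M s -> J s) by (intros s Hs; apply (cJ a b); auto).
  assert (Md : forall s, locally s M -> dom g s).
  { intros s Hs. apply Hdom. destruct (locally_step M s 1 (or_introl eq_refl) Hs) as (d & Hd & H).
    unfold M in H. lra. }
  assert (acc : forall s P, M s -> locally s P -> exists u, dom g u /\ P u).
  { intros s P Hs. apply points_near with c. intros e He. apply Hdom. unfold M in Hs.
    split; nra. }
  assert (inc : Z a < Z b).
  { apply (Z_increasing rep M); auto; unfold M; lra. }
  split; [| split].
  - apply (diffeomorphic_rep k_cont rep (fun z => Z a < z < Z b)
      (fun z => (z - Z a) / (Z b - Z a)) (fun t => Z a + t * (Z b - Z a))).
    + intros s t u Hs%Hdom Ht%Hdom Hu. apply Hdom. lra.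
    + intros s Hs%Hdom. apply Hpos, MJ. unfold M. lra.
    + intros z. split.
      * intros Hz. destruct (intermediate_value J Z a b z) as (s & Hs & E); auto; try lra.
        { apply continuous_on_forall. intros u Hu.
          now apply (rep_Z_continuous rep). }
        exists s. split; auto. apply Hdom.
        destruct (Req_dec s a) as [-> |]; [lra |]. destruct (Req_dec s b) as [-> |]; lra.
      * intros (s & Hs%Hdom & <-).
        split; apply (Z_increasing rep M); auto; unfold M; lra.
    + apply Cn_2 with (fun _ => / (Z b - Z a)) (fun _ => 0).
      * intros z _. auto_derive; auto. field. lra.
      * intros z _. exact (is_derive_const (/ (Z b - Z a)) z).
      * intros z _. apply continuous_const.
    + apply Cn_2 with (fun _ => Z b - Z a) (fun _ => 0).
      * intros t _. auto_derive; auto. ring.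
      * intros t _. exact (is_derive_const (Z b - Z a) t).
      * intros t _. apply continuous_const.
    + intros z Hz. split; [split |].
      * apply Rdiv_lt_0_compat; lra.
      * apply Rmult_lt_reg_r with (Z b - Z a). lra.
        unfold Rdiv. rewrite Rmult_assoc, Rinv_l; lra.
      * field. lra.
    + intros t Ht. split; [split; nra |]. field. lra.
  - exists c. assert (Hc : dom g c) by (apply Hdom; lra).
    split; auto. split. now rewrite xc_eq.
    intros s Hs Hne. rewrite xc_eq by auto. apply HX; auto. apply (rep_J rep s Hs).
  - exists a, b, (X a), (X b), (Z a), (Z b).
    split. { intros E. injection E as E. lra. }
    split. lra. split; [| split].
    + apply (boundary_circumference_rep rep a (-1)); auto.
      intros P. apply acc. unfold M. lra.
    + apply (boundary_circumference_rep rep b 1); auto.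
      intros P. apply acc. unfold M. lra.
    + intros p. rewrite (boundary_rep rep M); auto.
      * split.
        -- intros (s & Hs & Hn & Hp). rewrite Hdom in Hn. unfold M in Hs.
           destruct (Req_dec s a) as [-> |]; auto. destruct (Req_dec s b) as [-> |]; auto.
           exfalso. apply Hn. lra.
        -- intros [Hp | Hp]; [exists a | exists b]; unfold M; rewrite Hdom;
             (split; [lra | split; [lra | auto]]).
      * intros s Hs%Hdom. unfold M. lra.
      * intros s Hs. split; auto. now apply Rlt_le, Hpos, MJ.
      * left. exists a. unfold M. split. lra. intros s Hs. lra.
      * left. exists b. unfold M. split. lra. intros s Hs. lra.
Qed.

Lemma axis_type_rep (nu0 : R) : axis_shape J X V (dom g) nu0 -> axis_type nu0 g.
Proof.
  intros (sg & a & b & S & Hsg & Hab & Ja & Jb & Xa & Va & Vb & Xb & Hdom & HS & HX).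
  set (M := fun s => 0 <= sg * (s - a) /\ 0 <= sg * (b - s)).
  assert (cM : convex M) by (intros s t u; unfold M; destruct Hsg; subst sg; lra).
  assert (MJ : forall s, M s -> J s).
  { intros s. unfold M. intros Hs. destruct Hsg; subst sg; [apply (cJ a b) | apply (cJ b a)];
      auto; lra. }
  assert (Md : forall s, locally s M -> dom g s).
  { intros s Hs. apply Hdom. destruct (locally_step M s sg Hsg Hs) as (d & Hd & H).
    unfold M in H. destruct Hsg; subst sg; lra. }
  assert (acc : forall s P, M s -> locally s P -> exists u, dom g u /\ P u).
  { intros s P Hs. apply points_near with a. intros e He. apply Hdom. unfold M in Hs.
    destruct Hsg; subst sg; split; nra. }
  assert (Ma : M a) by (unfold M; destruct Hsg; subst sg; lra).
  assert (Mb : M b) by (unfold M; destruct Hsg; subst sg; lra).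
  assert (Da : dom g a) by (apply Hdom; destruct Hsg; subst sg; lra).
  assert (DM : forall s, M s -> s <> b -> dom g s).
  { intros s Hs Hne. apply Hdom. unfold M in Hs. destruct Hsg; subst sg; lra. }
  split; [| split].
  (* [S] inverts [X] on the domain, so the surface is the graph of [Z (S rho)] over the open disc of
     radius [X b]. The cusp lies over the centre, where the graph is still continuous. *)
  - apply simply_connected_graph with (fun rho => Z (S rho)) (X b); auto.
    + intros rho Hrho. destruct (HX rho Hrho) as (H1 & _ & H2).
      apply continuous_comp; auto. apply (rep_Z_continuous rep).
      now apply (rep_J rep).
    + intros p. rewrite (surface_rep rep). split.
      * intros (s & Hs & E1 & E2). destruct (HS s Hs) as [H1 H2]. rewrite E1, E2.
        rewrite sqrt_pow2, H2 by lra. split; auto. nra.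
      * intros [H1 H2]. assert (H0 : 0 <= c1 p ^ 2 + c2 p ^ 2) by nra.
        destruct (HX (sqrt (c1 p ^ 2 + c2 p ^ 2))) as (H3 & H4 & _).
        { split. apply sqrt_pos. rewrite <- (sqrt_pow2 (X b)) by lra.
          apply sqrt_lt_1_alt. lra. }
        exists (S (sqrt (c1 p ^ 2 + c2 p ^ 2))). rewrite H4, pow2_sqrt by auto. auto.
  - exists a. split; auto. rewrite xc_eq by auto. split; auto. split.
    + rewrite <- Va. now apply (rep_eq rep).
    + intros s Hs. rewrite xc_eq by auto. intros E.
      destruct (HS s Hs) as [_ <-]. destruct (HS a Da) as [_ <-]. now rewrite E, Xa.
  - exists b, (X b), (Z b). split.
    + apply (boundary_circumference_rep rep b sg); auto. intros P. now apply acc.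
    + intros p. rewrite (boundary_rep rep M); auto.
      * split.
        -- intros (s & Hs & Hn & Hp). destruct (Req_dec s b) as [-> |]; auto.
           exfalso. auto.
        -- intros Hp. exists b. split; auto. split; auto. rewrite Hdom. lra.
      * intros s Hs%Hdom. unfold M. lra.
      * intros s Hs. split; auto. destruct (Req_dec s b) as [-> | Hne]. lra.
        apply HS. now apply DM.
      * left. destruct Hsg; subst sg; [exists a | exists b]; split; auto;
          unfold M; intros s Hs; lra.
      * left. destruct Hsg; subst sg; [exists b | exists a]; split; auto;
          unfold M; intros s Hs; lra.
Qed.

(** While [|V| <= 1 - d], the height grows at rate at least [w = sqrt (1 - (1 - d) ^ 2)]; over a
    half-line of times this makes [sg * Z] tend to minus infinity at the unbounded end. *)
Lemma asymptotic_height (sg b d t : R) : sg = 1 \/ sg = -1 -> 0 < d ->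
  (forall s, dom g s <-> 0 < sg * (b - s)) ->
  (forall s, 0 < sg * (t - s) -> Rabs (V s) <= 1 - d) ->
  forall y, exists u, forall s, 0 < sg * (u - s) -> dom g s /\ sg * Z s < y.
Proof.
  intros Hsg Hd Hdom HV y.
  assert (Ht0 : exists t0, 0 < sg * (t - t0) /\ 0 < sg * (b - t0)).
  { destruct Hsg; subst sg; [exists (Rmin t b - 1) | exists (Rmax t b + 1)].
    - pose proof (Rmin_l t b). pose proof (Rmin_r t b). lra.
    - pose proof (Rmax_l t b). pose proof (Rmax_r t b). lra. }
  destruct Ht0 as (t0 & Ht0 & Hb0).
  set (I := fun s => 0 <= sg * (t0 - s)).
  set (w := sqrt (1 - (1 - d) ^ 2)).
  assert (Hd1 : d <= 1) by (specialize (HV t0 Ht0); pose proof (Rabs_pos (V t0)); lra).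
  assert (Hw : 0 < w) by (apply sqrt_lt_R0; nra).
  assert (ID : forall s, I s -> dom g s).
  { intros s Hs. apply Hdom. unfold I in Hs. destruct Hsg; subst sg; lra. }
  assert (IJ : forall s, I s -> J s).
  { intros s Hs. now apply (rep_J rep), ID. }
  assert (mono : forall s u, I s -> I u -> s <= u -> Z s + - (w * s) <= Z u + - (w * u)).
  { intros s u. apply (nondecreasing_of_derive I (fun s => Z s + - (w * s))
      (fun s => sqrt (1 - V s ^ 2) + - w)).
    - intros p q r. unfold I. destruct Hsg; subst sg; lra.
    - apply continuous_on_plus.
      + apply continuous_on_forall. intros p Hp. apply (rep_Z_continuous rep). auto.
      + apply continuous_on_forall. intros p Hp.
        apply (continuous_of_ex_derive (fun s => - (w * s))). auto_derive; auto.
    - intros p Hp%locally_singleton. split.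
      + apply (is_derive_plus Z (fun s => - (w * s))).
        * apply (rep_height rep). auto.
        * auto_derive; auto. ring.
      + enough (w <= sqrt (1 - V p ^ 2)) by lra. apply sqrt_le_1_alt.
        assert (Hp' : Rabs (V p) <= 1 - d).
        { apply HV. unfold I in Hp. destruct Hsg; subst sg; lra. }
        apply Rabs_le_between in Hp'. nra. }
  (* A duration long enough, at rate at least [w], to bring [sg * Z] from its value at [t0] below
     [y]. *)
  set (q := Rabs (sg * Z t0 - y) / w + 1).
  assert (Hq : 0 < q /\ sg * Z t0 - y < w * q).
  { assert (0 <= Rabs (sg * Z t0 - y) / w).
    { apply Rmult_le_pos. apply Rabs_pos. apply Rlt_le, Rinv_0_lt_compat, Hw. }
    split. unfold q; lra.
    replace (w * q) with (Rabs (sg * Z t0 - y) + w) by (unfold q; field; lra).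
    pose proof (Rle_abs (sg * Z t0 - y)). lra. }
  exists (t0 - sg * q). intros s Hs.
  assert (Is : I s) by (unfold I; destruct Hsg; subst sg; lra).
  assert (I0 : I t0) by (unfold I; lra).
  split; auto. destruct Hq as [Hq1 Hq2].
  destruct Hsg; subst sg.
  - specialize (mono s t0 Is I0 ltac:(lra)). nra.
  - specialize (mono t0 s I0 Is ltac:(lra)). nra.
Qed.

(** The two clauses on [sg * c3 p] record on which side the end goes off to infinity; they are what
    distinguishes the two asymptotic surfaces up to translation. *)
Lemma asymptotic_type_rep (sg : R) : sg = 1 \/ sg = -1 ->
  asymptotic_shape J X V (dom g) sg ->
  asymptotic_type g /\ (exists h, forall p, surface g p -> sg * c3 p < h) /\
  (forall y, exists p, surface g p /\ sg * c3 p < y).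
Proof.
  intros Hsg (b & Jb & Vb & Hdom & HJ & HX & Hlim & d & t & Hd & Ht).
  pose proof (asymptotic_height sg b d t Hsg Hd Hdom Ht) as Hz.
  set (M := fun s => 0 <= sg * (b - s)).
  assert (cM : convex M) by (intros s u v; unfold M; destruct Hsg; subst sg; lra).
  assert (MJ : forall s, M s -> J s).
  { intros s. unfold M. intros Hs. destruct (Req_dec s b) as [-> | Hne]; auto.
    apply HJ. destruct Hsg; subst sg; lra. }
  assert (Md : forall s, locally s M -> dom g s).
  { intros s Hs. apply Hdom. destruct (locally_step M s sg Hsg Hs) as (e & He & H).
    unfold M in H. destruct Hsg; subst sg; lra. }
  (* Points of the domain close to [s], which may be the rim, are found on the side away from the
     rim, in the direction of [s - sg]. *)
  assert (acc : forall s P, M s -> locally s P -> exists u, dom g u /\ P u).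
  { intros s P Hs. apply points_near with (s - sg). intros e He. apply Hdom. unfold M in Hs.
    destruct Hsg; subst sg; nra. }
  assert (Mb : M b) by (unfold M; lra).
  assert (DM : forall s, dom g s -> M s) by (intros s Hs%Hdom; unfold M; lra).
  assert (inc : forall s u, M s -> M u -> s < u -> Z s < Z u).
  { intros s u. now apply (Z_increasing rep M). }
  assert (Hzb : forall s, dom g s -> 0 < sg * (Z b - Z s)).
  { intros s Hs. pose proof (DM s Hs) as Ms. apply Hdom in Hs.
    destruct Hsg; subst sg; [specialize (inc s b Ms Mb) | specialize (inc b s Mb Ms)]; lra. }
  split; [split |].
  (* The heights fill an open half-line ending at [Z b], which the exponential carries onto
     [(0, 1)]. *)
  - apply (diffeomorphic_rep k_cont rep (fun z => 0 < sg * (Z b - z))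
      (fun z => exp (sg * (z - Z b))) (fun u => Z b + sg * ln u)).
    + intros s u v Hs%Hdom Hu%Hdom Hv. apply Hdom. destruct Hsg; subst sg; lra.
    + intros s Hs%Hdom. auto.
    + intros z. split.
      * intros Hzz. destruct (Hz (sg * z)) as [u Hu].
        destruct (Hu (u - sg)) as [Du Zu]. { destruct Hsg; subst sg; lra. }
        assert (Hex : exists s, M s /\ Z s = z).
        { pose proof (DM _ Du) as Mu.
          assert (Hcont : continuous_on M Z).
          { apply continuous_on_forall. intros v Hv. apply (rep_Z_continuous rep). auto. }
          apply Hdom in Du. destruct Hsg; subst sg.
          - destruct (intermediate_value M Z (u - 1) b z) as (s & Hs & E); auto; try lra.
            exists s. split; auto. apply (cM (u - 1) b); auto.
          - destruct (intermediate_value M Z b (u - -1) z) as (s & Hs & E); auto; try lra.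
            exists s. split; auto. apply (cM b (u - -1)); auto. }
        destruct Hex as (s & Ms & E). exists s. split; auto. apply Hdom. unfold M in Ms.
        assert (s <> b) by (intros ->; destruct Hsg; subst sg; lra).
        destruct Hsg; subst sg; lra.
      * intros (s & Hs & <-). auto.
    + apply Cn_2 with (fun z => sg * exp (sg * (z - Z b))) (fun z => sg * (sg * exp (sg * (z - Z b)))).
      * intros z _. auto_derive; auto. unfold Rminus. ring.
      * intros z _. auto_derive; auto. unfold Rminus. ring.
      * intros z _.
        apply (continuous_of_is_derive (fun z => sg * (sg * exp (sg * (z - Z b)))) z
          (sg * (sg * (sg * exp (sg * (z - Z b)))))).
        auto_derive; auto. unfold Rminus. ring.
    + apply Cn_2 with (fun u => sg * / u) (fun u => - sg * / u ^ 2).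
      * intros u Hu. auto_derive. lra. field. lra.
      * intros u Hu. auto_derive. lra. field. lra.
      * intros u Hu.
        apply (continuous_of_is_derive (fun u => - sg * / u ^ 2) u (2 * sg * / u ^ 3)).
        auto_derive. apply Rgt_not_eq. nra. field. lra.
    + intros z Hzz. split; [split |].
      * apply exp_pos.
      * rewrite <- exp_0. apply exp_increasing. lra.
      * rewrite ln_exp. destruct Hsg; subst sg; lra.
    + intros u Hu. split.
      * assert (ln u < 0) by (rewrite <- ln_1; apply ln_increasing; lra).
        destruct Hsg; subst sg; lra.
      * replace (sg * (Z b + sg * ln u - Z b)) with (ln u) by (destruct Hsg; subst sg; ring).
        apply exp_ln. lra.
  - assert (Hbc : boundary_circumference g b (X b) (Z b)).
    { apply (boundary_circumference_rep rep b sg); auto. intros P. now apply acc. }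
    assert (Hbd : forall p, boundary (surface g) p <-> circumference (X b) (Z b) p).
    { intros p. rewrite (boundary_rep rep M); auto.
      * split.
        -- intros (s & Hs & Hn & Hp). destruct (Req_dec s b) as [-> | Hne]; auto.
           exfalso. apply Hn, Hdom. unfold M in Hs. destruct Hsg; subst sg; lra.
        -- intros Hp. exists b. split; auto. split; auto. rewrite Hdom. lra.
      * intros s Hs. split; auto. now apply Rlt_le, HX, MJ.
      * destruct Hsg; subst sg; [right | left].
        -- intros y. destruct (Hz y) as [u Hu]. exists (u - 1).
           destruct (Hu (u - 1)) as [H1 H2]. lra. split; auto. lra.
        -- exists b. split; auto. unfold M. intros s Hs. lra.
      * destruct Hsg; subst sg; [left | right].
        -- exists b. split; auto. unfold M. intros s Hs. lra.
        -- intros y. destruct (Hz (- y)) as [u Hu]. exists (u + 1).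
           destruct (Hu (u + 1)) as [H1 H2]. lra. split; auto. lra. }
    assert (Hx : forall P : R -> Prop, locally 0 P ->
      exists u, forall s, 0 < sg * (u - s) -> dom g s -> P (xc g s)).
    { intros P [e He]. destruct (Hlim e (cond_pos e)) as [u Hu]. exists u. intros s Hs Ds.
      rewrite xc_eq by auto. apply He. change (Rabs (X s - 0) < e).
      specialize (Hu s Hs). rewrite Rminus_0_r, Rabs_pos_eq; auto.
      now apply Rlt_le, HX, MJ, DM. }
    assert (Ha : forall y, exists u, forall s, 0 < sg * (u - s) -> dom g s -> y < Rabs (zc g s)).
    { intros y. destruct (Hz (- y)) as [u Hu]. exists u. intros s Hs Ds.
      destruct (Hu s Hs) as [_ H]. destruct (rep_eq rep s Ds) as (_ & _ & -> & _).
      destruct Hsg; subst sg.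
      - pose proof (Rle_abs (- Z s)). rewrite Rabs_Ropp in H0. lra.
      - pose proof (Rle_abs (Z s)). lra. }
    destruct Hsg; subst sg; [exists m_infty | exists p_infty]; exists b, (X b), (Z b);
      (split; [discriminate |]); (split; [| now split]).
    + split; [split |].
      * discriminate.
      * intros P [u Hu]. exists (Rmin u b - 1). pose proof (Rmin_l u b). pose proof (Rmin_r u b).
        split. apply Hdom. lra. apply Hu. lra.
      * split.
        -- intros P HP. destruct (Hx P HP) as [u Hu]. exists u. intros s Hs. apply Hu. lra.
        -- intros P [y HP]. destruct (Ha y) as [u Hu]. exists u. intros s Hs Ds. apply HP.
           apply Hu; auto. lra.
    + split; [split |].
      * discriminate.
      * intros P [u Hu]. exists (Rmax u b + 1). pose proof (Rmax_l u b). pose proof (Rmax_r u b).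
        split. apply Hdom. lra. apply Hu. lra.
      * split.
        -- intros P HP. destruct (Hx P HP) as [u Hu]. exists u. intros s Hs. apply Hu. lra.
        -- intros P [y HP]. destruct (Ha y) as [u Hu]. exists u. intros s Hs Ds. apply HP.
           apply Hu; auto. lra.
  - split.
    + exists (sg * Z b). intros p Hp. apply (surface_rep rep) in Hp.
      destruct Hp as (s & Hs & _ & ->). specialize (Hzb s Hs). lra.
    + intros y. destruct (Hz y) as [u Hu].
      destruct (Hu (u - sg)) as [H1 H2]. { destruct Hsg; subst sg; lra. }
      exists (X (u - sg), 0, Z (u - sg)). split; auto.
      apply (surface_rep rep). exists (u - sg). split; auto.
      unfold c1, c2, c3; cbn [fst snd]. split; auto. ring.
Qed.

End Types.

(** * Singular boundary points *)

(* An interval approaches each of its ends from one side: from below when [sg = 1]. *)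
Lemma end_side (D : R -> Prop) (e : Rbar) :
  convex D -> is_end D e -> exists sg, (sg = 1 \/ sg = -1) /\
  (forall P, within D (Rbar_locally e) P ->
     exists m, D m /\ forall s, D s -> 0 < sg * (s - m) -> P s) /\
  (forall m, D m -> within D (Rbar_locally e) (fun s => 0 < sg * (s - m))).
Proof.
  intros cD [Hn Hf]. destruct e as [e| |].
  - assert (HnD : ~ D e) by now apply Hn.
    destruct (Hf (fun _ => True)) as (s0 & Hs0 & _). { apply filter_true. }
    assert (Hside : exists sg, (sg = 1 \/ sg = -1) /\ forall s, D s -> 0 < sg * (e - s)).
    { destruct (Rtotal_order s0 e) as [H | [-> | H]]; [exists 1 | now elim HnD | exists (-1)];
        (split; [auto |]); intros s Hs.
      - destruct (Rlt_or_le s e); [lra |]. exfalso. apply HnD. apply (cD s0 s); auto. lra.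
      - destruct (Rlt_or_le e s); [lra |]. exfalso. apply HnD. apply (cD s s0); auto. lra. }
    destruct Hside as (sg & Hsg & Hside). exists sg. split; auto. split.
    + intros P [d Hd]. destruct (Hf (ball e d)) as (m & Hm & Hb). { apply locally_ball. }
      exists m. split; auto. intros s Hs Hms. apply Hd; auto. specialize (Hside s Hs).
      change (Rabs (m - e) < d) in Hb. change (Rabs (s - e) < d).
      apply Rabs_def2 in Hb. apply Rabs_def1; destruct Hsg; subst sg; lra.
    + intros m Hm. exists (mkposreal _ (Hside m Hm)). intros s Hs _.
      change (Rabs (s - e) < sg * (e - m)) in Hs. apply Rabs_def2 in Hs.
      destruct Hsg; subst sg; lra.
  - exists 1. split; auto. split.
    + intros P [M HM]. destruct (Hf (fun s => M < s)) as (m & Hm & Hb). { now exists M. }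
      exists m. split; auto. intros s Hs Hms. apply HM; auto. lra.
    + intros m _. exists m. intros s Hs _. lra.
  - exists (-1). split; auto. split.
    + intros P [M HM]. destruct (Hf (fun s => s < M)) as (m & Hm & Hb). { now exists M. }
      exists m. split; auto. intros s Hs Hms. apply HM; auto. lra.
    + intros m _. exists m. intros s Hs _. lra.
Qed.

Lemma end_proper (D : R -> Prop) (e : Rbar) : is_end D e -> ProperFilter' (within D (Rbar_locally e)).
Proof.
  intros [_ Hf]. constructor.
  - intros H. destruct (Hf _ H) as (s & Hs & H'). auto.
  - apply within_filter, Rbar_locally_filter.
Qed.

(** The height is strictly monotone along the profile, and its limit [h] at the end lies strictly
    beyond the height of every parameter [m]. A family of points whose heights tend to [h] must
    therefore pass every [m]. *)
Lemma filterlim_toward {T : Type} (F : (T -> Prop) -> Prop) (g : profile) (e : Rbar) (h : R)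
    (f : T -> R) :
  Filter F -> convex (dom g) -> is_end (dom g) e ->
  (forall s t, dom g s -> dom g t -> s < t -> zc g s < zc g t) ->
  filterlim (zc g) (toward g e) (locally h) ->
  F (fun w => dom g (f w)) -> filterlim (fun w => zc g (f w)) F (locally h) ->
  filterlim f F (toward g e).
Proof.
  intros FF cD He inc Hz HfD Hfz P HP.
  pose proof (end_proper _ _ He) as PF. pose proof He as [_ Hfr].
  destruct (end_side _ _ cD He) as (sg & Hsg & H1 & H2). destruct (H1 P HP) as (m & Hm & HmP).
  assert (inc' : forall s t, dom g s -> dom g t -> 0 < sg * (t - s) -> 0 < sg * (zc g t - zc g s)).
  { intros s t Hs Ht H. destruct Hsg; subst sg;
      [specialize (inc s t Hs Ht) | specialize (inc t s Ht Hs)]; lra. }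
  destruct (Hfr _ (H2 m Hm)) as (m' & Hm' & Hmm'). specialize (Hmm' Hm').
  pose proof (inc' m m' Hm Hm' Hmm') as Hinc.
  assert (Hopen : forall c y, 0 < sg * (y - c) -> locally y (fun u => 0 < sg * (u - c))).
  { intros c y Hy. apply (open_comp (fun u => sg * (u - c)) (fun v => 0 < v)); auto.
    - intros u _. apply (continuous_of_ex_derive (fun u => sg * (u - c))). auto_derive; auto.
    - apply open_gt. }
  (* A second parameter [m'] beyond [m] provides strictness: otherwise the heights near the end
     would fall short of that of [m'], against monotonicity. *)
  assert (Hh : 0 < sg * (h - zc g m)).
  { destruct (Rlt_or_le 0 (sg * (h - zc g m'))) as [Hlt | Hle]; [lra |].
    apply Rnot_le_lt. intros Hle'.
    assert (Hz' : within (dom g) (Rbar_locally e) (fun s => 0 < - sg * (zc g s - zc g m'))).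
    { apply (Hz (fun y => 0 < - sg * (y - zc g m'))).
      apply (open_comp (fun u => - sg * (u - zc g m')) (fun v => 0 < v)).
      - intros u _. apply (continuous_of_ex_derive (fun u => - sg * (u - zc g m'))).
        auto_derive; auto.
      - apply open_gt.
      - lra. }
    pose proof (filter_and (F := within (dom g) (Rbar_locally e)) _ _ Hz' (H2 m' Hm')) as Hz2.
    destruct (Hfr (fun s => dom g s -> 0 < - sg * (zc g s - zc g m') /\ 0 < sg * (s - m')) Hz2)
      as (s & Hs & Hs').
    destruct (Hs' Hs) as [Ha Hb]. specialize (inc' m' s Hm' Hs Hb). lra. }
  assert (Hfz' : F (fun w => 0 < sg * (zc g (f w) - zc g m))) by exact (Hfz _ (Hopen _ _ Hh)).
  change (F (fun w => P (f w))).
  generalize (filter_and _ _ HfD Hfz'). apply filter_imp. intros w [Hw1 Hw2].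
  apply HmP; auto. apply Rnot_le_lt. intros Hle.
  destruct (Req_dec m (f w)) as [E | Hne].
  - rewrite <- E in Hw2. lra.
  - enough (0 < sg * (zc g m - zc g (f w))) by lra. apply inc'; auto.
    destruct Hsg; subst sg; lra.
Qed.

Lemma filterlim_R_unique {T : Type} (F : (T -> Prop) -> Prop) (f : T -> R) (x y : R) :
  ProperFilter' F -> filterlim f F (locally x) -> filterlim f F (locally y) -> x = y.
Proof.
  intros FF. exact (filterlim_locally_unique (K := R_AbsRing) (V := R_NormedModule) f x y).
Qed.

Section Singular.

Variables (K : R -> R) (g : profile) (J : R -> Prop) (X V Z : R -> R).
Hypothesis k_cont : forall t, continuous (kext K) t.
Hypothesis k_pos : forall t, 0 < kext K t.
Hypothesis rep : represented K g J X V Z.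
Hypothesis cD : convex (dom g).
Variables (e : Rbar) (r h : R).
Hypothesis Hbc : boundary_circumference g e r h.

Let zc_increasing (s t : R) : dom g s -> dom g t -> s < t -> zc g s < zc g t.
Proof.
  intros Hs Ht. destruct (rep_eq rep s Hs) as (_ & _ & -> & _).
  destruct (rep_eq rep t Ht) as (_ & _ & -> & _).
  apply (Z_increasing rep (dom g)); auto.
  - apply (rep_J rep).
  - intros u. apply locally_singleton.
Qed.

Lemma closure_boundary_circumference (p : R3) : circumference r h p -> closure (surface g) p.
Proof.
  destruct Hbc as ((_ & Hfr) & Hr & Hx & Hz & _).
  intros [E1 E2] P HP. destruct p as [[a b] c].
  unfold c1, c2, c3 in E1, E2. cbn [fst snd] in E1, E2. subst c.
  destruct (polar a b r ltac:(lra) E1) as (phi & -> & ->).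
  assert (FF : Filter (toward g e)) by (apply within_filter, Rbar_locally_filter).
  assert (Hlim : filterlim (fun s => (xc g s * cos phi, xc g s * sin phi, zc g s)) (toward g e)
                   (locally ((r * cos phi, r * sin phi, h) : R3))).
  { apply filterlim_pair_locally; auto.
    apply (filterlim_pair_locally (U := R_UniformSpace) (V := R_UniformSpace)); auto;
      apply filterlim_Rmult; auto; apply filterlim_const. }
  destruct (Hfr _ (Hlim P HP)) as (s & Hs & Hps).
  exists (xc g s * cos phi, xc g s * sin phi, zc g s). split; auto.
  exists (s, phi). split; auto.
Qed.

Variables (U : R2 -> Prop) (Y : R2 -> R3).
Hypothesis imm : immersed_surface U Y.

Let oU : open U.
Proof. apply imm. Qed.

(** On the surface these two functions are [X ^ 2] and [Z] of the profile parameter. As polynomials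
    in the coordinates of the immersion they are of class C^2 up to and including [q]. *)
Let P (w : R2) : R := c1 (Y w) * c1 (Y w) + c2 (Y w) * c2 (Y w).
Let H3 (w : R2) : R := c3 (Y w).

Let CP : Ck 2 U P.
Proof.
  destruct imm as (_ & (C1 & C2 & _) & _).
  apply (Ck_plus 2 U (fun w => c1 (Y w) * c1 (Y w)) (fun w => c2 (Y w) * c2 (Y w))); auto.
  - apply (Ck_mult 2 U (fun w => c1 (Y w)) (fun w => c1 (Y w))); auto.
  - apply (Ck_mult 2 U (fun w => c2 (Y w)) (fun w => c2 (Y w))); auto.
Qed.

Let CH : Ck 2 U H3.
Proof. apply imm. Qed.

Variables (q : R2) (W : R2 -> Prop).
Hypothesis Uq : U q.
Hypothesis Eq : circumference r h (Y q).
Hypothesis oW : open W.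
Hypothesis clW : closure W q.
Hypothesis HW : forall w, W w -> U w /\ surface g (Y w).

(** Off the axis the profile parameter is interior to [dom g], hence differentiable as a function of
    the height. Near [q], which maps to distance [r > 0] from the axis, [W'] and [W] agree. *)
Let W' (w : R2) : Prop := W w /\ 0 < P w.

Let oW' : open W'.
Proof.
  intros w [Hw Hp]. apply filter_and. now apply oW.
  apply (proj1 CP w (proj1 (HW w Hw)) (fun y => 0 < y)). now apply (open_gt 0).
Qed.

Let Pq : P q = r ^ 2.
Proof. destruct Eq as [E _]. unfold P. rewrite <- E. ring. Qed.

Let r_pos : 0 < r.
Proof. apply Hbc. Qed.

Let F : (R2 -> Prop) -> Prop := within W' (locally q).

Let FF : ProperFilter' F.
Proof.
  constructor.
  - intros H. assert (Hp : locally q (fun w => 0 < P w)).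
    { apply (proj1 CP q Uq (fun y => 0 < y)). apply (open_gt 0). rewrite Pq. nra. }
    assert (Hl : locally q (fun w => (W' w -> False) /\ 0 < P w)).
    { apply filter_and; [exact H | exact Hp]. }
    destruct (clW _ Hl) as (w & (H1 & H2) & Hw). apply H1. now split.
  - apply within_filter, locally_filter.
Qed.

(** Here [sg] is [sin th] as a function of the profile parameter, not a sign as in the shapes
    above. *)
Let sg (s : R) : R := sqrt (1 - V s ^ 2).

(* The parameter [s] of the profile, as a function on the part of [Y] lying in the surface. *)
Lemma profile_parameter : exists T : R2 -> R, forall w, W' w ->
  dom g (T w) /\ 0 < X (T w) /\ P w = X (T w) ^ 2 /\ H3 w = Z (T w) /\
  forall v, is_derive (fun t : R => T (plus w (scal t v))) 0 (dder v H3 w / sg (T w)).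
Proof.
  set (D := interior (dom g)).
  assert (HD : forall s, D s -> dom g s) by (intros s; apply locally_singleton).
  assert (oD : open D) by apply open_interior.
  assert (cD' : convex D) by now apply convex_of_interior.
  destruct (inverse_of_increasing D Z sg oD cD') as [ze Hze].
  - intros s Hs. apply (rep_height rep), (rep_J rep), HD, Hs.
  - intros s Hs. apply (rep_speed_pos rep), HD, Hs.
  - assert (Hsurf : forall w, W' w -> exists s, D s /\ 0 < X s /\ P w = X s ^ 2 /\ H3 w = Z s).
    { intros w [Hw Hp]. destruct (HW w Hw) as [_ Hs]. apply (surface_rep rep) in Hs.
      destruct Hs as (s & Hs & E1 & E2). exists s.
      assert (E : P w = X s ^ 2) by (rewrite <- E1; unfold P; ring).
      assert (Hx : 0 < X s).
      { pose proof (rep_X_nonneg rep s Hs). nra. }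
      split; auto. now apply (rep_dom_locally rep). }
    exists (fun w => ze (H3 w)). intros w Hw.
    destruct (Hsurf w Hw) as (s & Hs & Hx & E1 & E2). destruct (Hze s Hs) as [E3 d].
    rewrite E2, E3. do 4 (split; auto). intros v.
    replace (dder v H3 w / sg s) with (dder v H3 w * / sg s) by reflexivity.
    apply (is_derive_comp ze (fun t : R => H3 (plus w (scal t v)))).
    + replace (plus w (scal (0 : R) v)) with w by (symmetry; exact (line_0 w v)).
      rewrite E2. exact d.
    + exact (dder_correct H3 v w (proj1 (proj2 CH v) w (proj1 (HW w (proj1 Hw))))).
Qed.

(** At [q] the differentials of the height and of the squared distance to the axis both vanish. At
    distance [r > 0] from the axis this leaves only the direction of the circumference for tangent
    vectors, so their cross product is zero, against immersion. *)
Lemma not_extending : False.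
Proof.
  destruct profile_parameter as [T HT].
  destruct Hbc as (He & _ & Hxlim & Hzlim & Hthlim).
  destruct (rep_flow rep) as (_ & _ & Hfl).
  assert (WU : forall w, W' w -> U w) by (intros w [Hw _]; now apply HW).
  assert (FFil : Filter F) by (apply within_filter, locally_filter).
  assert (HFU : forall f : R2 -> R, continuous f q -> filterlim f F (locally (f q))).
  { intros f Hf. unfold F. apply filterlim_restrict; [apply locally_filter | exact Hf]. }
  assert (HFW : F W').
  { unfold F, within. apply filter_forall. auto. }
  assert (Hext : forall (f f' : R2 -> R) l, (forall w, W' w -> f w = f' w) ->
    filterlim f F l -> filterlim f' F l).
  { intros f f' l E. apply filterlim_ext_loc. revert HFW. apply filter_imp. exact E. }
  (* As [w] tends to [q] the height tends to [h], so the profile parameter tends to the end; the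
     limits of [X], [V] and [sin th] along the surface follow. *)
  assert (HTlim : filterlim T F (toward g e)).
  { apply filterlim_toward with h; auto.
    - revert HFW. apply filter_imp. intros w Hw. now apply HT.
    - apply (Hext H3).
      + intros w Hw. destruct (HT w Hw) as (Hd & _ & _ & -> & _).
        symmetry. now apply (rep_eq rep).
      + destruct Eq as [_ E]. rewrite <- E. apply (HFU H3). exact (proj1 CH q Uq). }
  assert (Xlim : filterlim (fun w => X (T w)) F (locally r)).
  { apply (Hext (fun w => xc g (T w))).
    - intros w Hw. apply (rep_eq rep). now apply HT.
    - exact (filterlim_comp _ _ _ T (xc g) F _ _ HTlim Hxlim). }
  assert (Hep : exists ep, (ep = 1 \/ ep = -1) /\
    filterlim (fun w => V (T w)) F (locally ep)).
  { assert (Hc : forall l, filterlim (th g) (toward g e) (locally l) ->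
      filterlim (fun w => V (T w)) F (locally (cos l))).
    { intros l Hl. apply (Hext (fun w => cos (th g (T w)))).
      - intros w Hw. apply (rep_eq rep). now apply HT.
      - apply (filterlim_comp _ _ _ (fun w => th g (T w)) cos F (locally l)).
        + exact (filterlim_comp _ _ _ T (th g) F _ _ HTlim Hl).
        + apply continuous_cos. }
    destruct Hthlim as [H | H]; apply Hc in H.
    - exists 1. rewrite cos_0 in H. auto.
    - exists (-1). rewrite cos_PI in H. auto. }
  destruct Hep as (ep & Hep & Vlim).
  assert (Slim : filterlim (fun w => sg (T w)) F (locally 0)).
  { replace 0 with (sqrt (1 - ep ^ 2))
      by (replace (1 - ep ^ 2) with 0 by (destruct Hep; subst; ring); apply sqrt_0).
    apply (filterlim_comp _ _ _ (fun w => V (T w)) (fun v => sqrt (1 - v ^ 2)) F (locally ep)); auto.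
    apply (continuous_sqrt_comp (fun v => 1 - v ^ 2)).
    apply (continuous_of_ex_derive (fun v => 1 - v ^ 2)). auto_derive; auto. }
  assert (Klim : filterlim (fun w => kext K (V (T w))) F (locally (kext K ep))).
  { apply (filterlim_comp _ _ _ (fun w => V (T w)) (kext K) F (locally ep)); auto. apply k_cont. }
  assert (Spos : forall w, W' w -> 0 < sg (T w)).
  { intros w Hw. apply (rep_speed_pos rep). now apply HT. }
  assert (Ssq : forall w, W' w -> sg (T w) ^ 2 = 1 - V (T w) ^ 2).
  { intros w Hw. unfold sg. rewrite pow2_sqrt; auto.
    pose proof (rep_V_bound rep (T w)) as Hv. specialize (Hv (proj1 (HT w Hw))). nra. }
  assert (dT : forall (f : R -> R) l w v, W' w -> is_derive f (T w) l ->
    is_derive (fun t : R => f (T (plus w (scal t v)))) 0 (dder v H3 w / sg (T w) * l)).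
  { intros f l w v Hw d. destruct (HT w Hw) as (_ & _ & _ & _ & dTw).
    apply (is_derive_comp f (fun t : R => T (plus w (scal t v)))).
    - replace (plus w (scal (0 : R) v)) with w by (symmetry; exact (line_0 w v)). exact d.
    - apply dTw. }
  assert (dX : forall w, W' w -> is_derive X (T w) (V (T w))).
  { intros w Hw. apply (proj1 (Hfl (T w) (rep_J rep _ (proj1 (HT w Hw))))). }
  assert (dV : forall w, W' w -> is_derive V (T w) (X (T w) * kext K (V (T w)))).
  { intros w Hw. apply (proj2 (Hfl (T w) (rep_J rep _ (proj1 (HT w Hw))))). }
  (* The first-order relation; its limit at [q], where [sg] tends to 0, makes the tangent
     plane of [Y] horizontal. *)
  assert (E1 : forall v w, W' w ->
    sg (T w) * dder v P w = 2 * (X (T w) * V (T w)) * dder v H3 w).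
  { intros v w Hw. rewrite (dder_ext W' P (fun w => X (T w) ^ 2)); auto.
    2: { intros w' Hw'. now apply HT. }
    rewrite (dder_unique _ v w (dder v H3 w / sg (T w) * (2 * V (T w) * X (T w)))).
    - specialize (Spos w Hw). field. lra.
    - apply (dT (fun s => X s ^ 2)); auto. evar_last.
      + apply is_derive_pow. apply dX, Hw.
      + simpl. ring. }
  (* [E1] differentiated along [v], with [dder v H3] eliminated by [E1] and denominators
     cleared; at [q] only the curvature term [kext K * (dder v P)^2] survives. *)
  assert (E2 : forall v w, W' w ->
    2 * X (T w) ^ 2 * V (T w) ^ 2 *
      (- (kext K (V (T w)) * dder v P w ^ 2) + 2 * (sg (T w) ^ 2 * dder v (dder v P) w))
    = 2 * (sg (T w) ^ 2 * (V (T w) ^ 2 + X (T w) ^ 2 * kext K (V (T w))) * dder v P w ^ 2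
           + 4 * X (T w) ^ 3 * V (T w) ^ 3 * sg (T w) * dder v (dder v H3) w)).
  { intros v w Hw. pose proof (Spos w Hw) as Hs. pose proof (E1 v w Hw) as E1w.
    pose proof (dder_ext W' (fun w => sg (T w) * dder v P w)
      (fun w => 2 * (X (T w) * V (T w)) * dder v H3 w) v w oW' Hw (E1 v)) as Ed.
    assert (dS : is_derive sg (T w) (- (V (T w) * (X (T w) * kext K (V (T w)))) / sg (T w))).
    { evar_last.
      - apply (is_derive_sqrt (fun s => 1 - V s ^ 2)).
        + apply (is_derive_minus (fun _ => 1) (fun s => V s ^ 2)). apply is_derive_const.
          apply is_derive_pow. exact (dV w Hw).
        + rewrite <- Ssq by auto. nra.
      - fold (sg (T w)). unfold minus, plus, opp, zero; simpl. field. lra. }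
    assert (dXV : is_derive (fun s => 2 * (X s * V s)) (T w)
      (2 * (V (T w) * V (T w) + X (T w) * (X (T w) * kext K (V (T w)))))).
    { apply is_derive_scal. apply (is_derive_mult X V); auto. intros; apply Rmult_comm. }
    pose proof (dT _ _ w v Hw dS) as dS'. pose proof (dT _ _ w v Hw dXV) as dXV'.
    assert (exP : ex_derive (fun t : R => dder v P (plus w (scal t v))) 0).
    { apply (proj2 (proj2 (proj2 CP v)) v). now apply WU. }
    assert (exH : ex_derive (fun t : R => dder v H3 (plus w (scal t v))) 0).
    { apply (proj2 (proj2 (proj2 CH v)) v). now apply WU. }
    rewrite (dder_mult (fun w => sg (T w)) (dder v P)) in Ed; [| now eexists; apply dS' | auto].
    rewrite (dder_mult (fun w => 2 * (X (T w) * V (T w))) (dder v H3)) in Ed;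
      [| now eexists; apply dXV' | auto].
    rewrite (dder_unique (fun w => sg (T w)) v w _ dS') in Ed.
    rewrite (dder_unique (fun w => 2 * (X (T w) * V (T w))) v w _ dXV') in Ed.
    set (x := X (T w)) in *. set (c := V (T w)) in *. set (s := sg (T w)) in *.
    set (k := kext K c) in *. set (Pv := dder v P w) in *. set (Zv := dder v H3 w) in *.
    set (Pvv := dder v (dder v P) w) in *. set (Zvv := dder v (dder v H3) w) in *.
    (* The directional derivative of the parameter [T]. Both [Zv] and [Pv] are multiples of it, so
       after substitution the claim becomes a polynomial identity. *)
    set (Tv := Zv / s) in *.
    assert (EZ : Zv = s * Tv) by (unfold Tv; field; lra).
    assert (EP : Pv = 2 * x * c * Tv).
    { apply Rmult_eq_reg_l with s; [| lra]. rewrite E1w, EZ. ring. }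
    assert (Ed' : Tv * - (c * (x * k)) * Pv + s ^ 2 * Pvv
      = s * (Tv * (2 * (c * c + x * (x * k))) * Zv + 2 * (x * c) * Zvv)).
    { rewrite <- Ed. field. lra. }
    clear Ed dS dS' dXV dXV' exP exH E1w.
    assert (EPP : s ^ 2 * Pvv = Tv * (c * (x * k)) * Pv
      + s * (Tv * (2 * (c * c + x * (x * k))) * Zv + 2 * (x * c) * Zvv)) by lra.
    rewrite EPP, EP, EZ. ring. }
  assert (HZ0 : forall v, dder v H3 q = 0).
  { intros v.
    assert (L1 : filterlim (fun w => sg (T w) * dder v P w) F (locally (0 * dder v P q))).
    { apply filterlim_Rmult; auto. apply HFU. apply (proj1 (proj2 (proj2 CP v))); auto. }
    assert (L2 : filterlim (fun w => sg (T w) * dder v P w) F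
      (locally (2 * (r * ep) * dder v H3 q))).
    { apply (Hext (fun w => 2 * (X (T w) * V (T w)) * dder v H3 w)).
      - intros w Hw. symmetry. now apply E1.
      - repeat (apply filterlim_Rmult; auto); try apply filterlim_const.
        apply HFU. apply (proj1 (proj2 (proj2 CH v))); auto. }
    pose proof (filterlim_R_unique _ _ _ _ FF L1 L2) as E.
    destruct Hep; subst ep; nra. }
  assert (HP0 : forall v, dder v P q = 0).
  { intros v.
    assert (lP : filterlim (fun w => dder v P w) F (locally (dder v P q))).
    { apply HFU. apply (proj1 (proj2 (proj2 CP v))); auto. }
    assert (lPP : filterlim (fun w => dder v (dder v P) w) F (locally (dder v (dder v P) q))).
    { apply HFU. apply (proj1 (proj2 (proj2 (proj2 (proj2 CP v)) v))); auto. }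
    assert (lHH : filterlim (fun w => dder v (dder v H3) w) F (locally (dder v (dder v H3) q))).
    { apply HFU. apply (proj1 (proj2 (proj2 (proj2 (proj2 CH v)) v))); auto. }
    assert (lpow : forall (f : R2 -> R) l n, filterlim f F (locally l) ->
      filterlim (fun w => f w ^ n) F (locally (l ^ n))).
    { intros f l n Hl. induction n as [|n IH]; simpl. apply filterlim_const.
      apply filterlim_Rmult; auto. }
    set (A := fun w => 2 * X (T w) ^ 2 * V (T w) ^ 2 *
      (- (kext K (V (T w)) * dder v P w ^ 2) + 2 * (sg (T w) ^ 2 * dder v (dder v P) w))).
    assert (L1 : filterlim A F (locally (2 * r ^ 2 * ep ^ 2 *
      (- (kext K ep * dder v P q ^ 2) + 2 * (0 ^ 2 * dder v (dder v P) q))))).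
    { unfold A. apply filterlim_Rmult; auto.
      - repeat (apply filterlim_Rmult; auto); apply filterlim_const.
      - apply filterlim_Rplus; auto.
        + apply (filterlim_comp _ _ _ (fun w => kext K (V (T w)) * dder v P w ^ 2) Ropp F
            (locally (kext K ep * dder v P q ^ 2))).
          * apply filterlim_Rmult; auto.
          * apply (filterlim_opp (kext K ep * dder v P q ^ 2)).
        + repeat (apply filterlim_Rmult; auto); apply filterlim_const. }
    assert (L2 : filterlim A F (locally (2 * (0 ^ 2 * (ep ^ 2 + r ^ 2 * kext K ep) * dder v P q ^ 2
           + 4 * r ^ 3 * ep ^ 3 * 0 * dder v (dder v H3) q)))).
    { apply (Hext (fun w => 2 * (sg (T w) ^ 2 * (V (T w) ^ 2 + X (T w) ^ 2 * kext K (V (T w)))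
             * dder v P w ^ 2
             + 4 * X (T w) ^ 3 * V (T w) ^ 3 * sg (T w) * dder v (dder v H3) w))).
      - intros w Hw. symmetry. now apply E2.
      - apply filterlim_Rmult; auto. apply filterlim_const.
        apply filterlim_Rplus; auto.
        + apply filterlim_Rmult; auto. apply filterlim_Rmult; auto.
          apply filterlim_Rplus; auto. apply filterlim_Rmult; auto.
        + repeat (apply filterlim_Rmult; auto); apply filterlim_const. }
    pose proof (filterlim_R_unique _ _ _ _ FF L1 L2) as E.
    assert (E' : r ^ 2 * kext K ep * dder v P q ^ 2 = 0) by (destruct Hep; subst ep; lra).
    pose proof (k_pos ep). assert (Hrk : 0 < r ^ 2 * kext K ep) by (apply Rmult_lt_0_compat; nra).
    apply Rmult_integral in E'. destruct E' as [E' | E']; [lra |]. nra. }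
  destruct imm as (_ & (C1 & C2 & _) & Hcross). apply (Hcross q Uq).
  assert (HPv : forall v, 2 * (c1 (Y q) * dder v (fun w => c1 (Y w)) q
                             + c2 (Y q) * dder v (fun w => c2 (Y w)) q) = 0).
  { intros v.
    pose proof (proj1 (proj2 C1 v) q Uq) as d1. pose proof (proj1 (proj2 C2 v) q Uq) as d2.
    set (dd1 := dder v (fun w => c1 (Y w)) q). set (dd2 := dder v (fun w => c2 (Y w)) q).
    assert (E : dder v P q = (dd1 * c1 (Y q) + c1 (Y q) * dd1) + (dd2 * c2 (Y q) + c2 (Y q) * dd2)).
    { transitivity (dder v (fun w => c1 (Y w) * c1 (Y w)) q + dder v (fun w => c2 (Y w) * c2 (Y w)) q).
      - apply (dder_plus (fun w => c1 (Y w) * c1 (Y w)) (fun w => c2 (Y w) * c2 (Y w)) v q).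
        + exact (ex_derive_mult (fun t : R => c1 (Y (plus q (scal t v))))
            (fun t : R => c1 (Y (plus q (scal t v)))) 0 d1 d1).
        + exact (ex_derive_mult (fun t : R => c2 (Y (plus q (scal t v))))
            (fun t : R => c2 (Y (plus q (scal t v)))) 0 d2 d2).
      - f_equal.
        + exact (dder_mult (fun w => c1 (Y w)) (fun w => c1 (Y w)) v q d1 d1).
        + exact (dder_mult (fun w => c2 (Y w)) (fun w => c2 (Y w)) v q d2 d2). }
    rewrite HP0 in E. lra. }
  pose proof (HPv (1, 0)) as Hu. pose proof (HPv (0, 1)) as Hv.
  pose proof (HZ0 (1, 0)) as Zu. pose proof (HZ0 (0, 1)) as Zv.
  destruct Eq as [E _]. unfold H3 in Zu, Zv.
  unfold cross, du, dv, pder.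
  set (a := dder (1, 0) (fun w => c1 (Y w)) q) in *. set (b := dder (1, 0) (fun w => c2 (Y w)) q) in *.
  set (a' := dder (0, 1) (fun w => c1 (Y w)) q) in *. set (b' := dder (0, 1) (fun w => c2 (Y w)) q) in *.
  unfold c1 at 1 2 3 4, c2 at 1 2 3 4, c3; cbn [fst snd].
  change (fun w : R2 => snd (Y w)) with (fun w : R2 => c3 (Y w)).
  rewrite Zu, Zv.
  (* The horizontal vectors [(a, b)] and [(a', b')] are orthogonal to [(y1, y2)], which has length
     [r > 0], so they are parallel. The identity writes [r ^ 2] times their determinant as a
     combination of the two orthogonality relations. *)
  assert (Hdet : a * b' - b * a' = 0).
  { set (y1 := c1 (Y q)) in *. set (y2 := c2 (Y q)) in *.
    assert (H : (y1 ^ 2 + y2 ^ 2) * (a * b' - b * a') = 0).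
    { replace ((y1 ^ 2 + y2 ^ 2) * (a * b' - b * a'))
        with (((y1 * b' - y2 * a') * (2 * (y1 * a + y2 * b))
               + (y2 * a - y1 * b) * (2 * (y1 * a' + y2 * b'))) / 2) by field.
      rewrite Hu, Hv. field. }
    rewrite E in H. apply Rmult_integral in H. destruct H as [H | H]; auto. nra. }
  f_equal; [f_equal |]; auto; ring.
Qed.

End Singular.

(** * Classification *)

Section Classification.

Variable K : R -> R.
Hypothesis k_cont : forall t, continuous (kext K) t.
Hypothesis k_pos : forall t, 0 < kext K t.

(** An orbit other than the constant one has a point off the equilibrium, whose level and sign of
    [v] select the canonical curve. In the first and third cases the point itself is recorded, for
    later comparison of surfaces by level. *)
Lemma surface_classification (g : profile) : rotational_K_surface K g ->
  exists J X V Z, represented K g J X V Z /\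
  ((exists x0, 0 < x0 /\ waist_shape J X V (dom g) x0 /\
      exists s, dom g s /\ xc g s ^ 2 - energy (kext K) (cos (th g s)) = x0 ^ 2) \/
   (exists nu0, -1 < nu0 < 1 /\ nu0 <> 0 /\ axis_shape J X V (dom g) nu0) \/
   (exists sg, (sg = 1 \/ sg = -1) /\ asymptotic_shape J X V (dom g) sg /\
      exists s, dom g s /\ xc g s ^ 2 - energy (kext K) (cos (th g s)) = 0 /\
        0 < cos (th g s) * sg)).
Proof.
  intros Hg. pose proof Hg as [[[_ Hsol] _] [_ Hnt]].
  assert (Hs : exists s, dom g s /\ (xc g s <> 0 \/ cos (th g s) <> 0)).
  { apply NNPP. intros Hno. apply Hnt. intros s Hs.
    destruct (Hsol s Hs) as (_ & Hth & _).
    destruct (Req_dec (xc g s) 0) as [E1 |]; [| exfalso; apply Hno; eauto].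
    destruct (Req_dec (cos (th g s)) 0) as [E2 |]; [| exfalso; apply Hno; eauto].
    split; auto. rewrite <- (acos_cos (th g s)), E2 by lra. apply acos_0. }
  destruct Hs as (s & Hs & Hne). destruct (Hsol s Hs) as (Hx & Hth & _).
  destruct (phase_curve_classification (kext K) (xc g s) (cos (th g s)))
    as [(x0 & H0 & HQ) | [(nu0 & H0 & H1 & HQ) | (sg & H0 & HQ)]];
    auto using cos_bound_strict.
  - destruct (canonical_waist (kext K) k_cont k_pos x0 H0) as (J & X & V & Hcan & Hsh).
    destruct (surface_of_canonical K J X V _ g s Hcan Hg Hs HQ) as (c & Z & Hrep).
    do 4 eexists. split; [exact Hrep |]. left. exists x0. split; auto. split; eauto.
    revert Hsh. apply waist_shape_shift. apply (rep_dom Hrep).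
  - destruct (canonical_axis (kext K) nu0 k_cont k_pos H0 H1) as (J & X & V & Hcan & Hsh).
    destruct (surface_of_canonical K J X V _ g s Hcan Hg Hs HQ) as (c & Z & Hrep).
    do 4 eexists. split; [exact Hrep |]. right; left. exists nu0. do 2 (split; auto).
    revert Hsh. apply axis_shape_shift. apply (rep_dom Hrep).
  - destruct (canonical_asymptotic (kext K) sg k_cont k_pos H0) as (J & X & V & Hcan & Hsh).
    destruct (surface_of_canonical K J X V _ g s Hcan Hg Hs HQ) as (c & Z & Hrep).
    do 4 eexists. split; [exact Hrep |]. right; right. exists sg. split; auto. split; eauto.
    revert Hsh. apply asymptotic_shape_shift. apply (rep_dom Hrep).
Qed.

Lemma surface_regular (g : profile) (s : R) : rotational_K_surface K g -> locally s (dom g) ->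
  0 < xc g s /\ 0 < th g s < PI /\
  is_derive (xc g) s (cos (th g s)) /\
  is_derive (th g) s (xc g s * K (cos (th g s)) / sin (th g s)) /\
  is_derive (zc g) s (sin (th g s)).
Proof.
  intros Hg Hs. pose proof (locally_singleton _ _ Hs) as Hs'.
  destruct (surface_classification g Hg) as (J & X & V & Z & Hrep & _).
  destruct Hg as [[[_ Hsol] _] [Hz _]]. destruct (Hsol s Hs') as (_ & Hth & dx & dth).
  split.
  - destruct (rep_eq Hrep s Hs') as (-> & _).
    exact (rep_interior_pos Hrep s Hs).
  - split; auto. repeat split; eapply is_derive_of_deriv_within; eauto.
Qed.

(** The common source of uniqueness: two surfaces with points satisfying the same [Q] are shifts of
    one canonical curve. *)
Lemma canonical_translate (J : R -> Prop) (X V : R -> R) (Q : R -> R -> Prop) (g g' : profile)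
    (s s' : R) :
  canonical (kext K) J X V Q -> rotational_K_surface K g -> rotational_K_surface K g' ->
  dom g s -> Q (xc g s) (cos (th g s)) -> dom g' s' -> Q (xc g' s') (cos (th g' s')) ->
  vertical_translate (surface g) (surface g').
Proof.
  intros Hcan Hg Hg' Hs HQ Hs' HQ'.
  destruct (surface_of_canonical K J X V Q g s Hcan Hg Hs HQ) as (c & Z & Hrep).
  destruct (surface_of_canonical K J X V Q g' s' Hcan Hg' Hs' HQ') as (c' & Z' & Hrep').
  now apply (surface_translate K J X V Z Z' g g' c c' s).
Qed.

Lemma canonical_profile (J : R -> Prop) (X V : R -> R) (Q : R -> R -> Prop) :
  canonical (kext K) J X V Q ->
  exists g, rotational_K_surface K g /\ exists s, dom g s /\ Q (xc g s) (cos (th g s)).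
Proof.
  intros Hcan. destruct (canonical_surface K J X V Q Hcan) as (g & Hg & Ed & Ex & Ev).
  exists g. split; auto.
  destruct (can_nontrivial Hcan) as (s & _ & Hs & _).
  exists s. rewrite Ed, Ex, Ev by (now rewrite Ed). split; auto.
  now apply (can_invariant Hcan).
Qed.

(** * Mutual exclusion of the types and uniqueness within each *)

Lemma waist_radius_le (g : profile) (x0 s : R) : waist_radius g x0 -> dom g s -> x0 <= xc g s.
Proof.
  intros (s0 & Hs0 & <- & H) Hs. destruct (Req_dec s s0) as [-> | Hne]; [lra |].
  now apply Rlt_le, H.
Qed.

Lemma waist_radius_unique (g : profile) (x0 x1 : R) :
  waist_radius g x0 -> waist_radius g x1 -> x0 = x1.
Proof.
  intros H0 H1. apply Rle_antisym.
  - pose proof H1 as (s1 & Hs1 & <- & _). now apply waist_radius_le.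
  - pose proof H0 as (s0 & Hs0 & <- & _). now apply waist_radius_le.
Qed.

Lemma waist_not_asymptotic (g : profile) (x0 : R) (e : Rbar) :
  0 < x0 -> waist_radius g x0 -> ~ asymptotic_to_axis g e.
Proof.
  intros Hx0 Hw ([_ Hf] & Hx & _).
  destruct (Hf _ (Hx _ (open_lt x0 0 Hx0))) as (s & Hs & H). specialize (H Hs). simpl in H.
  pose proof (waist_radius_le g x0 s Hw Hs). lra.
Qed.

(** The prolonged height is continuous on the compact interval between the axis and the rim, so the
    heights of an axis surface are bounded, whereas an asymptotic end requires unbounded ones. *)
Lemma axis_not_asymptotic (g : profile) (J : R -> Prop) (X V Z : R -> R) (nu0 : R) (e : Rbar) :
  represented K g J X V Z -> axis_shape J X V (dom g) nu0 -> ~ asymptotic_to_axis g e.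
Proof.
  intros Hrep (sg & a & b & S & Hsg & Hab & Ja & Jb & _ & _ & _ & _ & Hdom & _) ([_ Hf] & _ & Hz).
  assert (Hbd : exists B, forall s, dom g s -> Rabs (zc g s) <= B).
  { assert (Hcont : forall u, J u -> continuity_pt Z u).
    { intros u Hu. apply continuity_pt_filterlim. exact (rep_Z_continuous Hrep u Hu). }
    assert (cJ : convex J) by apply (rep_flow Hrep).
    assert (Hm : exists lo hi, lo <= hi /\ J lo /\ J hi /\ forall s, dom g s -> lo <= s <= hi).
    { destruct Hsg; subst sg; [exists a, b | exists b, a]; repeat split; auto; try lra;
        apply Hdom in H; lra. }
    destruct Hm as (lo & hi & Hle & Jlo & Jhi & Hin).
    destruct (continuity_ab_maj Z lo hi Hle) as (M & HM & _).
    { intros c Hc. apply Hcont. now apply (cJ lo hi). }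
    destruct (continuity_ab_min Z lo hi Hle) as (m & Hm & _).
    { intros c Hc. apply Hcont. now apply (cJ lo hi). }
    exists (Rabs (Z M) + Rabs (Z m)). intros s Hs.
    destruct (rep_eq Hrep s Hs) as (_ & _ & -> & _).
    specialize (HM s (Hin s Hs)). specialize (Hm s (Hin s Hs)).
    unfold Rabs. repeat destruct (Rcase_abs _); lra. }
  destruct Hbd as [B HB].
  assert (HP : Rbar_locally p_infty (fun y => B < y)) by (exists B; auto).
  destruct (Hf _ (Hz _ HP)) as (s & Hs & H). specialize (H Hs). simpl in H.
  specialize (HB s Hs). lra.
Qed.

Lemma waist_surfaces (x0 : R) : 0 < x0 -> exactly_one_surface K (waist_type x0).
Proof.
  intros Hx0.
  (* The type has to determine the level. On another positive level the waist radius differs; an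
     axis surface reaches radius 0, and an asymptotic one has arbitrarily small radii. *)
  assert (Hchar : forall g, rotational_K_surface K g ->
    ((exists s, dom g s /\ xc g s ^ 2 - energy (kext K) (cos (th g s)) = x0 ^ 2)
     <-> waist_type x0 g)).
  { intros g Hg. split.
    - intros (s & Hs & HQ).
      destruct (canonical_waist (kext K) k_cont k_pos x0 Hx0) as (J & X & V & Hcan & Hsh).
      destruct (surface_of_canonical K J X V _ g s Hcan Hg Hs HQ) as (c & Z & Hrep).
      apply (waist_type_rep k_cont Hrep).
      revert Hsh. apply waist_shape_shift. apply (rep_dom Hrep).
    - intros (_ & Hw & _).
      destruct (surface_classification g Hg) as (J & X & V & Z & Hrep &
        [(x1 & Hx1 & Hsh & Hs) | [(nu0 & _ & _ & Hsh) | (sg & Hsg & Hsh & _)]]).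
      + destruct (waist_type_rep k_cont Hrep x1 Hsh) as (_ & Hw1 & _).
        now rewrite (waist_radius_unique g x0 x1 Hw Hw1).
      + destruct (axis_type_rep Hrep nu0 Hsh) as (_ & (s & Hs & E & _) & _).
        pose proof (waist_radius_le g x0 s Hw Hs). lra.
      + destruct (asymptotic_type_rep k_cont Hrep sg Hsg Hsh)
          as ((_ & e1 & _ & _ & _ & _ & Ha & _) & _).
        exfalso. now apply (waist_not_asymptotic g x0 e1). }
  destruct (canonical_waist (kext K) k_cont k_pos x0 Hx0) as (J & X & V & Hcan & _).
  destruct (canonical_profile J X V _ Hcan) as (g & Hg & s & Hs & HQ).
  exists g. split; auto. split. { apply Hchar; eauto. }
  intros g' Hg' HP. apply Hchar in HP; auto. destruct HP as (s' & Hs' & HQ').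
  exact (canonical_translate J X V _ g g' s s' Hcan Hg Hg' Hs HQ Hs' HQ').
Qed.

Lemma axis_surfaces (nu0 : R) : -1 < nu0 < 1 -> nu0 <> 0 ->
  exactly_one_surface K (axis_type nu0).
Proof.
  intros Hnu Hne.
  destruct (canonical_axis (kext K) nu0 k_cont k_pos Hnu Hne) as (J & X & V & Hcan & Hsh).
  destruct (canonical_profile J X V _ Hcan) as (g & Hg & s & Hs & HQ).
  exists g. split; auto. split.
  - destruct (surface_of_canonical K J X V _ g s Hcan Hg Hs HQ) as (c & Z & Hrep).
    apply (axis_type_rep Hrep).
    revert Hsh. apply axis_shape_shift. apply (rep_dom Hrep).
  (* The axis point of the competitor has [x = 0] and [v = nu0], so it lies on the branch of the
     canonical curve. *)
  - intros g' Hg' (_ & (s' & Hs' & E1 & E2 & _) & _).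
    apply (canonical_translate J X V _ g g' s s' Hcan Hg Hg' Hs HQ Hs').
    rewrite E1, E2. split. ring. nra.
Qed.

Lemma asymptotic_surfaces : exactly_two_surfaces K asymptotic_type.
Proof.
  assert (Hex : forall sg, sg = 1 \/ sg = -1 ->
    exists g, rotational_K_surface K g /\ asymptotic_type g /\
      (exists h, forall p, surface g p -> sg * c3 p < h) /\
      (forall y, exists p, surface g p /\ sg * c3 p < y) /\
      forall g' s', rotational_K_surface K g' -> dom g' s' ->
        xc g' s' ^ 2 - energy (kext K) (cos (th g' s')) = 0 /\ 0 < cos (th g' s') * sg ->
        vertical_translate (surface g) (surface g')).
  { intros sg Hsg.
    destruct (canonical_asymptotic (kext K) sg k_cont k_pos Hsg) as (J & X & V & Hcan & Hsh).
    destruct (canonical_profile J X V _ Hcan) as (g & Hg & s & Hs & HQ).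
    exists g. split; auto.
    destruct (surface_of_canonical K J X V _ g s Hcan Hg Hs HQ) as (c & Z & Hrep).
    destruct (asymptotic_type_rep k_cont Hrep sg Hsg) as (H1 & H2 & H3).
    { revert Hsh. apply asymptotic_shape_shift. apply (rep_dom Hrep). }
    do 3 (split; auto). intros g' s' Hg' Hs' HQ'.
    exact (canonical_translate J X V _ g g' s s' Hcan Hg Hg' Hs HQ Hs' HQ'). }
  destruct (Hex 1 (or_introl eq_refl)) as (g1 & Hg1 & T1 & _ & Low1 & U1).
  destruct (Hex (-1) (or_intror eq_refl)) as (g2 & Hg2 & T2 & (h2 & Up2) & _ & U2).
  exists g1, g2. do 4 (split; auto). split.
  (* Heights on [g1] are unbounded below, while those on [g2] exceed [- h2]; a point of [g1] below
     [- h2 - c] rules out the translation by [c]. *)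
  - intros [c Hc]. destruct (Low1 (- h2 - c)) as (p & Hp & Hlow).
    destruct p as [[a b] d]. unfold c3 in Hlow. simpl in Hlow.
    assert (H : surface g2 (a, b, d + c)).
    { apply Hc. now replace (d + c - c) with d by ring. }
    apply Up2 in H. unfold c3 in H. simpl in H. lra.
  - intros g' Hg' (_ & e1 & _ & _ & _ & _ & Ha & _).
    destruct (surface_classification g' Hg') as (J & X & V & Z & Hrep &
      [(x1 & Hx1 & Hsh & Hs) | [(nu0 & _ & _ & Hsh) | (sg & Hsg & _ & s & Hs & HQ)]]).
    + destruct (waist_type_rep k_cont Hrep x1 Hsh) as (_ & Hw1 & _).
      exfalso. now apply (waist_not_asymptotic g' x1 e1).
    + exfalso. now apply (axis_not_asymptotic g' J X V Z nu0 e1).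
    + destruct Hsg; subst sg; [left | right]; eauto.
Qed.

End Classification.

Theorem theorem3p2 :
  forall K : R -> R,
    C1_on (fun t => -1 <= t <= 1) K ->
    (forall t, -1 <= t <= 1 -> K t < 0) ->
    (forall g, rotational_K_surface K g ->
       K_surface K (rot_dom g) (rot_param g) /\
       (forall q, rot_dom g q ->
          angle_function (rot_param g) q = cos (th g (fst q)))) /\
    (forall x0, 0 < x0 -> exactly_one_surface K (waist_type x0)) /\
    (forall nu0, -1 < nu0 < 1 -> nu0 <> 0 ->
       exactly_one_surface K (axis_type nu0)) /\
    exactly_two_surfaces K asymptotic_type /\
    (forall g, rotational_K_surface K g ->
       (exists x0, 0 < x0 /\ waist_type x0 g) \/
       (exists nu0, -1 < nu0 < 1 /\ nu0 <> 0 /\ axis_type nu0 g) \/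
       asymptotic_type g) /\
    (forall g e r h, rotational_K_surface K g ->
       boundary_circumference g e r h ->
       forall p, circumference r h p ->
         singular_point (surface g) p /\
         (forall U Y, K_surface K U Y -> ~ extends_through (surface g) U Y p)).
Proof.
  intros K HC1 HK.
  pose proof (kext_continuous K HC1) as k_cont. pose proof (kext_pos K HK) as k_pos.
  split; [| split; [| split; [| split; [| split]]]].
  - intros g Hg. apply K_surface_rot; auto. intros s. now apply surface_regular.
  - intros x0. now apply waist_surfaces.
  - intros nu0. now apply axis_surfaces.
  - now apply asymptotic_surfaces.
  - intros g Hg. destruct (surface_classification K k_cont k_pos g Hg) as (J & X & V & Z & Hrep &
      [(x1 & Hx1 & Hsh & _) | [(nu0 & H1 & H2 & Hsh) | (sg & Hsg & Hsh & _)]]).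
    + left. exists x1. split; auto. now apply (waist_type_rep k_cont Hrep).
    + right; left. exists nu0. do 2 (split; auto). now apply (axis_type_rep Hrep).
    + right; right. now apply (asymptotic_type_rep k_cont Hrep sg).
  - intros g e r h Hg Hbc p Hp.
    destruct (surface_classification K k_cont k_pos g Hg) as (J & X & V & Z & Hrep & _).
    assert (cD : convex (dom g)) by exact (proj1 (proj1 (proj1 (proj1 Hg)))).
    assert (Hsing : forall U Y, immersed_surface U Y -> ~ extends_through (surface g) U Y p).
    { intros U Y imm (q & W & Uq & Eq & oW & clW & HW).
      apply (not_extending K g J X V Z k_cont k_pos Hrep cD e r h Hbc U Y imm q W); auto.
      now rewrite Eq. }
    split; [split |]; auto.
    + now apply (closure_boundary_circumference g e r h Hbc).
    + intros U Y [imm _]. auto.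
Qed.
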